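(* Let $\beta>1/2$. For every $\eta>0$ there exist initial data $(f,g)\in \dot H^{11/4}(\ln H)^{-\beta}(\mathbb{R}^2)\times \dot H^{7/4}(\ln H)^{-\beta}(\mathbb{R}^2)$, supported in a compact subset of $\mathbb{R}^2$, with $$\|f\|_{\dot H^{11/4}(\ln H)^{-\beta}}+\|g\|_{\dot H^{7/4}(\ln H)^{-\beta}}\le \eta,$$ such that the Cauchy problem in $2$ space dimensions $$\Box u=(Du)\,D^2u,\qquad (u,\partial_t u)|_{t=0}=(f,g),\qquad D=\partial_{x_1}-\partial_t,$$ has the following properties: (1) for no $T>0$ does it have a proper solution $u$ on $[0,T)\times\mathbb{R}^2$ with $(u,\partial_t u)\in C\big([0,T);\dot H^{11/4}(\ln H)^{-\beta}(\mathbb{R}^2)\times \dot H^{7/4}(\ln H)^{-\beta}(\mathbb{R}^2)\big)$; (2) in fact, for all sufficiently small $\lambda>0$, for no $T>0$ does it have a proper solution $u$ on $[0,T)\times\mathbb{R}^2$ with $(u,\partial_t u)\in C\big([0,T);\dot H^{11/4-\lambda}(\mathbb{R}^2)\times \dot H^{7/4-\lambda}(\mathbb{R}^2)\big)$.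
   Context: Coordinates are $(t,x_1,x_2)\in[0,\infty)\times\mathbb{R}^2$ and $\Box=\partial_t^2-\partial_{x_1}^2-\partial_{x_2}^2$. The Fourier transform is $\hat f(\xi)=\mathcal F(f)(\xi)=\int_{\mathbb{R}^2}f(y)e^{-2i\pi\langle y,\xi\rangle}\,dy$. Homogeneous Sobolev norm: $\|f\|_{\dot H^s(\mathbb{R}^2)}^2=\int_{\mathbb{R}^2}|\xi|^{2s}|\hat f(\xi)|^2\,d\xi$; $\dot H^s(\mathbb{R}^2)$ is the space of functions for which it is finite. Logarithmically modified homogeneous Sobolev norm: $\|f\|_{\dot H^{s}(\ln H)^{-\beta}}^2=\int_{\mathbb{R}^2}\frac{|\xi|^{2s}}{(1+|\ln|\xi||)^{2\beta}}|\hat f(\xi)|^2\,d\xi$; $\dot H^{s}(\ln H)^{-\beta}$ is the space of functions for which it is finite. Proper solution: a distributional solution $u$ of the Cauchy problem which is in addition the weak limit of a sequence of smooth solutions $u_\epsilon$ ($\epsilon\to0$) of the same equation with mollified data $(\varphi_\epsilon*f,\varphi_\epsilon*g)$, where $\varphi_\epsilon(x)=\epsilon^{-2}\varphi(x/\epsilon)$ for some $\varphi\in C_0^\infty(\mathbb{R}^2)$ with $\int\varphi=1$. *)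

(* Defs.v *)
From HB Require Import structures.
From mathcomp Require Import all_boot all_order all_algebra.
From mathcomp Require Import all_classical all_reals all_analysis.
From mathcomp Require Import complex.
Set Implicit Arguments.
Unset Strict Implicit.
Unset Printing Implicit Defensive.
Import Order.TTheory GRing.Theory Num.Theory.
Import numFieldNormedType.Exports.
Local Open Scope classical_set_scope.
Local Open Scope ring_scope.
Local Open Scope complex_scope.

(* Functions are real-valued and stand for their classes modulo null sets.
   A point of [spacetime R] is (t, x1, x2), so its time is z.1.1. *)

Notation plane R := (R * R)%type (only parsing).
Notation spacetime R := (R * R * R)%type (only parsing).

Section Measures.
Variable R : realType.

Definition leb2 : {measure set _ -> \bar R} :=
  (@lebesgue_measure R \x @lebesgue_measure R)%E.

Definition leb3 : {measure set _ -> \bar R} := (leb2 \x @lebesgue_measure R)%E.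

Definition int2 (f : plane R -> R) : R := Rintegral leb2 setT f.
Definition int3 (f : spacetime R -> R) : R := Rintegral leb3 setT f.

Definition loc_integrable2 (f : plane R -> R) : Prop :=
  forall K : set (plane R), compact K -> leb2.-integrable K (EFin \o f).

Definition loc_integrable3 (U : set (spacetime R)) (f : spacetime R -> R) :=
  forall K : set (spacetime R), compact K -> K `<=` U ->
    leb3.-integrable K (EFin \o f).

End Measures.

Section Smoothness.
Variables (R : realType) (V : normedModType R).

Fixpoint Ck (k : nat) (U : set V) (f : V -> R) : Prop :=
  (forall x, U x -> {for x, continuous f}) /\
  if k is k'.+1 then
    forall v : V, (forall x, U x -> derivable f x v) /\ Ck k' U ('D_v f)
  else True.

Definition smooth_on (U : set V) (f : V -> R) : Prop := forall k, Ck k U f.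

Definition compactly_supported_in (U : set V) (f : V -> R) : Prop :=
  exists K : set V, [/\ compact K, K `<=` U & forall x, ~ K x -> f x = 0].

Definition test_function (U : set V) (f : V -> R) : Prop :=
  smooth_on setT f /\ compactly_supported_in U f.

End Smoothness.

Section Fourier.
Variable R : realType.

Definition dot2 (x y : plane R) : R := x.1 * y.1 + x.2 * y.2.

(* The norm of the library on a product is the sup norm. *)
Definition enorm (x : plane R) : R := Num.sqrt (dot2 x x).

Definition expi (theta : R) : R[i] := cos theta +i* sin theta.

Definition cint2 (F : plane R -> R[i]) : R[i] :=
  int2 (fun x => complex.Re (F x)) +i* int2 (fun x => complex.Im (F x)).

Definition fourier_integral (f : plane R -> R) (xi : plane R) : R[i] :=
  cint2 (fun y => (f y)%:C * expi (- (2 * pi * dot2 y xi))).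

Definition tempered (f : plane R -> R) : Prop :=
  exists N : nat,
    (leb2 R).-integrable setT (fun x => (f x / (1 + enorm x) ^+ N)%:E).

(* The members of the homogeneous spaces need not be integrable, so the Fourier
   transform is extended by duality from [fourier_integral]: [F] is the
   transform of [f] as a tempered distribution, and it is a locally integrable
   function. By Fubini, [F] is a.e. [fourier_integral f] when [f] is
   integrable. *)
Definition is_fourier (f : plane R -> R) (F : plane R -> R[i]) : Prop :=
  [/\ tempered f,
      loc_integrable2 (fun xi => complex.Re (F xi)),
      loc_integrable2 (fun xi => complex.Im (F xi)) &
      forall psi : plane R -> R, test_function setT psi ->
        cint2 (fun xi => F xi * (psi xi)%:C) =
        cint2 (fun x => (f x)%:C * fourier_integral psi x)].

Definition fourier (f : plane R -> R) : plane R -> R[i] :=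
  xget (fun=> 0) [set F | is_fourier f F].

Definition weighted_norm (w : plane R -> R) (f : plane R -> R) : \bar R :=
  sqrte (\int[leb2 R]_xi
    (w xi * (complex.Re (fourier f xi) ^+ 2
           + complex.Im (fourier f xi) ^+ 2))%:E)%E.

Definition weighted_space (w : plane R -> R) : set (plane R -> R) :=
  [set f | (exists F, is_fourier f F) /\ (weighted_norm w f < +oo)%E].

Definition hdot_weight (s : R) (xi : plane R) : R := enorm xi `^ (2 * s).

Definition hdot_log_weight (s beta : R) (xi : plane R) : R :=
  enorm xi `^ (2 * s) / (1 + `| ln (enorm xi) |) `^ (2 * beta).

Definition hdot_log_norm (s beta : R) := weighted_norm (hdot_log_weight s beta).

Definition Hdot (s : R) := weighted_space (hdot_weight s).
Definition Hdot_log (s beta : R) := weighted_space (hdot_log_weight s beta).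

Definition slice (u : spacetime R -> R) (t : R) : plane R -> R :=
  fun x => u (t, x.1, x.2).

Definition continuous_curve (w : plane R -> R) (T : R) (u : spacetime R -> R) :=
  forall t0 : R, 0 <= t0 < T ->
    weighted_space w (slice u t0) /\
    (weighted_norm w (slice u t \- slice u t0)
       @[t --> within `[0, T[%classic (nbhs t0)] --> 0%E).

Definition C_Hdot (s T : R) := continuous_curve (hdot_weight s) T.
Definition C_Hdot_log (s beta T : R) :=
  continuous_curve (hdot_log_weight s beta) T.

End Fourier.

Section Wave.
Variable R : realType.
Implicit Types (u v w phi : spacetime R -> R) (f g : plane R -> R).

Definition d_t u : spacetime R -> R := 'D_((1, 0, 0) : spacetime R) u.
Definition d_1 u : spacetime R -> R := 'D_((0, 1, 0) : spacetime R) u.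
Definition d_2 u : spacetime R -> R := 'D_((0, 0, 1) : spacetime R) u.

Definition box u : spacetime R -> R :=
  d_t (d_t u) \- d_1 (d_1 u) \- d_2 (d_2 u).

Definition Dop u : spacetime R -> R := d_1 u \- d_t u.

Definition strip (T : R) : set (spacetime R) := [set z | 0 < z.1.1 < T].

Definition weak_d_t (T : R) u v : Prop :=
  loc_integrable3 (strip T) v /\
  forall phi, test_function (strip T) phi ->
    int3 (fun z => u z * d_t phi z) = - int3 (fun z => v z * phi z).

Definition weak_Dop (T : R) u w : Prop :=
  loc_integrable3 (strip T) w /\
  forall phi, test_function (strip T) phi ->
    int3 (fun z => u z * Dop phi z) = - int3 (fun z => w z * phi z).

Definition attains (T : R) u f : Prop :=
  (forall t, 0 < t < T -> loc_integrable2 (slice u t)) /\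
  forall psi : plane R -> R, test_function setT psi ->
    int2 (fun x => slice u t x * psi x) @[t --> 0^'+]
      --> int2 (fun x => f x * psi x).

(* [ut] is the time derivative of [u]; it is an argument because its time
   slices are used. With w = Du locally square integrable, the product
   (Du)(D^2 u) = w (Dw) is the distribution D(w^2)/2, whence the right-hand
   side of the weak equation (the formal transpose of D is -D). *)
Definition distributional_solution (T : R) f g u ut : Prop :=
  [/\ loc_integrable3 (strip T) u,
      weak_d_t T u ut,
      exists w, [/\ weak_Dop T u w,
        loc_integrable3 (strip T) (fun z => w z ^+ 2) &
        forall phi, test_function (strip T) phi ->
          int3 (fun z => u z * box phi z) =
          - int3 (fun z => w z ^+ 2 / 2 * Dop phi z)],
      attains T u f &
      attains T ut g].

(* A function is smooth on 0 <= t < T when it extends smoothly to t < T. *)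
Definition smooth_solution (T : R) f g u : Prop :=
  [/\ smooth_on [set z | z.1.1 < T] u,
      forall z : spacetime R, 0 <= z.1.1 < T ->
        box u z = Dop u z * Dop (Dop u) z,
      forall x, slice u 0 x = f x &
      forall x, slice (d_t u) 0 x = g x].

Definition convolution f g : plane R -> R :=
  fun x => int2 (fun y => f (x - y) * g y).

Definition mollifier (phi : plane R -> R) (eps : R) : plane R -> R :=
  fun x => eps ^- 2 * phi (eps^-1 * x.1, eps^-1 * x.2).

Definition proper_solution (T : R) f g u ut : Prop :=
  distributional_solution T f g u ut /\
  exists (phi : plane R -> R) (eps : nat -> R) (un : nat -> spacetime R -> R),
    [/\ test_function setT phi /\ int2 phi = 1,
        (forall n, 0 < eps n) /\ (eps n @[n --> \oo] --> (0 : R)),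
        forall n, smooth_solution T (convolution (mollifier phi (eps n)) f)
                                    (convolution (mollifier phi (eps n)) g)
                                    (un n) &
        forall psi, test_function (strip T) psi ->
          int3 (fun z => un n z * psi z) @[n --> \oo]
            --> int3 (fun z => u z * psi z)].

End Wave.

(* Main.v *)
(* The position data vanish and the velocity data are a superposition of packets g_k centred at
   (0, p_k), p_k = 2^-k, of width delta_k = q_k^2 in x1 and q_k in x2, and of height 2 delta_k / tau_k,
   tau_k = p_k / 16. In the disc of radius 2 tau + 62 delta about (2 tau, p), the strip |x1| <= 2 delta
   is contained in |x2 - p| <= 18 q, where the packet does not depend on x2; so there the data depend
   on x1 only, and by an energy estimate the same holds for every smooth solution in the cone over
   this disc. In that cone v = Du solves (1 - v) v_t + (1 + v) v_x = 0, hence is constant along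
   straight characteristics, and two of them cross before time tau_k. Mollification with small
   epsilon preserves all this, and tau_k is arbitrarily small: for no T are there smooth solutions
   with mollified data, hence no proper solution.
   Smallness: integrating by parts three times bounds the Fourier transform of a packet, and
   after rescaling frequencies its norm without logarithm stays bounded as q_k -> 0, whereas the
   logarithmic factor tends to zero pointwise; by dominated convergence the norm of each packet is
   as small as we please. *)
Require Import Defs.
From HB Require Import structures.
From mathcomp Require Import all_boot all_order all_algebra.
From mathcomp Require Import all_classical all_reals all_analysis.
From mathcomp Require Import measurable_realfun complex ring lra.
Import Order.TTheory GRing.Theory Num.Theory.
Import numFieldNormedType.Exports.
Local Open Scope classical_set_scope.
Local Open Scope ring_scope.
Set Implicit Arguments.
Unset Strict Implicit.
Unset Printing Implicit Defensive.

(** * Calculus of one variable and along lines *)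

(** The proportion q^2 by q of a packet is forced from two sides. Geometrically, a disc of radius
    about 2 tau whose edge lies O(delta) to the left of x1 = 0 cuts the strip |x1| <= 2 delta in
    chords of half-length of order sqrt(tau delta); a packet constant in x2 over a length of order q
    contains them when delta = q^2. Analytically, the squared norm without logarithm is of order (A
    delta q)^2 delta^(-7/2) / (delta q) with height A = 2 delta / tau, that is q / (tau^2
    sqrt(delta)): for delta = q^2 it neither grows nor decays, so 7/4 is the critical order and only
    the logarithm makes a packet small. Characteristics of Du have speed 1 + O(mu), mu = 4 delta /
    tau, and the left edge of the cone moves at speed 1 + 10 mu; up to time tau both stay within
    O(delta) of the line x1 = t, so the cone still contains the characteristics when they cross. One
    packet is only shown to break smoothness by its own time tau, which is why a sequence with tau_k
    tending to 0 is taken to exclude every T > 0. *)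

Section OneVariable.
Variable R : realType.
Implicit Types (f g : R -> R) (a b x : R).

Lemma derive_continuous f (df : R) x : is_derive x 1 f df -> {for x, continuous f}.
Proof.
by move=> [dfx _]; apply/differentiable_continuous; rewrite -derivable1_diffP.
Qed.

Lemma is_derive_eq1 f x (d d' : R) : is_derive x 1 f d -> d = d' -> is_derive x 1 f d'.
Proof. by move=> ? <-. Qed.

Lemma is_derive_add f g x (df dg : R) : is_derive x 1 f df -> is_derive x 1 g dg ->
  is_derive x 1 (fun y => f y + g y) (df + dg).
Proof. by move=> hf hg; exact: is_deriveD. Qed.

Lemma is_derive_sub f g x (df dg : R) : is_derive x 1 f df -> is_derive x 1 g dg ->
  is_derive x 1 (fun y => f y - g y) (df - dg).
Proof. by move=> hf hg; exact: is_deriveB. Qed.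

Lemma is_derive_mul f g x (df dg : R) : is_derive x 1 f df -> is_derive x 1 g dg ->
  is_derive x 1 (fun y => f y * g y) (df * g x + f x * dg).
Proof.
move=> hf hg; apply: is_derive_eq1 (is_deriveM hf hg) _.
by rewrite -![_ *: _]/(_ * _) addrC mulrC.
Qed.

Lemma is_derive_const (c : R) x : is_derive x 1 (fun=> c) 0.
Proof. exact: is_derive_cst. Qed.

Lemma is_derive_cmul (c : R) f x (df : R) : is_derive x 1 f df ->
  is_derive x 1 (fun y => c * f y) (c * df).
Proof.
by move=> hf; apply: is_derive_eq1 (is_derive_mul (is_derive_const c x) hf) _; rewrite mul0r add0r.
Qed.

Lemma is_derive_pow f n x (df : R) : is_derive x 1 f df ->
  is_derive x 1 (fun y => f y ^+ n) (n%:R * f x ^+ n.-1 * df).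
Proof.
move=> hf; have := is_deriveX n hf.
by rewrite exprfctE -[_ *: _]/(_ * _).
Qed.

Lemma continuous_on_within f (A : set R) :
  (forall x, A x -> {for x, continuous f}) -> {within A, continuous f}.
Proof. by move=> h; apply/continuous_in_subspaceT => x /[1!inE] /h. Qed.

Lemma is_derive_comp f g x (df dg : R) :
  is_derive (g x) 1 f df -> is_derive x 1 g dg -> is_derive x 1 (fun y => f (g y)) (df * dg).
Proof.
move=> hf hg.
have := @is_derive1_comp _ f g x df dg hf hg.
by [].
Qed.

(** From the second power on the kink of the positive part disappears: at 0 the difference quotient
    is at most [|h| ^+ n.+1] in size. The cone weight and the profiles are powers of positive parts
    for this reason. *)
Lemma is_derive_maxr_pow n x :
  is_derive x 1 (fun s => Num.max s 0 ^+ n.+2) (n.+2%:R * Num.max x 0 ^+ n.+1).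
Proof.
have [x0|x0|->] := ltgtP x 0.
- rewrite expr0n/= mulr0.
  apply: (@near_eq_is_derive _ _ _ (cst 0)) => //.
  near=> y; rewrite max_r ?expr0n//=.
  by apply: ltW; near: y; exact: lt_nbhsl.
- apply: (@near_eq_is_derive _ _ _ (fun s : R => s ^+ n.+2)).
    near=> y; rewrite max_l//.
    by apply: ltW; near: y; exact: lt_nbhsr.
  by apply: is_derive_eq1 (is_derive_pow n.+2 (is_derive_id x 1)) _; rewrite mulr1.
rewrite expr0n/= mulr0.
suff H : h^-1 *: ((Num.max (h *: (1 : R) + 0 : R) 0 ^+ n.+2) - Num.max (0 : R) 0 ^+ n.+2)
    @[h --> (0 : R)^'] --> (0 : R).
  by apply: DeriveDef; [apply/cvg_ex; exists 0|apply/cvg_lim].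
rewrite maxxx expr0n/=.
apply/cvgr0Pnorm_le => e e0; near=> h.
have h0 : h != 0 by near: h; exact: nbhs_dnbhs_neq.
have he : `|h| <= e by near: h; apply: dnbhs0_le.
have h1 : `|h| <= 1 by near: h; apply: dnbhs0_le.
rewrite subr0 [h *: 1]mulr1 addr0 [_ *: _]mulrC.
rewrite normrM normfV normrX ler_pdivrMr ?normr_gt0//.
have hm : `|Num.max h 0| <= `|h|.
  case: (leP h 0) => hh; last by [].
  by rewrite normr0.
apply: (@le_trans _ _ (`|h| ^+ n.+2)); first by rewrite ler_pXn2r// nnegrE.
rewrite exprS mulrC ler_wpM2r// (le_trans _ he)//.
by rewrite exprS ler_piMr// exprn_ile1.
Unshelve. all: by end_near. Qed.

Lemma ler_derive_nincr f (df : R -> R) a b : a <= b ->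
  (forall x, a <= x <= b -> is_derive x 1 f (df x)) ->
  (forall x, a <= x <= b -> df x <= 0) -> f b <= f a.
Proof.
move=> ab fd d0.
have cf : {within `[a, b], continuous f}.
  apply: continuous_on_within => x /=; rewrite in_itv/= => xab.
  exact: derive_continuous (fd x xab).
have [|c cab] := @MVT_segment _ f df a b ab _ cf.
  by move=> x /[!in_itv]/= /andP[ax xb]; apply: fd; rewrite !ltW.
move=> h; rewrite -subr_le0 h; move: cab; rewrite in_itv/= => cab.
by rewrite mulr_le0_ge0 ?d0// subr_ge0.
Qed.

(* Gronwall in the form of backward and forward uniqueness: [f^2 exp (-+ 2 K x)] is monotone. *)
Lemma ode_zero f (df : R -> R) (K a b r : R) :
  (forall x, a <= x <= b -> is_derive x 1 f (df x)) ->
  (forall x, a <= x <= b -> `|df x| <= K * `|f x|) ->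
  a <= r <= b -> f r = 0 -> forall x, a <= x <= b -> f x = 0.
Proof.
move=> fd fK rab fr0.
have key (s : R) : `|s| = 1 -> forall x y, a <= x -> x <= y -> y <= b ->
    f y ^+ 2 * expR (- s * (2 * K * y)) * s <= f x ^+ 2 * expR (- s * (2 * K * x)) * s.
  move=> s1 x y ax xy yb.
  pose F z := f z ^+ 2 * expR (- s * (2 * K * z)) * s.
  pose dF z := (2 * f z * df z * s - s ^+ 2 * (2 * K) * f z ^+ 2) * expR (- s * (2 * K * z)).
  apply: (@ler_derive_nincr F dF) => // z /andP[xz zy].
    have zab : a <= z <= b by rewrite (le_trans ax xz) (le_trans zy yb).
    have fz := fd z zab.
    have ez : is_derive z 1 (fun z => expR (- s * (2 * K * z))) (expR (- s * (2 * K * z)) * (- s * (2 * K * 1))).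
      apply: (is_derive_comp (is_derive_expR _)).
    apply: is_derive_eq1 (is_derive_mul (is_derive_mul (is_derive_pow 2 fz) ez) (is_derive_const s z)) _.
    rewrite /dF expr1; ring.
  have zab : a <= z <= b by rewrite (le_trans ax xz) (le_trans zy yb).
  rewrite /dF pmulr_lle0 ?expR_gt0//.
  have s2 : s ^+ 2 = 1 by rewrite -real_normK ?num_real// s1 expr1n.
  rewrite s2 mul1r subr_le0.
  apply: le_trans (ler_norm _) _.
  rewrite !normrM s1 mulr1 ger0_norm// -[f z ^+ 2]real_normK ?num_real//.
  rewrite -!mulrA ler_pM2l// expr2 mulrCA ler_wpM2l//.
  exact: fK.
have sq0 (c : R) (e : R) : c ^+ 2 * expR e <= 0 -> c = 0.
  rewrite pmulr_lle0 ?expR_gt0// => h.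
  by apply/eqP; rewrite -sqrf_eq0 eq_le h sqr_ge0.
move=> x /andP[ax xb]; case/andP: rab => ar rb.
have [xr|rx] := leP x r.
  have := key (-1) _ x r ax xr rb; rewrite normrN normr1 => /(_ erefl).
  by rewrite fr0 expr0n/= !mul0r !mulrN1 oppr_ge0; exact: sq0.
have := key 1 _ r x ar (ltW rx) xb; rewrite normr1 => /(_ erefl).
by rewrite fr0 expr0n/= !mul0r !mulr1; exact: sq0.
Qed.

End OneVariable.

(** * Directional derivatives, without assuming differentiability *)

Section Lines.
Variables (R : realType) (V : normedModType R).
Implicit Types (f : V -> R) (z v w : V) (U : set V).

Lemma line_derive f z v (s : R) : derivable f (z + s *: v) v ->
  is_derive s 1 (fun r : R => f (z + r *: v)) ('D_v f (z + s *: v)).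
Proof.
move=> df.
have E : (fun h : R => h^-1 *: (((fun r : R => f (z + r *: v)) \o shift s) (h *: 1) - f (z + s *: v)))
   = (fun h : R => h^-1 *: ((f \o shift (z + s *: v)) (h *: v) - f (z + s *: v))).
  apply/funext => h /=; congr (_ *: (f _ - _)).
  by rewrite [h *: 1]mulr1 scalerDl addrCA.
by apply: DeriveDef; rewrite /derivable /derive /= E.
Qed.

Lemma line_MVT f z v (h : R) : 0 <= h ->
  (forall s : R, 0 <= s <= h -> derivable f (z + s *: v) v) ->
  exists2 s : R, 0 <= s <= h & f (z + h *: v) - f z = h * 'D_v f (z + s *: v).
Proof.
move=> h0 df.
have dF (s : R) : 0 <= s <= h -> is_derive s 1 (fun r : R => f (z + r *: v)) ('D_v f (z + s *: v)).
  by move=> /df; exact: line_derive.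
have [||s] := @MVT_segment _ (fun r : R => f (z + r *: v)) (fun s => 'D_v f (z + s *: v)) 0 h h0.
- by move=> x /[!in_itv]/= /andP[x0 xh]; apply: dF; rewrite !ltW.
- by apply: continuous_on_within => x /=; rewrite in_itv/= => /dF/derive_continuous.
rewrite in_itv/= => sh; rewrite scale0r addr0 subr0 mulrC => E.
by exists s.
Qed.

(** Intermediate points of mean value theorems are not under control, so the property is wanted on
    the whole parallelogram at once, negative parameters included. *)
Lemma near_parallelogram (P : V -> Prop) z v w : (\forall x \near z, P x) ->
  \forall h \near (0 : R), forall s r : R, `|s| <= `|h| -> `|r| <= `|h| -> P (z + s *: v + r *: w).
Proof.
move=> /nbhs_ballP[e /= e0 zP].
near=> h => s r sh rh; apply: zP; rewrite -ball_normE /=.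
rewrite -addrA opprD addNKr normrN.
apply: le_lt_trans (ler_normD _ _) _; rewrite !normrZ.
apply: (@le_lt_trans _ _ (`|h| * (`|v| + `|w|))).
  by rewrite mulrDr lerD// ler_wpM2r.
have k0 : 0 < `|v| + `|w| + 1 by rewrite ltr_wpDl// addr_ge0.
apply: (@le_lt_trans _ _ (`|h| * (`|v| + `|w| + 1))).
  by rewrite ler_wpM2l// lerDl.
rewrite -ltr_pdivlMr//; near: h; apply: (@nbhs0_lt R R); exact: divr_gt0.
Unshelve. all: by end_near. Qed.

(** Schwarz's argument: the second difference of [f] over a parallelogram with sides [h v] and [h w]
    is [h ^+ 2] times a mixed derivative at some point of it, in either order of differentiation;
    both points are as close to [z] as desired. *)
Lemma derive_swap f z v w :
  (\forall x \near z, [/\ derivable f x v, derivable f x w,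
      derivable ('D_v f) x w & derivable ('D_w f) x v]) ->
  {for z, continuous ('D_w ('D_v f))} -> {for z, continuous ('D_v ('D_w f))} ->
  'D_w ('D_v f) z = 'D_v ('D_w f) z.
Proof.
move=> df c1 c2; apply/eqP; rewrite -subr_eq0 -normr_le0; apply/ler_addgt0Pl => e e0.
rewrite addr0.
have e20 : 0 < e / 2 by rewrite divr_gt0.
have I0 : \forall x \near z, [/\ derivable f x v, derivable f x w,
      derivable ('D_v f) x w & derivable ('D_w f) x v] /\
    (`|'D_w ('D_v f) z - 'D_w ('D_v f) x| <= e / 2 /\
     `|'D_v ('D_w f) z - 'D_v ('D_w f) x| <= e / 2).
  apply: filterI df _; apply: filterI.
    exact: (cvgr_dist_le _ _ c1).
  exact: (cvgr_dist_le _ _ c2).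
have H1 := near_parallelogram w v I0.
have H2 := near_parallelogram v w I0.
have /nbhs_ballP[d1 /= d10 Hd1] := H1.
have /nbhs_ballP[d2 /= d20 Hd2] := H2.
pose d := Num.min d1 d2.
have d0 : 0 < d by rewrite lt_min d10.
pose h := d / 2.
have h0 : 0 < h by rewrite divr_gt0.
have hd : h < d by rewrite /h ltr_pdivrMr// ltr_pMr// ltr1n.
have {}H1 : _ := Hd1 h _.
have {}H2 : _ := Hd2 h _.
have /H1{}H1 : ball 0 d1 h.
  by rewrite -ball_normE/= sub0r normrN gtr0_norm// (lt_le_trans hd)// ge_min lexx.
have /H2{}H2 : ball 0 d2 h.
  by rewrite -ball_normE/= sub0r normrN gtr0_norm// (lt_le_trans hd)// ge_min lexx orbT.
have hh (s : R) : 0 <= s <= h -> `|s| <= `|h|.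
  by move=> /andP[s0 sh]; rewrite !ger0_norm// ltW.
(* Mean value theorem twice: along [a] for the increment of [f] in direction [b], then along [b] for
   ['D_a f]. *)
have key (a b : V) :
   (forall s r : R, `|s| <= `|h| -> `|r| <= `|h| -> derivable f (z + s *: a + r *: b) a /\
      derivable ('D_a f) (z + s *: a + r *: b) b) ->
   exists s r : R, [/\ `|s| <= `|h|, `|r| <= `|h| &
     f (z + h *: a + h *: b) - f (z + h *: a) - (f (z + h *: b) - f z) =
     h ^+ 2 * 'D_b ('D_a f) (z + s *: a + r *: b)].
  move=> H.
  pose phi x := f (x + h *: b) - f x.
  have dphi (s : R) : 0 <= s <= h ->
      is_derive s 1 (fun r : R => phi (z + r *: a))
        ('D_a f (z + s *: a + h *: b) - 'D_a f (z + s *: a)).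
    move=> sh; rewrite /phi; apply: is_derive_sub; last first.
      apply: line_derive.
      by have [|+ _] := H s 0 (hh s sh); [rewrite normr0|rewrite scale0r addr0].
    under eq_fun do rewrite addrAC.
    rewrite [z + s *: a + _]addrAC; apply: line_derive.
    by have [] := H s h (hh _ sh) (lexx _); rewrite addrAC.
  have [||s] := @MVT_segment _ (fun r : R => phi (z + r *: a))
    (fun s => 'D_a f (z + s *: a + h *: b) - 'D_a f (z + s *: a)) 0 h (ltW h0).
  - by move=> x; rewrite in_itv/= => /andP[? ?]; apply: dphi; rewrite !ltW.
  - by apply: continuous_on_within => x /=; rewrite in_itv/= => /dphi/derive_continuous.
  rewrite in_itv/= => sh; rewrite scale0r addr0 subr0 => E.
  have [|r rh E2] := @line_MVT ('D_a f) (z + s *: a) b h (ltW h0).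
    by move=> r rh; have [] := H s r (hh _ sh) (hh _ rh).
  exists s, r; split; [exact: hh|exact: hh|].
  by rewrite -[LHS]/(phi _ - phi _) E E2 expr2; ring.
have [s [r [sh rh Es]]] := key v w (fun s r sh rh => conj (let: And4 a _ _ _ := (H2 s r sh rh).1 in a)
   (let: And4 _ _ c _ := (H2 s r sh rh).1 in c)).
have [s' [r' [sh' rh' Es']]] := key w v (fun s r sh rh => conj (let: And4 _ a _ _ := (H1 s r sh rh).1 in a)
   (let: And4 _ _ _ c := (H1 s r sh rh).1 in c)).
have [_ [I1 _]] := H2 s r sh rh.
have [_ [_ I2]] := H1 s' r' sh' rh'.
have EE : 'D_w ('D_v f) (z + s *: v + r *: w) = 'D_v ('D_w f) (z + s' *: w + r' *: v).
  apply: (@mulfI _ (h ^+ 2)); first by rewrite expf_neq0// gt_eqF.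
  have Ez : z + h *: w + h *: v = z + h *: v + h *: w by rewrite addrAC.
  apply: etrans (esym Es) _; apply: etrans _ Es'; rewrite Ez.
  by move: (f _) (f _) (f _) (f _) => A B C D; ring.
apply: le_trans (ler_distD ('D_w ('D_v f) (z + s *: v + r *: w)) _ _) _.
rewrite [leRHS]splitr; apply: lerD; first exact: I1.
by rewrite EE distrC; exact: I2.
Qed.

Lemma derive_dirZ f z v (c : R) : derivable f z v ->
  is_derive z (c *: v) f (c * 'D_v f z).
Proof.
move=> df.
have := @line_derive f z v 0; rewrite scale0r addr0 => /(_ df) H.
have H2 : is_derive (0 : R) 1 (fun r : R => f (z + (c * r) *: v)) ('D_v f z * (c * 1)).
  have Hc : is_derive (0 : R) 1 (fun r : R => c * r) (c * 1).
    exact: (@is_derive_cmul _ c id 0 1 (is_derive_id (0 : R) 1)).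
  have Hf : is_derive (c * 0) 1 (fun r : R => f (z + r *: v)) ('D_v f z) by rewrite mulr0.
  exact: (is_derive_comp Hf Hc).
have E : (fun h : R => h^-1 *: (((fun r : R => f (z + (c * r) *: v)) \o shift 0) (h *: 1) - f (z + (c * 0) *: v)))
   = (fun h : R => h^-1 *: ((f \o shift z) (h *: (c *: v)) - f z)).
  apply/funext => h /=; rewrite mulr0 scale0r !addr0; congr (_ *: (f _ - _)).
  by rewrite [h *: 1]mulr1 scalerA addrC mulrC.
case: H2; rewrite /derivable /derive /= E => h1 h2.
by apply: DeriveDef => //; rewrite /derive h2 mulr1 mulrC.
Qed.

(** Derivatives along [v] and [w] need not add for a function that is merely derivable. Here the
    increment along [v] is taken at the moving point [z + h w], and continuity of ['D_v f] brings it
    back to [z]. *)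
Lemma derive_dirD f z v w :
  (\forall x \near z, derivable f x v) -> {for z, continuous ('D_v f)} -> derivable f z w ->
  is_derive z (v + w) f ('D_v f z + 'D_w f z).
Proof.
move=> dv cv dw.
suff H : (fun h : R => h^-1 *: ((f \o shift z) (h *: (v + w)) - f z)) @ (0 : R)^' -->
    'D_v f z + 'D_w f z.
  by apply: DeriveDef; [apply/cvg_ex; eexists; exact: H|exact/cvg_lim].
have -> : (fun h : R => h^-1 *: ((f \o shift z) (h *: (v + w)) - f z)) =
  (fun h : R => h^-1 *: (f (z + h *: w + h *: v) - f (z + h *: w)) +
     h^-1 *: ((f \o shift z) (h *: w) - f z)).
  apply/funext => h /=; rewrite -scalerDr; congr (_ *: _).
  rewrite (addrC (h *: w) z) addrA subrK; congr (f _ - _).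
  by rewrite scalerDr addrC [h *: v + _]addrC addrA.
apply: cvgD; last exact: dw.
apply/cvgrPdist_le => e e0.
have I0 : \forall x \near z, derivable f x v /\ `|'D_v f z - 'D_v f x| <= e.
  by apply: filterI dv _; exact: (cvgr_dist_le _ _ cv).
have H := near_parallelogram w v I0.
apply: filter_app (cvg_within _ H); near=> h => {}H.
have h0 : h != 0 by near: h; exact: nbhs_dnbhs_neq.
have [s sh E] : exists2 s : R, `|s| <= `|h| & f (z + h *: w + h *: v) - f (z + h *: w) =
    h * 'D_v f (z + h *: w + s *: v).
  have [hp|hn] := leP 0 h.
    have [|s sh ->] := @line_MVT f (z + h *: w) v h hp.
      by move=> s /andP[s0 sh]; apply: (H h s _ _).1; rewrite // !ger0_norm.
    by exists s => //; case/andP: sh => ? ?; rewrite !ger0_norm.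
  (* For negative [h] the segment is run backwards, from its far end with length [- h]. *)
  have [||s sh] := @line_MVT f (z + h *: w + h *: v) v (- h).
  - by rewrite oppr_ge0 ltW.
  - move=> s /andP[s0 sh]; rewrite -addrA -scalerDl; apply: (H h (h + s) _ _).1 => //.
    by rewrite (ltr0_norm hn) ler0_norm; lra.
  have -> : z + h *: w + h *: v + - h *: v = z + h *: w by rewrite scaleNr addrK.
  have -> : z + h *: w + h *: v + s *: v = z + h *: w + (h + s) *: v by rewrite -addrA -scalerDl.
  move=> E.
  exists (h + s); first by case/andP: sh => ? ?; rewrite (ltr0_norm hn) ler0_norm; lra.
  by rewrite -opprB E mulNr opprK.
by rewrite E -[_ *: _]/(_ * _) mulKf//; apply: (H h s _ _).2.
Unshelve. all: by end_near. Qed.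

End Lines.

Lemma continuous_pair2 (T U V : topologicalType) (f : T -> U) (g : T -> V) (x : T) :
  {for x, continuous f} -> {for x, continuous g} -> {for x, continuous (fun y => (f y, g y))}.
Proof. by move=> cf cg; apply: (@cvg_pair _ _ _ (nbhs x) (nbhs (f x)) (nbhs (g x))). Qed.

(** * Integrals over segments that depend on a parameter *)

Section SegmentIntegral.
Variable R : realType.
Implicit Types (f g : R -> R) (a b : R).
Local Notation mu := (@lebesgue_measure R).

Lemma integrable_segment f a b :
  (forall y, a <= y <= b -> {for y, continuous f}) -> mu.-integrable `[a, b] (EFin \o f).
Proof.
move=> cf; apply: continuous_compact_integrable; first exact: segment_compact.
by apply: continuous_on_within => x /=; rewrite in_itv/=; exact: cf.
Qed.

Lemma Rintegral_segment_dist f g a b (e : R) : a <= b ->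
  (forall y, a <= y <= b -> {for y, continuous f}) ->
  (forall y, a <= y <= b -> {for y, continuous g}) ->
  (forall y, a <= y <= b -> `|f y - g y| <= e) ->
  `|\int[mu]_(y in `[a, b]) f y - \int[mu]_(y in `[a, b]) g y| <= e * (b - a).
Proof.
move=> ab cf cg fg.
have [intf intg] := (integrable_segment cf, integrable_segment cg).
have cfg y : a <= y <= b -> {for y, continuous (fun y => f y - g y)}.
  by move=> yab; apply: continuousB; [exact: cf|exact: cg].
have cnfg y : a <= y <= b -> {for y, continuous (fun y => `|f y - g y|)}.
  by move=> yab; apply: continuous_comp; [exact: cfg|exact: norm_continuous].
rewrite -RintegralB//.
apply: le_trans (le_normr_Rintegral _ _) _ => //; first exact: integrable_segment.
apply: (@le_trans _ _ (\int[mu]_(y in `[a, b]) cst e y)).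
  apply: le_Rintegral => //.
  - exact: integrable_segment.
  - by apply: integrable_segment => y _; exact: cst_continuous.
rewrite Rintegral_cst//= lebesgue_measure_itv/= lte_fin.
have [ab'|ba] := ltP a b; first by rewrite -EFinD.
by rewrite /= mulr0 mulr_ge0 ?subr_ge0// (le_trans _ (fg a _)) ?lexx.
Qed.

Lemma FTC_segment (F f : R -> R) a b : a < b ->
  (forall x, a <= x <= b -> is_derive x 1 F (f x)) ->
  (forall x, a <= x <= b -> {for x, continuous f}) ->
  \int[mu]_(x in `[a, b]) f x = F b - F a.
Proof.
move=> ab dF cf.
have cF x : a <= x <= b -> {for x, continuous F} by move/dF/derive_continuous.
rewrite /Rintegral (@continuous_FTC2 _ f F)//.
- by apply: continuous_on_within => x /=; rewrite in_itv/=; exact: cf.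
- split.
  + by move=> x /[!in_itv]/= /andP[xa xb]; have [|? _] := dF x; rewrite ?ltW.
  + by apply: cvg_at_right_filter; apply: cF; rewrite lexx ltW.
  + by apply: cvg_at_left_filter; apply: cF; rewrite lexx ltW.
- move=> x /[!in_itv]/= /andP[xa xb]; have [|_ <-] := dF x; first by rewrite !ltW.
  by rewrite derive1E.
Qed.

(** A positive value at an interior point would keep half its size on a short segment to its right,
    of positive measure. *)
Lemma Rintegral_segment_eq0 f a b :
  (forall y, a <= y <= b -> {for y, continuous f}) ->
  (forall y, a <= y <= b -> 0 <= f y) -> \int[mu]_(y in `[a, b]) f y = 0 ->
  forall x, a < x < b -> f x = 0.
Proof.
move=> cf f0 If x /andP[ax xb].
have xab : a <= x <= b by rewrite !ltW.
apply/eqP; rewrite eq_le (f0 x xab) andbT leNgt; apply/negP => fx0.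
have fx20 : 0 < f x / 2 by rewrite divr_gt0.
have N : \forall y \near x, [/\ a < y, y < b & f x / 2 <= f y].
  near=> y; split.
  - by near: y; exact: lt_nbhsr.
  - by near: y; exact: lt_nbhsl.
  - have : `|f x - f y| <= f x / 2.
      by near: y; exact: (cvgr_dist_le _ _ (cf x xab)).
    by rewrite ler_norml => /andP[_]; lra.
have /nbhs_ballP[d /= d0 Hd] := N.
have h0 : 0 < d / 2 by rewrite divr_gt0.
have Hs y : x <= y <= x + d / 2 -> [/\ a < y, y < b & f x / 2 <= f y].
  move=> /andP[xy yd]; apply: Hd; rewrite -ball_normE/= distrC ger0_norm ?subr_ge0//.
  by rewrite ltrBlDl (le_lt_trans yd)// ltrD2l ltr_pdivrMr// ltr_pMr// ltr1n.
have sub : `[x, x + d / 2] `<=` `[a, b].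
  by move=> y /=; rewrite !in_itv/= => /Hs[? ? _]; rewrite !ltW.
have cf' y : x <= y <= x + d / 2 -> {for y, continuous f}.
  by move=> /Hs[? ? _]; apply: cf; rewrite !ltW.
have := integrable_segment cf; move=> /measurable_int mf.
have E : (\int[mu]_(y in `[a, b]) (f y)%:E = 0)%E.
  have h : (\int[mu]_(y in `[a, b]) (f y)%:E)%E \is a fin_num.
    by apply: integrable_fin_num => //; exact: integrable_segment.
  by rewrite -(fineK h) -[fine _]/(Rintegral _ _ _) If.
have : (\int[mu]_(y in `[x, (x + d / 2)%R]) (cst (f x / 2) y)%:E <= \int[mu]_(y in `[a, b]) (f y)%:E)%E.
  apply: (@le_trans _ _ (\int[mu]_(y in `[x, (x + d / 2)%R]) (f y)%:E)%E).
    apply: ge0_le_integral => //.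
    - by move=> y /= _; rewrite lee_fin ltW.
    - by apply/measurable_EFinP; exact: measurable_cst.
    - by apply: (measurable_funS _ sub).
    - by move=> y /=; rewrite in_itv/= => /Hs[? ? ?]; rewrite lee_fin.
  exact: ge0_subset_integral.
rewrite E /= integral_cst//= lebesgue_measure_itv/= lte_fin ltrDl h0 -EFinD addrAC subrr add0r -EFinM lee_fin.
by rewrite leNgt mulr_gt0.
Unshelve. all: by end_near. Qed.

(** Tube lemma: compactness of the segment makes continuity in the parameter uniform in [y]. *)
Lemma near_segment_dist (T : topologicalType) (h : T * R -> R) z a b (e : R) : 0 < e ->
  (forall y, a <= y <= b -> {for (z, y), continuous h}) ->
  \forall x \near z, forall y, a <= y <= b -> `|h (x, y) - h (z, y)| <= e.
Proof.
move=> e0 ch.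
have /compact_near_coveringP cov := @segment_compact R a b.
have := cov T (nbhs z) (fun x y => `|h (x, y) - h (z, y)| <= e) _.
move=> H; apply: filterS (H _ _).
  by move=> x K y yab; apply: K => /=; rewrite in_itv.
move=> y /=; rewrite in_itv/= => yab.
have e20 : 0 < e / 2 by rewrite divr_gt0.
have := cvgr_dist_le _ _ (ch y yab) _ e20.
move=> [[A B] /= [Az By] AB].
exists (B, A) => //= -[y' x] /= [By' Ax].
have h1 := AB (x, y') (conj Ax By').
have h2 := AB (z, y') (conj (nbhs_singleton Az) By').
rewrite /= in h1 h2.
rewrite (le_trans (ler_distD (h (z, y)) _ _))// [leRHS]splitr lerD//.
by rewrite distrC.
Qed.

Lemma continuous_slice (T : topologicalType) (h : T * R -> R) z y :
  {for (z, y), continuous h} -> {for y, continuous (fun y => h (z, y))}.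
Proof.
move=> ch; apply: (@continuous_comp _ _ _ (fun y => (z, y)) h) => //.
by apply: continuous_pair2; [exact: cvg_cst|exact: cvg_id].
Qed.

Lemma continuous_Rintegral_segment (T : topologicalType) (h : T * R -> R) z a b : a <= b ->
  (\forall x \near z, forall y, a <= y <= b -> {for (x, y), continuous h}) ->
  {for z, continuous (fun x => \int[mu]_(y in `[a, b]) h (x, y))}.
Proof.
move=> ab ch; apply/cvgrPdist_le => e e0.
have k0 : 0 < b - a + 1 by rewrite ltr_wpDl// subr_ge0.
have e10 : 0 < e / (b - a + 1) by rewrite divr_gt0.
have chz := nbhs_singleton ch.
have := near_segment_dist e10 chz; apply: filterS2 ch => x chx hx.
apply: le_trans (Rintegral_segment_dist ab _ _ _) _.
- by move=> y /chz/continuous_slice; exact.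
- by move=> y /chx/continuous_slice; exact.
- by move=> y /hx; rewrite distrC; exact.
by rewrite mulrAC ler_pdivrMr// ler_wpM2l ?(ltW e0)// lerDl.
Qed.

Lemma is_derive_Rintegral_segment (h h' : R * R -> R) s a b : a <= b ->
  (\forall x \near s, forall y, a <= y <= b -> [/\ {for (x, y), continuous h},
     {for (x, y), continuous h'} & is_derive x 1 (fun r => h (r, y)) (h' (x, y))]) ->
  is_derive s 1 (fun x => \int[mu]_(y in `[a, b]) h (x, y)) (\int[mu]_(y in `[a, b]) h' (s, y)).
Proof.
move=> ab H.
have Hs := nbhs_singleton H.
have ch's y : a <= y <= b -> {for (s, y), continuous h'} by move/Hs => [].
have ch'sl y : a <= y <= b -> {for y, continuous (fun y => `|h' (s, y)|)}.
  move/ch's/continuous_slice => c.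
  by apply: continuous_comp; [exact: c|exact: norm_continuous].
have [c cab Mc] := EVT_max ab (continuous_on_within (fun x (xab : `[a, b]%classic x) => ch'sl x xab)).
(* A constant dominating [h'] for all nearby parameters: the maximum over the slice at [s], plus the
   oscillation allowed by [near_segment_dist]. *)
pose M := `|h' (s, c)| + 1.
have N : \forall x \near s, forall y, a <= y <= b -> [/\ {for (x, y), continuous h},
     is_derive x 1 (fun r => h (r, y)) (h' (x, y)) & `|h' (x, y)| <= M].
  have := near_segment_dist ltr01 ch's; apply: filterS2 H => x Hx dx y yab.
  have [? _ ?] := Hx y yab; split=> //.
  have := dx y yab => d1.
  have : `|h' (s, y)| <= `|h' (s, c)| by apply: Mc; rewrite in_itv.
  have := ler_normD (h' (x, y) - h' (s, y)) (h' (s, y)); rewrite subrK /M; lra.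
have /nbhs_ballP[d /= d0 Hd] := N.
have Hd' x : `]s - d, s + d[%classic x -> forall y, a <= y <= b ->
     [/\ {for (x, y), continuous h}, is_derive x 1 (fun r => h (r, y)) (h' (x, y)) & `|h' (x, y)| <= M].
  by move=> /=; rewrite in_itv/= => xI; apply: Hd; rewrite -ball_normE/= distrC ltr_distl.
have Is : `]s - d, s + d[%classic s by rewrite /= in_itv/= ltrBlDr !ltrDl d0.
have E x y : `]s - d, s + d[%classic x -> `[a, b]%classic y ->
    partial1of2 (fun r y => h (r, y)) x y = h' (x, y).
  move=> xI /=; rewrite in_itv/= => yab; rewrite partial1of2E.
  by have [_ [_ ->] _] := Hd' x xI y yab.
have I1 x : `]s - d, s + d[%classic x -> mu.-integrable `[a, b] (EFin \o (fun y => h (x, y))).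
  by move=> xI; apply: integrable_segment => y yab; have [/continuous_slice] := Hd' x xI y yab.
have I2 x y : `]s - d, s + d[%classic x -> `[a, b]%classic y -> derivable (fun r => h (r, y)) x 1.
  by move=> xI /=; rewrite in_itv/= => yab; have [_ []] := Hd' x xI y yab.
have I3 (y : R) : 0 <= cst M y by rewrite /= addr_ge0.
have I4 : mu.-integrable `[a, b] (EFin \o cst M).
  by apply: integrable_segment => y _; exact: cst_continuous.
have I5 x y : `]s - d, s + d[%classic x -> `[a, b]%classic y ->
    `|partial1of2 (fun r y => h (r, y)) x y| <= cst M y.
  by move=> xI yab; rewrite E//; move: yab; rewrite /= in_itv/= => /(Hd' x xI)[].
have mab : measurable (`[a, b]%classic : set (measurableTypeR R)) by [].
have dF := @derivable_under_integral R _ _ mu (fun r y => h (r, y)) _ mab s _ _ Is I1 I2 _ I3 I4 I5.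
have F' := @differentiation_under_integral R _ _ mu (fun r y => h (r, y)) _ mab s _ _ Is I1 I2 _ I3 I4 I5.
apply: DeriveDef => //.
rewrite -derive1E F'; apply: eq_Rintegral => y /[1!inE] yab.
exact: E.
Qed.

End SegmentIntegral.

(** * Energy estimate in a cone *)

Section PartialDerivatives.
Variables (R : realType) (T : R).
Implicit Types f g : spacetime R -> R.

Definition partial_t f g := forall t x y : R, t < T ->
  is_derive t 1 (fun s => f (s, x, y)) (g (t, x, y)).
Definition partial_1 f g := forall t x y : R, t < T ->
  is_derive x 1 (fun s => f (t, s, y)) (g (t, x, y)).
Definition partial_2 f g := forall t x y : R, t < T ->
  is_derive y 1 (fun s => f (t, x, s)) (g (t, x, y)).
Definition cont_before f := forall z : spacetime R, z.1.1 < T -> {for z, continuous f}.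

Lemma before_near (z : spacetime R) : z.1.1 < T -> \forall z' \near z, z'.1.1 < T.
Proof.
move=> zT.
have c : {for z, continuous (fun z' : spacetime R => z'.1.1)}.
  by apply: continuous_comp; [exact: cvg_fst|exact: cvg_fst].
have := c _ (lt_nbhsl zT).
by [].
Qed.

End PartialDerivatives.

Section DivergenceInequality.
Variables (R : realType) (T s a1 b1 a2 b2 : R) (G Gt F1 F11 F2 F22 : spacetime R -> R).
Local Notation mu := (@lebesgue_measure R).
Hypotheses (sT : s < T) (ab1 : a1 < b1) (ab2 : a2 < b2).
Hypotheses (cG : cont_before T G) (cGt : cont_before T Gt) (cF1 : cont_before T F1)
  (cF11 : cont_before T F11) (cF22 : cont_before T F22).
Hypotheses (dG : partial_t T G Gt) (dF1 : partial_1 T F1 F11) (dF2 : partial_2 T F2 F22).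
Hypothesis F1_bd : forall t y, 0 <= t <= s -> F1 (t, a1, y) = 0 /\ F1 (t, b1, y) = 0.
Hypothesis F2_bd : forall t x, 0 <= t <= s -> F2 (t, x, a2) = 0 /\ F2 (t, x, b2) = 0.
Hypothesis Gt_le : forall t x y, 0 <= t <= s -> Gt (t, x, y) <= F11 (t, x, y) + F22 (t, x, y).
Hypothesis G_ge0 : forall t x y, 0 <= t <= s -> 0 <= G (t, x, y).
Hypothesis G_0 : forall x y, G (0, x, y) = 0.

Let inner (H : spacetime R -> R) (p : R * R) := \int[mu]_(y in `[a2, b2]) H (p, y).

Let cont_inner H : cont_before T H -> forall p : R * R, p.1 < T -> {for p, continuous (inner H)}.
Proof.
move=> cH p pT; apply: continuous_Rintegral_segment; first exact: ltW.
have pn : \forall x \near p, x.1 < T.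
  have c : {for p, continuous (fun x : R * R => x.1)} by exact: cvg_fst.
  exact: (c _ (lt_nbhsl pT)).
by apply: filterS pn => x xT y _; exact: cH.
Qed.

Let cont_y H t x y : cont_before T H -> t < T -> {for y, continuous (fun y => H (t, x, y))}.
Proof. by move=> cH tT; apply: continuous_slice; exact: cH. Qed.

Let cont_x (h : R * R -> R) (t : R) : (forall p, p.1 < T -> {for p, continuous h}) -> t < T ->
  forall x, {for x, continuous (fun x => h (t, x))}.
Proof. by move=> ch tT x; apply: continuous_slice; exact: ch. Qed.

Let swap13 H t x y : cont_before T H -> t < T ->
  {for (x, y), continuous (fun p : R * R => H (t, p.1, p.2))}.
Proof.
move=> cH tT; apply: (@continuous_comp _ _ _ (fun p : R * R => (t, p.1, p.2)) H); last exact: cH.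
apply: continuous_pair2; last exact: cvg_snd.
by apply: continuous_pair2; [exact: cvg_cst|exact: cvg_fst].
Qed.

Let swap12 H t x y : cont_before T H -> t < T ->
  {for (t, y), continuous (fun p : R * R => H (p.1, x, p.2))}.
Proof.
move=> cH tT; apply: (@continuous_comp _ _ _ (fun p : R * R => (p.1, x, p.2)) H); last exact: cH.
apply: continuous_pair2; last exact: cvg_snd.
by apply: continuous_pair2; [exact: cvg_fst|exact: cvg_cst].
Qed.

Let inner_t (t x : R) : t < T -> is_derive t 1 (fun r => inner G (r, x)) (inner Gt (t, x)).
Proof.
move=> tT.
apply: (@is_derive_Rintegral_segment _ (fun p => G (p.1, x, p.2)) (fun p => Gt (p.1, x, p.2))).
  exact: ltW.
near=> r => y _.
have rT : r < T by near: r; exact: lt_nbhsl.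
by split; [exact: swap12|exact: swap12|exact: dG].
Unshelve. all: by end_near. Qed.

Let inner_1 (t x : R) : t < T -> is_derive x 1 (fun r => inner F1 (t, r)) (inner F11 (t, x)).
Proof.
move=> tT.
apply: (@is_derive_Rintegral_segment _ (fun p => F1 (t, p.1, p.2)) (fun p => F11 (t, p.1, p.2))).
  exact: ltW.
near=> r => y _.
by split; [exact: swap13|exact: swap13|exact: dF1].
Unshelve. all: by end_near. Qed.

Let E (t : R) := \int[mu]_(x in `[a1, b1]) inner G (t, x).

Let E_t (t : R) : t < T -> is_derive t 1 E (\int[mu]_(x in `[a1, b1]) inner Gt (t, x)).
Proof.
move=> tT.
apply: (@is_derive_Rintegral_segment _ (inner G) (inner Gt)); first exact: ltW.
near=> r => x _.
have rT : r < T by near: r; exact: lt_nbhsl.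
by split; [exact: cont_inner|exact: cont_inner|exact: inner_t].
Unshelve. all: by end_near. Qed.

Let inner_le (t x : R) : 0 <= t <= s -> inner Gt (t, x) <= inner F11 (t, x).
Proof.
move=> ts; have tT : t < T by case/andP: ts => _ /le_lt_trans; exact.
have Z : \int[mu]_(y in `[a2, b2]) F22 (t, x, y) = 0.
  have -> := @FTC_segment R (fun y => F2 (t, x, y)) (fun y => F22 (t, x, y)) a2 b2 ab2
    (fun y _ => dF2 x y tT) (fun y _ => cont_y cF22 tT).
  by have [-> ->] := F2_bd x ts; rewrite subrr.
rewrite -[leRHS]addr0 -Z /inner -RintegralD//.
- apply: le_Rintegral => //.
  + by apply: integrable_segment => y _; exact: cont_y.
  + apply: integrable_segment => y _; apply: continuousD; exact: cont_y.
  + by move=> y _; exact: Gt_le.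
- by apply: integrable_segment => y _; exact: cont_y.
- by apply: integrable_segment => y _; exact: cont_y.
Qed.

Let E_le0 (t : R) : 0 <= t <= s -> \int[mu]_(x in `[a1, b1]) inner Gt (t, x) <= 0.
Proof.
move=> ts; have tT : t < T by case/andP: ts => _ /le_lt_trans; exact.
have Z : \int[mu]_(x in `[a1, b1]) inner F11 (t, x) = 0.
  have -> := @FTC_segment R (fun x => inner F1 (t, x)) (fun x => inner F11 (t, x)) a1 b1 ab1
    (fun x _ => inner_1 x tT) (fun x _ => @cont_x _ _ (cont_inner cF11) tT x).
  have F0 (c : R) : (forall y, F1 (t, c, y) = 0) -> inner F1 (t, c) = 0.
    move=> F0; rewrite /inner; under eq_Rintegral do rewrite F0.
    by rewrite Rintegral_cst//= mul0r.
  by rewrite !F0 ?subrr// => y; have [] := F1_bd y ts.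
rewrite -Z; apply: le_Rintegral => //.
- by apply: integrable_segment => x _; apply: cont_x => //; exact: cont_inner.
- by apply: integrable_segment => x _; apply: cont_x => //; exact: cont_inner.
- by move=> x _; exact: inner_le.
Qed.

(** The fluxes [F1] and [F2] vanish on the sides of the box, so the time derivative of the integral
    of [G] is at most the integral of a divergence, which is 0. The integral starts from 0 and [G]
    is nonnegative, hence it stays 0. *)
Lemma divergence_inequality t x y : 0 <= t <= s -> a1 < x < b1 -> a2 < y < b2 -> G (t, x, y) = 0.
Proof.
move=> ts xab yab; have tT : t < T by case/andP: ts => _ /le_lt_trans; exact.
have E0 : E 0 = 0.
  rewrite /E; under eq_Rintegral.
    move=> x' _; rewrite /inner; under eq_Rintegral do rewrite G_0.
    rewrite Rintegral_cst//= mul0r; over.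
  by rewrite Rintegral_cst//= mul0r.
have [t0 tS] := andP ts.
have Ele : E t <= 0.
  rewrite -E0; apply: (@ler_derive_nincr _ E (fun t => \int[mu]_(x in `[a1, b1]) inner Gt (t, x))) => //.
    by move=> r /andP[_ rt]; apply: E_t; exact: le_lt_trans tT.
  by move=> r /andP[r0 rt]; apply: E_le0; rewrite r0 (le_trans rt).
have inner0 x' : 0 <= inner G (t, x') by apply: Rintegral_ge0 => y' _; exact: G_ge0.
have Eq : E t = 0.
  by apply/eqP; rewrite eq_le Ele; apply: Rintegral_ge0 => x' _; exact: inner0.
have := Rintegral_segment_eq0 _ _ Eq.
move=> /(_ _ _ x xab) I0.
apply: (@Rintegral_segment_eq0 _ (fun y => G (t, x, y)) a2 b2) => //.
- by move=> y' _; exact: cont_y.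
- by move=> y' _; exact: G_ge0.
- apply: I0 => x' _; last exact: inner0.
  by apply: cont_x => //; exact: cont_inner.
Qed.

End DivergenceInequality.

(** * Cones and estimates of quadratic forms *)

Section Cone.
Variable R : realType.

(** While [k * t <= r] this is positive exactly inside the disc of radius [r - k * t]: a polynomial
    substitute for the distance to the lateral boundary. Beyond the vertex the square is large
    again, which is why [k * t <= r] accompanies its uses. *)
Definition cone (r k c1 c2 : R) (z : spacetime R) : R :=
  (r - k * z.1.1) ^+ 2 - ((z.1.2 - c1) ^+ 2 + (z.2 - c2) ^+ 2).

Lemma sqr_le_bound (x a : R) : 0 <= a -> x ^+ 2 <= a ^+ 2 -> - a <= x <= a.
Proof.
move=> a0; rewrite -ler_norml -[leRHS]ger0_norm ?sqr_ge0// normrX.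
by rewrite -[leLHS]real_normK ?num_real// ler_pXn2r ?nnegrE// (ger0_norm a0).
Qed.

Lemma sqr_lt_bound (x a : R) : 0 <= a -> x ^+ 2 < a ^+ 2 -> - a < x < a.
Proof.
move=> a0 h; have /andP[h1 h2] := sqr_le_bound a0 (ltW h).
rewrite !lt_neqAle h1 h2 !andbT; apply/andP; split; apply/eqP => E; move: h.
  by rewrite -E sqrrN ltxx.
by rewrite E ltxx.
Qed.

Lemma cone_box r k c1 c2 t x y : 0 <= k * t <= r -> 0 < cone r k c1 c2 (t, x, y) ->
  (- (r - k * t) < x - c1 < r - k * t) && (- (r - k * t) < y - c2 < r - k * t).
Proof.
move=> /andP[t0 tr]; rewrite /cone /= subr_gt0 => h.
by apply/andP; split; apply: sqr_lt_bound; rewrite ?subr_ge0//;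
  apply: le_lt_trans h; rewrite ?lerDl ?lerDr sqr_ge0.
Qed.

Lemma cone_decr r k c1 c2 s t x y : 0 <= k -> 0 <= s -> s <= t -> k * t <= r ->
  cone r k c1 c2 (t, x, y) <= cone r k c1 c2 (s, x, y).
Proof.
move=> k0 s0 st ktr; rewrite /cone/= lerB//.
have kst : k * s <= k * t by rewrite ler_wpM2l.
by rewrite ler_pXn2r ?nnegrE ?subr_ge0// ?(le_trans kst)// lerD2l lerN2.
Qed.

(* Positivity of the energy flux through the lateral boundary: the cone has opening [1 + kappa] and
   the principal part differs from the d'Alembertian by [O(nu)], [5 nu <= kappa]. *)
Lemma flux_ge0 (nu k rho X Y v a b c : R) : 0 <= nu -> 5 * nu <= k - 1 -> k <= 2 ->
  0 < rho -> X ^+ 2 + Y ^+ 2 <= rho ^+ 2 -> `|v| <= nu ->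
  X * ((1 + v) * a * b - v * a ^+ 2) + Y * (a * c) <=
  k * rho * (((1 - v) * a ^+ 2 + (1 + v) * b ^+ 2 + c ^+ 2) / 2).
Proof.
move=> nu0 nuk k2 rho0 XY vnu.
set S := a ^+ 2 + b ^+ 2 + c ^+ 2.
have S0 : 0 <= S by rewrite !addr_ge0 ?sqr_ge0.
have h1 : 0 <= rho * S - 2 * a * (X * b + Y * c).
  rewrite -(pmulr_rge0 _ rho0).
  (* The case of the d'Alembertian itself, with opening 1: after multiplication by [rho] the
     Lagrange identity leaves squares and a multiple of [rho ^+ 2 - (X ^+ 2 + Y ^+ 2)]. *)
  have -> : rho * (rho * S - 2 * a * (X * b + Y * c)) = (rho * a - (X * b + Y * c)) ^+ 2 +
     ((rho ^+ 2 - (X ^+ 2 + Y ^+ 2)) * (b ^+ 2 + c ^+ 2) + (X * c - Y * b) ^+ 2).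
    by rewrite /S; ring.
  by rewrite !addr_ge0 ?sqr_ge0// mulr_ge0 ?subr_ge0// addr_ge0 ?sqr_ge0.
have Xr : `|X| <= rho.
  rewrite ler_norml; apply: sqr_le_bound; first exact: ltW.
  by apply: le_trans XY; rewrite lerDl sqr_ge0.
have a2 : `|b ^+ 2 - a ^+ 2| <= S.
  by rewrite ler_norml /S; have := sqr_ge0 a; have := sqr_ge0 b; have := sqr_ge0 c; lra.
have a3 : `|a * b - a ^+ 2| <= 3 / 2 * S.
  rewrite ler_norml /S; have := sqr_ge0 (a + b); have := sqr_ge0 (a - b).
  have := sqr_ge0 a; have := sqr_ge0 b; have := sqr_ge0 c; rewrite !sqrrD sqrrN mulrN mulNrn; lra.
have h2 : `|v * (b ^+ 2 - a ^+ 2)| <= nu * S by rewrite normrM ler_pM.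
have h3 : `|X * (v * (a * b - a ^+ 2))| <= rho * (nu * (3 / 2 * S)).
  by rewrite normrM ler_pM// normrM ler_pM.
have k0 : 0 <= k by lra.
have h4 : - (k * rho * (nu * S)) <= k * rho * (v * (b ^+ 2 - a ^+ 2)).
  rewrite -mulrN ler_wpM2l ?mulr_ge0 ?(ltW rho0)//.
  by move: h2; rewrite ler_norml => /andP[].
have h5 : k * rho * (nu * S) <= 2 * rho * (nu * S).
  by rewrite ler_wpM2r ?mulr_ge0// ler_wpM2r// ltW.
have h6 : rho * S * (5 * nu) <= rho * S * (k - 1) by rewrite ler_wpM2l ?mulr_ge0// ltW.
move: h3; rewrite ler_norml => /andP[_ h3].
rewrite -subr_ge0.
have -> : k * rho * (((1 - v) * a ^+ 2 + (1 + v) * b ^+ 2 + c ^+ 2) / 2) -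
    (X * ((1 + v) * a * b - v * a ^+ 2) + Y * (a * c)) =
    (rho * S - 2 * a * (X * b + Y * c)) / 2 + rho * S * (k - 1) / 2 +
    k * rho * (v * (b ^+ 2 - a ^+ 2)) / 2 - X * (v * (a * b - a ^+ 2)).
  by rewrite /S; field.
move: h1 h3 h4 h5 h6.
rewrite (_ : rho * (nu * (3 / 2 * S)) = 3 / 2 * (rho * (nu * S))); last by ring.
rewrite (_ : 2 * rho * (nu * S) = 2 * (rho * (nu * S))); last by ring.
rewrite (_ : rho * S * (5 * nu) = 5 * (rho * (nu * S))); last by ring.
lra.
Qed.

(** Up to the factor [B] the four terms are at most [S / 2], [S], [3 / 2 * S] and [S / 2], together
    below [4 * S]; and [S / 4] is below the energy density because [|v| <= 1 / 2]. Hence the factor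
    16. *)
Lemma lower_order_le (B v vt v1 q a b c : R) : `|v1| <= B -> `|vt| <= B -> `|q| <= B -> `|v| <= 1 / 2 ->
  - v1 * a * b + v1 * a ^+ 2 + q * a * (b - a) + vt * (b ^+ 2 - a ^+ 2) / 2 <=
  16 * B * (((1 - v) * a ^+ 2 + (1 + v) * b ^+ 2 + c ^+ 2) / 2).
Proof.
move=> v1B vtB qB vh.
set S := a ^+ 2 + b ^+ 2 + c ^+ 2.
have B0 : 0 <= B by rewrite (le_trans _ v1B).
have [qa qb qc] := And3 (sqr_ge0 a) (sqr_ge0 b) (sqr_ge0 c).
have ab : `|a * b| <= S / 2.
  rewrite ler_norml /S; have := sqr_ge0 (a + b); have := sqr_ge0 (a - b).
  by rewrite !sqrrD sqrrN mulrN mulNrn; lra.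
have aab : `|a * (b - a)| <= 3 / 2 * S.
  rewrite ler_norml /S; have := sqr_ge0 (a + b); have := sqr_ge0 (a - b).
  by rewrite !sqrrD sqrrN mulrN mulNrn; lra.
have a2 : `|b ^+ 2 - a ^+ 2| <= S by rewrite ler_norml /S; lra.
have aa : `|a ^+ 2| <= S by rewrite ler_norml /S; lra.
have bnd (x y M : R) : `|x| <= B -> `|y| <= M -> x * y <= B * M.
  by move=> xB yM; apply: le_trans (ler_norm _) _; rewrite normrM ler_pM.
have t1 := bnd (- v1) _ _ (eq_ind_r (fun u => u <= B) v1B (normrN v1)) ab.
have t2 := bnd v1 _ _ v1B aa.
have t3 := bnd q _ _ qB aab.
have t4 := bnd vt _ _ vtB a2.
have e4 : S / 4 <= ((1 - v) * a ^+ 2 + (1 + v) * b ^+ 2 + c ^+ 2) / 2.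
  move: vh; rewrite ler_norml => /andP[vl vr].
  have : 0 <= (1 / 2 - v) * a ^+ 2 by rewrite mulr_ge0// subr_ge0.
  have : 0 <= (1 / 2 + v) * b ^+ 2 by rewrite mulr_ge0//; lra.
  by rewrite /S; lra.
apply: (@le_trans _ _ (16 * B * (S / 4))); last by rewrite ler_wpM2l// mulr_ge0.
rewrite (_ : - v1 * a * b = - v1 * (a * b)); last by ring.
rewrite (_ : q * a * (b - a) = q * (a * (b - a))); last by ring.
move: t1 t2 t3 t4.
have : 0 <= B * S by rewrite mulr_ge0// !addr_ge0.
rewrite (_ : B * (S / 2) = B * S / 2); last by ring.
rewrite (_ : B * (3 / 2 * S) = 3 / 2 * (B * S)); last by ring.
rewrite (_ : 16 * B * (S / 4) = 4 * (B * S)); last by field.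
lra.
Qed.

Lemma bounded_before (T s a1 b1 a2 b2 : R) (f : spacetime R -> R) : s < T -> cont_before T f ->
  exists B, forall t x y, 0 <= t <= s -> a1 <= x <= b1 -> a2 <= y <= b2 -> `|f (t, x, y)| <= B.
Proof.
move=> sT cf.
pose K := (`[0, s] `*` `[a1, b1]) `*` `[a2, b2] : set (spacetime R).
have cK : compact K.
  by apply: compact_setX; [apply: compact_setX|]; exact: segment_compact.
have : compact (f @` K).
  apply: continuous_compact => //; apply/continuous_in_subspaceT => z /[1!inE] -[[/=]].
  by rewrite in_itv/= => /andP[_ zs] _ _; apply: cf; exact: le_lt_trans sT.
move=> /compact_bounded [M [_ HM]].
exists (M + 1) => t x y ts xab yab.
apply: (HM (M + 1)); first by rewrite ltrDl.
by exists (t, x, y).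
Qed.

End Cone.

Section ContBefore.
Variables (R : realType) (T : R).
Implicit Types f g : spacetime R -> R.

Lemma cont_before_add f g : cont_before T f -> cont_before T g -> cont_before T (fun z => f z + g z).
Proof. by move=> cf cg z zT; apply: continuousD; [exact: cf|exact: cg]. Qed.
Lemma cont_before_sub f g : cont_before T f -> cont_before T g -> cont_before T (fun z => f z - g z).
Proof. by move=> cf cg z zT; apply: continuousB; [exact: cf|exact: cg]. Qed.
Lemma cont_before_opp f : cont_before T f -> cont_before T (fun z => - f z).
Proof. by move=> cf z zT; apply: continuousN; exact: cf. Qed.
Lemma cont_before_mul f g : cont_before T f -> cont_before T g -> cont_before T (fun z => f z * g z).
Proof. by move=> cf cg z zT; apply: continuousM; [exact: cf|exact: cg]. Qed.
Lemma cont_before_cst (c : R) : cont_before T (fun=> c).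
Proof. by move=> z zT; exact: cst_continuous. Qed.
Lemma cont_before_comp (h : R -> R) f : continuous h -> cont_before T f -> cont_before T (fun z => h (f z)).
Proof. by move=> ch cf z zT; apply: (@continuous_comp _ _ _ f h); [exact: cf|exact: ch]. Qed.
Lemma cont_before_pow f n : cont_before T f -> cont_before T (fun z => f z ^+ n).
Proof.
move=> cf; apply: (@cont_before_comp (fun x => x ^+ n)) cf => x.
exact: exprn_continuous.
Qed.
Lemma cont_before_t : cont_before T (fun z => z.1.1).
Proof. by move=> z zT; apply: continuous_comp; exact: cvg_fst. Qed.
Lemma cont_before_1 : cont_before T (fun z => z.1.2).
Proof. by move=> z zT; apply: continuous_comp; [exact: cvg_fst|exact: cvg_snd]. Qed.
Lemma cont_before_2 : cont_before T (fun z => z.2).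
Proof. by move=> z zT; exact: cvg_snd. Qed.

Lemma maxr0_continuous : continuous (fun x : R => Num.max x 0).
Proof.
move=> x; have -> : (fun x : R => Num.max x 0) = (fun x => (x + `|x|) / 2).
  apply/funext => y; have [y0|y0] := leP y 0; last by rewrite ger0_norm ?ltW//; field.
  by rewrite ler0_norm//; field.
apply: cvgM; last exact: cvg_cst.
by apply: cvgD; [exact: cvg_id|exact: norm_continuous].
Qed.

End ContBefore.

Ltac cont_before_tac := cbv beta; lazymatch goal with
  | |- cont_before _ (fun z => @?f z + @?g z) =>
      refine (@cont_before_add _ _ f g _ _); cont_before_tac
  | |- cont_before _ (fun z => - @?f z) => refine (@cont_before_opp _ _ f _); cont_before_tac
  | |- cont_before _ (fun z => @?f z * @?g z) =>
      refine (@cont_before_mul _ _ f g _ _); cont_before_tac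
  | |- cont_before _ (fun z => @?f z ^+ ?n) => refine (@cont_before_pow _ _ f n _); cont_before_tac
  | |- cont_before _ (fun z => expR (@?f z)) =>
      refine (@cont_before_comp _ _ expR f (@continuous_expR _) _); cont_before_tac
  | |- cont_before _ (fun z => Num.max (@?f z) 0) =>
      refine (@cont_before_comp _ _ _ f (@maxr0_continuous _) _); cont_before_tac
  | |- cont_before _ (fun z => z.1.1) => exact (@cont_before_t _ _)
  | |- cont_before _ (fun z => z.1.2) => exact (@cont_before_1 _ _)
  | |- cont_before _ (fun z => z.2) => exact (@cont_before_2 _ _)
  | |- cont_before ?T (fun=> ?c) => exact (@cont_before_cst _ T c)
  | |- cont_before _ (fun z => ?f z) => match goal with H : cont_before _ f |- _ => exact H end
  | H : cont_before _ ?f |- cont_before _ ?f => exact H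
  end.

Section Energy.
Variables (R : realType) (T s r k c1 c2 nu : R).
Variables (v vt v1 q wt w1 w2 wtt wt1 wt2 w11 w22 : spacetime R -> R).
Hypotheses (s0 : 0 <= s) (sT : s < T) (nu0 : 0 <= nu) (nu_half : nu <= 1 / 2)
  (nuk : 5 * nu <= k - 1) (k2 : k <= 2) (ksr : k * s < r).
Hypotheses (cv : cont_before T v) (cvt : cont_before T vt) (cv1 : cont_before T v1)
  (cwt : cont_before T wt) (cw1 : cont_before T w1) (cw2 : cont_before T w2)
  (cwtt : cont_before T wtt) (cwt1 : cont_before T wt1) (cwt2 : cont_before T wt2)
  (cw11 : cont_before T w11) (cw22 : cont_before T w22).
Hypotheses (v_t : partial_t T v vt) (v_1 : partial_1 T v v1)
  (wt_t : partial_t T wt wtt) (w1_t : partial_t T w1 wt1) (w2_t : partial_t T w2 wt2)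
  (wt_1 : partial_1 T wt wt1) (w1_1 : partial_1 T w1 w11)
  (wt_2 : partial_2 T wt wt2) (w2_2 : partial_2 T w2 w22).
(** The linear equation for a difference of two solutions: [v] is Du for one of them and [q] is D^2
    u for the other. *)
Hypothesis wave : forall z : spacetime R, 0 <= z.1.1 <= s ->
  wtt z - w11 z - w22 z = v z * (w11 z - 2 * wt1 z + wtt z) + q z * (w1 z - wt z).
Local Notation psi := (cone r k c1 c2).
Hypothesis v_small : forall z : spacetime R, 0 <= z.1.1 <= s -> 0 < psi z -> `|v z| <= nu.
Hypothesis init : forall x y, 0 < psi (0, x, y) ->
  [/\ wt (0, x, y) = 0, w1 (0, x, y) = 0 & w2 (0, x, y) = 0].

Let k0 : 0 < k. Proof. by move: nu0 nuk => a b; lra. Qed.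

Let m z := Num.max (psi z) 0.
(** Energy density and fluxes obtained by multiplying the equation by [wt]: the time derivative of
    [e] is the divergence of [(P1, P2)] plus [low], and [low] contains no second derivative of the
    difference. *)
Let e z := ((1 - v z) * wt z ^+ 2 + (1 + v z) * w1 z ^+ 2 + w2 z ^+ 2) / 2.
Let P1 z := (1 + v z) * wt z * w1 z - v z * wt z ^+ 2.
Let P2 z := wt z * w2 z.
Let et z := (- vt z * wt z ^+ 2 + (1 - v z) * (2 * wt z * wtt z) + vt z * w1 z ^+ 2 +
  (1 + v z) * (2 * w1 z * wt1 z) + 2 * w2 z * wt2 z) / 2.
Let P11 z := v1 z * wt z * w1 z + (1 + v z) * (wt1 z * w1 z + wt z * w11 z) -
  v1 z * wt z ^+ 2 - 2 * v z * wt z * wt1 z.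
Let P22 z := wt2 z * w2 z + wt z * w22 z.
Let low z := - v1 z * wt z * w1 z + v1 z * wt z ^+ 2 + q z * wt z * (w1 z - wt z) +
  vt z * (w1 z ^+ 2 - wt z ^+ 2) / 2.

Let et_eq z : 0 <= z.1.1 <= s -> et z = P11 z + P22 z + low z.
Proof.
move=> zs; have E : (1 - v z) * wtt z = (1 + v z) * w11 z + w22 z - 2 * v z * wt1 z + q z * (w1 z - wt z).
  have W := wave zs; apply/eqP; rewrite -subr_eq0; apply/eqP.
  transitivity (wtt z - w11 z - w22 z - (v z * (w11 z - 2 * wt1 z + wtt z) + q z * (w1 z - wt z))).
    by ring.
  by rewrite W subrr.
rewrite /et /P11 /P22 /low.
transitivity (((1 - v z) * wtt z) * wt z + (- vt z * wt z ^+ 2 + vt z * w1 z ^+ 2 +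
  (1 + v z) * (2 * w1 z * wt1 z) + 2 * w2 z * wt2 z) / 2); first by field.
by rewrite E; field.
Qed.

Variable K : R.
(** The square makes the weight continuously differentiable across the boundary of the cone; the
    exponential rate [K] is there to absorb [low]. *)
Let chi z := expR (- K * z.1.1) * m z ^+ 2.
Let chit z := expR (- K * z.1.1) * (2 * m z * (- 2 * k * (r - k * z.1.1)) - K * m z ^+ 2).
Let chi1 z := expR (- K * z.1.1) * (2 * m z * (- 2 * (z.1.2 - c1))).
Let chi2 z := expR (- K * z.1.1) * (2 * m z * (- 2 * (z.2 - c2))).

Let chi_t : partial_t T chi chit.
Proof.
move=> t x y tT.
have dexp : is_derive t 1 (fun s => expR (- K * s)) (expR (- K * t) * (- K * 1)).
  by apply: (is_derive_comp (is_derive_expR _)).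
have dpsi : is_derive t 1 (fun s => psi (s, x, y)) (2 * (r - k * t) ^+ 1 * (0 - k * 1) - 0).
  exact: (is_derive_sub (is_derive_pow 2 (is_derive_sub (is_derive_const r t)
    (is_derive_cmul k (is_derive_id t 1)))) (is_derive_const ((x - c1) ^+ 2 + (y - c2) ^+ 2) t)).
have dm := is_derive_comp (is_derive_maxr_pow 0 _) dpsi.
apply: is_derive_eq1 (is_derive_mul dexp dm) _.
by rewrite /chit /m /= expr1; ring.
Qed.

Let chi_1 : partial_1 T chi chi1.
Proof.
move=> t x y tT.
have dpsi : is_derive x 1 (fun s => psi (t, s, y)) (0 - (2 * (x - c1) ^+ 1 * (1 - 0) + 0)).
  exact: (is_derive_sub (is_derive_const ((r - k * t) ^+ 2) x) (is_derive_add (is_derive_pow 2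
    (is_derive_sub (is_derive_id x 1) (is_derive_const c1 x))) (is_derive_const ((y - c2) ^+ 2) x))).
have dm := is_derive_comp (is_derive_maxr_pow 0 _) dpsi.
apply: is_derive_eq1 (is_derive_cmul (expR (- K * t)) dm) _.
by rewrite /chi1 /m /= expr1; ring.
Qed.

Let chi_2 : partial_2 T chi chi2.
Proof.
move=> t x y tT.
have dpsi : is_derive y 1 (fun s => psi (t, x, s)) (0 - (0 + 2 * (y - c2) ^+ 1 * (1 - 0))).
  exact: (is_derive_sub (is_derive_const ((r - k * t) ^+ 2) y) (is_derive_add
    (is_derive_const ((x - c1) ^+ 2) y) (is_derive_pow 2
    (is_derive_sub (is_derive_id y 1) (is_derive_const c2 y))))).
have dm := is_derive_comp (is_derive_maxr_pow 0 _) dpsi.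
apply: is_derive_eq1 (is_derive_cmul (expR (- K * t)) dm) _.
by rewrite /chi2 /m /= expr1; ring.
Qed.

Let e_t : partial_t T e et.
Proof.
move=> t x y tT.
have [dv dwt dw1 dw2] := And4 (v_t x y tT) (wt_t x y tT) (w1_t x y tT) (w2_t x y tT).
have d1 := is_derive_mul (is_derive_sub (is_derive_const 1 t) dv) (is_derive_pow 2 dwt).
have d2 := is_derive_mul (is_derive_add (is_derive_const 1 t) dv) (is_derive_pow 2 dw1).
have d3 := is_derive_add (is_derive_add d1 d2) (is_derive_pow 2 dw2).
apply: is_derive_eq1 (is_derive_mul d3 (is_derive_const 2^-1 t)) _.
by rewrite /et /= !expr1; field.
Qed.

Let P1_1 : partial_1 T P1 P11.
Proof.
move=> t x y tT.
have [dv dwt dw1] := And3 (v_1 x y tT) (wt_1 x y tT) (w1_1 x y tT).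
have d1 := is_derive_mul (is_derive_mul (is_derive_add (is_derive_const 1 x) dv) dwt) dw1.
apply: is_derive_eq1 (is_derive_sub d1 (is_derive_mul dv (is_derive_pow 2 dwt))) _.
by rewrite /P11 /= !expr1; ring.
Qed.

Let P2_2 : partial_2 T P2 P22.
Proof. by move=> t x y tT; exact: is_derive_mul (wt_2 x y tT) (w2_2 x y tT). Qed.

Let G z := chi z * e z.
Let Gt z := chit z * e z + chi z * et z.
Let F1 z := chi z * P1 z.
Let F11 z := chi1 z * P1 z + chi z * P11 z.
Let F2 z := chi z * P2 z.
Let F22 z := chi2 z * P2 z + chi z * P22 z.

Let cm : cont_before T m.
Proof. rewrite /m /cone; cont_before_tac. Qed.

Let energy_decay (B : R) : K = 16 * B ->
  (forall t x y, 0 <= t <= s -> c1 - r <= x <= c1 + r -> c2 - r <= y <= c2 + r ->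
    [/\ `|v1 (t, x, y)| <= B, `|vt (t, x, y)| <= B & `|q (t, x, y)| <= B]) ->
  forall t x y, 0 <= t <= s -> 0 < psi (t, x, y) -> G (t, x, y) = 0.
Proof.
move=> KB bnd.
have r0 : 0 < r by apply: le_lt_trans ksr; rewrite mulr_ge0// ltW.
have ks t : 0 <= t <= s -> 0 <= k * t <= r.
  move=> /andP[t0 ts]; rewrite mulr_ge0 ?(ltW k0)//= (le_trans _ (ltW ksr))//.
  by rewrite ler_wpM2l// ltW.
have psi_box t x y : 0 <= t <= s -> 0 < psi (t, x, y) ->
    (c1 - r < x < c1 + r) && (c2 - r < y < c2 + r).
  move=> ts ps; have := cone_box (ks t ts) ps => /andP[/andP[? ?] /andP[? ?]].
  by have /andP[? ?] := ks t ts; apply/andP; split; apply/andP; split; lra.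
have m0 t x y : 0 <= t <= s -> ~~ ((c1 - r < x < c1 + r) && (c2 - r < y < c2 + r)) -> m (t, x, y) = 0.
  move=> ts /negP nb; rewrite /m max_r// leNgt; apply/negP => ps.
  by apply: nb; exact: (psi_box t).
move=> t x y ts ps.
have /andP[xb yb] := psi_box t x y ts ps.
apply: (@divergence_inequality R T s (c1 - r) (c1 + r) (c2 - r) (c2 + r) G Gt F1 F11 F2 F22) => //.
- by lra.
- by lra.
- rewrite /G /chi /e; cont_before_tac.
- rewrite /Gt /chit /chi /e /et; cont_before_tac.
- rewrite /F1 /chi /P1; cont_before_tac.
- rewrite /F11 /chi /chi1 /P1 /P11; cont_before_tac.
- rewrite /F22 /chi /chi2 /P2 /P22; cont_before_tac.
- by move=> t' x' y' tT; apply: is_derive_mul; [exact: chi_t|exact: e_t].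
- by move=> t' x' y' tT; apply: is_derive_mul; [exact: chi_1|exact: P1_1].
- by move=> t' x' y' tT; apply: is_derive_mul; [exact: chi_2|exact: P2_2].
- move=> t' y' ts'; by rewrite /F1 /chi !m0 ?ltxx ?andbF// expr0n/= !mulr0 !mul0r.
- move=> t' x' ts'; by rewrite /F2 /chi !m0 ?ltxx ?andbF// expr0n/= !mulr0 !mul0r.
- move=> t' x' y' ts'; rewrite /Gt /F11 /F22 et_eq//.
  set z := (t', x', y').
  have [p0|p0] := leP (psi z) 0.
    have mz : m z = 0 by rewrite /m max_r.
    by rewrite /chit /chi1 /chi2 /chi mz expr0n/= !(mulr0, mul0r, addr0, subr0).
  have mz : m z = psi z by rewrite /m max_l// ltW.
  have /andP[/andP[xb1 xb2] /andP[yb1 yb2]] := psi_box _ _ _ ts' p0.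
  have [] := bnd t' x' y' ts'; [by rewrite !ltW|by rewrite !ltW|move=> b1 b2 b3].
  have vz := v_small (z := z) ts' p0.
  rewrite -subr_le0.
  (* The second derivatives cancel. The first summand is nonpositive by the choice of [K]; the
     second because minus half the gradient of [psi] is [(k (r - k t), x - c1, y - c2)], to which
     [flux_ge0] applies. *)
  have -> : chit z * e z + chi z * (P11 z + P22 z + low z) -
     (chi1 z * P1 z + chi z * P11 z + (chi2 z * P2 z + chi z * P22 z)) =
     expR (- K * z.1.1) * (m z ^+ 2 * (low z - K * e z) + 4 * m z * ((z.1.2 - c1) * P1 z + (z.2 - c2) * P2 z -
       k * (r - k * z.1.1) * e z)).
    by rewrite /chit /chi /chi1 /chi2; ring.
  rewrite pmulr_rle0 ?expR_gt0//.
  have mz0 : 0 < m z by rewrite mz.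
  have l0 : low z - K * e z <= 0.
    by rewrite subr_le0 KB; apply: lower_order_le => //; exact: le_trans nu_half.
  have f0 : (z.1.2 - c1) * P1 z + (z.2 - c2) * P2 z - k * (r - k * z.1.1) * e z <= 0.
    rewrite subr_le0; apply: (@flux_ge0 _ nu) => //.
      rewrite subr_gt0 (le_lt_trans _ ksr)// ler_wpM2l ?(ltW k0)//.
      by case/andP: ts'.
    by rewrite -subr_ge0; exact: ltW.
  have h1 : m z ^+ 2 * (low z - K * e z) <= 0 by rewrite mulr_ge0_le0// exprn_ge0// ltW.
  have h2 := mulr_ge0_le0 (mulr_ge0 (ler0n R 4) (ltW mz0)) f0.
  by rewrite -[leRHS]addr0 lerD.
- move=> t' x' y' ts'; rewrite /G /chi.
  set z := (t', x', y').
  have [p0|p0] := leP (psi z) 0.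
    have mz : m z = 0 by rewrite /m max_r.
    by rewrite mz expr0n/= mulr0 mul0r.
  have vz := v_small (z := z) ts' p0.
  apply: mulr_ge0; first by rewrite mulr_ge0 ?expR_ge0 ?sqr_ge0.
  have : `|v z| <= 1 / 2 by exact: le_trans nu_half.
  rewrite ler_norml => /andP[va vb].
  rewrite /e divr_ge0// !addr_ge0 ?sqr_ge0// mulr_ge0 ?sqr_ge0//; lra.
- move=> x' y'; rewrite /G /chi /e.
  have [p0|p0] := leP (psi (0, x', y')) 0.
    have mz : m (0, x', y') = 0 by rewrite /m max_r.
    by rewrite mz expr0n/= mulr0 mul0r.
  have [-> -> ->] := init p0.
  by rewrite expr0n/= !mulr0 !addr0 mul0r mulr0.
Qed.

Lemma energy_uniqueness_weight (B : R) t x y : K = 16 * B ->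
  (forall t x y, 0 <= t <= s -> c1 - r <= x <= c1 + r -> c2 - r <= y <= c2 + r ->
    [/\ `|v1 (t, x, y)| <= B, `|vt (t, x, y)| <= B & `|q (t, x, y)| <= B]) ->
  0 <= t <= s -> 0 < psi (t, x, y) -> wt (t, x, y) = 0.
Proof.
move=> KB bnd ts ps; have := energy_decay KB bnd ts ps.
have mz : m (t, x, y) = psi (t, x, y) by rewrite /m max_l// ltW.
rewrite /G /chi => /eqP; rewrite mulf_eq0 mulf_eq0 gt_eqF ?expR_gt0//= mz sqrf_eq0 gt_eqF//=.
rewrite /e => /eqP ez.
have : `|v (t, x, y)| <= 1 / 2 by apply: le_trans nu_half; exact: v_small.
rewrite ler_norml => /andP[va vb].
have h1 : 0 <= (1 / 2 - v (t, x, y)) * wt (t, x, y) ^+ 2 by rewrite mulr_ge0 ?sqr_ge0// subr_ge0.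
have h2 : 0 <= (1 + v (t, x, y)) * w1 (t, x, y) ^+ 2 by rewrite mulr_ge0 ?sqr_ge0//; lra.
have h3 := sqr_ge0 (w2 (t, x, y)); have h4 := sqr_ge0 (wt (t, x, y)).
by apply/eqP; rewrite -sqrf_eq0 eq_le h4 andbT; lra.
Qed.

End Energy.

(** Compactness of the box around the cone supplies a common bound [B] for [v1], [vt] and [q], and
    the rate of the weight is then [16 * B]. *)
Lemma energy_uniqueness (R : realType) (T s r k c1 c2 nu : R)
    (v vt v1 q wt w1 w2 wtt wt1 wt2 w11 w22 : spacetime R -> R) :
  0 <= s -> s < T -> 0 <= nu -> nu <= 1 / 2 -> 5 * nu <= k - 1 -> k <= 2 -> k * s < r ->
  [/\ cont_before T v, cont_before T vt, cont_before T v1 & cont_before T q] ->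
  [/\ cont_before T wt, cont_before T w1 & cont_before T w2] ->
  [/\ cont_before T wtt, cont_before T wt1 & cont_before T wt2] ->
  cont_before T w11 -> cont_before T w22 ->
  partial_t T v vt -> partial_1 T v v1 ->
  [/\ partial_t T wt wtt, partial_t T w1 wt1 & partial_t T w2 wt2] ->
  partial_1 T wt wt1 -> partial_1 T w1 w11 -> partial_2 T wt wt2 -> partial_2 T w2 w22 ->
  (forall z : spacetime R, 0 <= z.1.1 <= s ->
    wtt z - w11 z - w22 z = v z * (w11 z - 2 * wt1 z + wtt z) + q z * (w1 z - wt z)) ->
  (forall z : spacetime R, 0 <= z.1.1 <= s -> 0 < cone r k c1 c2 z -> `|v z| <= nu) ->
  (forall x y, 0 < cone r k c1 c2 (0, x, y) ->
    [/\ wt (0, x, y) = 0, w1 (0, x, y) = 0 & w2 (0, x, y) = 0]) ->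
  forall t x y, 0 <= t <= s -> 0 < cone r k c1 c2 (t, x, y) -> wt (t, x, y) = 0.
Proof.
move=> s0 sT nu0 nuh nuk k2 ksr [cv cvt cv1 cq] [cwt cw1 cw2] [cwtt cwt1 cwt2] cw11 cw22.
move=> v_t v_1 [wt_t w1_t w2_t] wt_1 w1_1 wt_2 w2_2 wave vs init t x y ts ps.
have [B1 H1] := bounded_before (c1 - r) (c1 + r) (c2 - r) (c2 + r) sT cv1.
have [B2 H2] := bounded_before (c1 - r) (c1 + r) (c2 - r) (c2 + r) sT cvt.
have [B3 H3] := bounded_before (c1 - r) (c1 + r) (c2 - r) (c2 + r) sT cq.
pose B := Num.max B1 (Num.max B2 B3).
apply: (@energy_uniqueness_weight R T s r k c1 c2 nu v vt v1 q wt w1 w2 wtt wt1 wt2 w11 w22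
  s0 sT nu0 nuh nuk k2 ksr cv cvt cv1 cwt cw1 cw2 cwtt cwt1 cwt2 cw11 cw22 v_t v_1 wt_t w1_t w2_t
  wt_1 w1_1 wt_2 w2_2 wave vs init (16 * B) B) => // t' x' y' ts' xb yb.
by split; [apply: le_trans (H1 _ _ _ ts' xb yb) _|apply: le_trans (H2 _ _ _ ts' xb yb) _
  |apply: le_trans (H3 _ _ _ ts' xb yb) _]; rewrite /B !le_max lexx ?orbT.
Qed.

(** * Formation of a shock *)

Section SmoothBefore.
Variables (R : realType) (T : R).
Local Notation before := [set z : spacetime R | z.1.1 < T].
Implicit Types f : spacetime R -> R.

Lemma smooth_cont f : smooth_on before f -> cont_before T f.
Proof. by move=> /(_ 0%N)[cf _] z zT; exact: cf. Qed.

Lemma smooth_derivable f v z : smooth_on before f -> z.1.1 < T -> derivable f z v.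
Proof. by move=> /(_ 1%N)[_ /(_ v)[df _]] zT; exact: df. Qed.

Lemma smooth_derive f v : smooth_on before f -> smooth_on before ('D_v f).
Proof. by move=> sf n; have [_ /(_ v)[]] := sf n.+1. Qed.

Lemma smooth_partial_t f : smooth_on before f -> partial_t T f (d_t f).
Proof.
move=> sf t x y tT.
have := @line_derive R _ f (0, x, y) (1, 0, 0) t.
have E (r : R) : (0, x, y) + r *: (1, 0, 0) = (r, x, y) :> spacetime R.
  by congr (_, _, _); rewrite /= ?[_ *: _]mulr0 ?[_ *: _]mulr1 ?addr0 ?add0r.
rewrite E => H; under eq_fun do rewrite -E.
by apply: H; exact: smooth_derivable.
Qed.

Lemma smooth_partial_1 f : smooth_on before f -> partial_1 T f (d_1 f).
Proof.
move=> sf t x y tT.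
have := @line_derive R _ f (t, 0, y) (0, 1, 0) x.
have E (r : R) : (t, 0, y) + r *: (0, 1, 0) = (t, r, y) :> spacetime R.
  by congr (_, _, _); rewrite /= ?[_ *: _]mulr0 ?[_ *: _]mulr1 ?addr0 ?add0r.
rewrite E => H; under eq_fun do rewrite -E.
by apply: H; exact: smooth_derivable.
Qed.

Lemma smooth_partial_2 f : smooth_on before f -> partial_2 T f (d_2 f).
Proof.
move=> sf t x y tT.
have := @line_derive R _ f (t, x, 0) (0, 0, 1) y.
have E (r : R) : (t, x, 0) + r *: (0, 0, 1) = (t, x, r) :> spacetime R.
  by congr (_, _, _); rewrite /= ?[_ *: _]mulr0 ?[_ *: _]mulr1 ?addr0 ?add0r.
rewrite E => H; under eq_fun do rewrite -E.
by apply: H; exact: smooth_derivable.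
Qed.

Lemma smooth_swap f v w z : smooth_on before f -> z.1.1 < T ->
  'D_w ('D_v f) z = 'D_v ('D_w f) z.
Proof.
move=> sf zT; apply: derive_swap.
- apply: filterS (before_near zT) => x xT.
  by split; apply: smooth_derivable => //; exact: smooth_derive.
- by apply: smooth_cont => //; do 2!apply: smooth_derive.
- by apply: smooth_cont => //; do 2!apply: smooth_derive.
Qed.

(** A chain rule: [smooth_on] speaks of directional derivatives only, so the direction [(1, c, 0)]
    is decomposed by [derive_dirD], using continuity of [d_t f]. *)
Lemma smooth_line f (c t x y : R) : smooth_on before f -> t < T ->
  is_derive t 1 (fun s => f (s, x + c * s, y))
    (d_t f (t, x + c * t, y) + c * d_1 f (t, x + c * t, y)).
Proof.
move=> sf tT.
have := @line_derive R _ f (0, x, y) (1, c, 0) t.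
have E (r : R) : (0, x, y) + r *: (1, c, 0) = (r, x + c * r, y) :> spacetime R.
  congr (_, _, _); rewrite /= ?[_ *: _]mulr0 ?[_ *: _]mulr1 ?addr0 ?add0r//.
  by rewrite [r *: c]mulrC.
rewrite E => H; under eq_fun do rewrite -E.
have zT : (t, x + c * t, y).1.1 < T by [].
set z := (t, x + c * t, y) in zT H *.
apply: is_derive_eq1 (H _) _; first exact: smooth_derivable.
have Ev : (1, c, 0) = (1, 0, 0) + c *: (0, 1, 0) :> spacetime R.
  by congr (_, _, _); rewrite /= ?[_ *: _]mulr0 ?[_ *: _]mulr1 ?addr0 ?add0r.
have d1 := derive_dirZ c (@smooth_derivable f ((0, 1, 0) : spacetime R) z sf zT).
have [d1d d1e] := d1.
have N : \forall x \near z, derivable f x ((1, 0, 0) : spacetime R).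
  by apply: filterS (before_near zT) => z' z'T; apply: (smooth_derivable sf z'T).
have C : {for z, continuous ('D_((1, 0, 0) : spacetime R) f)}.
  exact: (smooth_cont (@smooth_derive f ((1, 0, 0) : spacetime R) sf) zT).
have [_ D] := derive_dirD N C d1d.
by rewrite Ev D d1e.
Qed.

End SmoothBefore.

Lemma smooth_wave_expanded (R : realType) (T : R) (u : spacetime R -> R) z :
  smooth_on [set z : spacetime R | z.1.1 < T] u -> z.1.1 < T ->
  box u z = Dop u z * Dop (Dop u) z ->
  d_t (d_t u) z - d_1 (d_1 u) z - d_2 (d_2 u) z =
  (d_1 u z - d_t u z) * (d_1 (d_1 u) z - 2 * d_t (d_1 u) z + d_t (d_t u) z).
Proof.
move=> su zT E; apply: etrans E _; apply: (congr1 (fun a => _ * a)).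
have su1 : smooth_on [set z : spacetime R | z.1.1 < T] (d_1 u) by exact: smooth_derive.
have sut : smooth_on [set z : spacetime R | z.1.1 < T] (d_t u) by exact: smooth_derive.
have d1 : d_1 (Dop u) z = d_1 (d_1 u) z - d_1 (d_t u) z.
  exact: (deriveB (@smooth_derivable _ _ _ ((0, 1, 0) : spacetime R) z su1 zT)
    (@smooth_derivable _ _ _ ((0, 1, 0) : spacetime R) z sut zT)).
have dt : d_t (Dop u) z = d_t (d_1 u) z - d_t (d_t u) z.
  exact: (deriveB (@smooth_derivable _ _ _ ((1, 0, 0) : spacetime R) z su1 zT)
    (@smooth_derivable _ _ _ ((1, 0, 0) : spacetime R) z sut zT)).
have E1 : d_1 (d_t u) z = d_t (d_1 u) z := smooth_swap ((1, 0, 0) : spacetime R) (0, 1, 0) su zT.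
apply: etrans (congr2 (fun a b => a - b) (etrans d1 (congr1 (fun a => _ - a) E1)) dt) _.
have R3 (a b c : R) : a - b - (b - c) = a - 2 * b + c by ring.
exact: R3.
Qed.

Section SmoothSolution.
Variables (R : realType) (T : R) (u ut u1 u2 utt ut1 ut2 u11 u22 : spacetime R -> R).
(** [v] is Du and [DD] is D^2 u. The mixed derivative occurs only as [ut1], the symmetry being
    settled before this section is applied. *)
Let v z := u1 z - ut z.
Let vt z := ut1 z - utt z.
Let v1 z := u11 z - ut1 z.
Let DD z := u11 z - 2 * ut1 z + utt z.
Hypotheses (cut : cont_before T ut) (cu1 : cont_before T u1) (cu2 : cont_before T u2)
  (cutt : cont_before T utt) (cut1 : cont_before T ut1) (cut2 : cont_before T ut2)
  (cu11 : cont_before T u11) (cu22 : cont_before T u22).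
Hypotheses (u_t : partial_t T u ut) (u_1 : partial_1 T u u1) (u_2 : partial_2 T u u2)
  (ut_t : partial_t T ut utt) (ut_1 : partial_1 T ut ut1) (ut_2 : partial_2 T ut ut2)
  (u1_t : partial_t T u1 ut1) (u1_1 : partial_1 T u1 u11)
  (u2_t : partial_t T u2 ut2) (u2_2 : partial_2 T u2 u22).
Hypothesis ut_line : forall c t x y : R, t < T -> is_derive t 1 (fun s => ut (s, x + c * s, y))
    (utt (t, x + c * t, y) + c * ut1 (t, x + c * t, y)).
Hypothesis u1_line : forall c t x y : R, t < T -> is_derive t 1 (fun s => u1 (s, x + c * s, y))
    (ut1 (t, x + c * t, y) + c * u11 (t, x + c * t, y)).
Hypothesis wave_expanded : forall z : spacetime R, 0 <= z.1.1 < T ->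
  utt z - u11 z - u22 z = v z * DD z.

Let sh (h : R) (f : spacetime R -> R) (z : spacetime R) := f (z.1, z.2 + h).
Let df (h : R) (f : spacetime R -> R) (z : spacetime R) := sh h f z - f z.

Let csh h f : cont_before T f -> cont_before T (sh h f).
Proof.
move=> cf z zT; apply: (@continuous_comp _ _ _ (fun z : spacetime R => (z.1, z.2 + h)) f).
  apply: continuous_pair2; first exact: cvg_fst.
  by apply: continuousD; [exact: cvg_snd|exact: cst_continuous].
exact: cf.
Qed.

Let cdf h f : cont_before T f -> cont_before T (df h f).
Proof. by move=> cf; apply: cont_before_sub => //; exact: csh. Qed.

Let df_t h f g : partial_t T f g -> partial_t T (df h f) (df h g).
Proof. by move=> fg t x y tT; exact: (is_derive_sub (fg t x (y + h) tT) (fg t x y tT)). Qed.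
Let df_1 h f g : partial_1 T f g -> partial_1 T (df h f) (df h g).
Proof. by move=> fg t x y tT; exact: (is_derive_sub (fg t x (y + h) tT) (fg t x y tT)). Qed.
Let df_2 h f g : partial_2 T f g -> partial_2 T (df h f) (df h g).
Proof.
move=> fg t x y tT; apply: is_derive_sub; last exact: fg.
have dh : is_derive y 1 (fun s : R => s + h) (1 + 0).
  exact: (is_derive_add (is_derive_id y 1) (is_derive_const h y)).
have H := @is_derive_comp R (fun s => f (t, x, s)) (fun s => s + h) y _ _ (fg t x (y + h) tT) dh.
by apply: is_derive_eq1 H _; rewrite addr0 mulr1.
Qed.

Section Strip.
Variables (s r k c1 c2 nu h0 : R) (g : plane R -> R).
Hypotheses (s0 : 0 <= s) (sT : s < T) (nu0 : 0 <= nu) (nu_half : nu <= 1 / 2)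
  (nuk : 5 * nu <= k - 1) (k2 : k <= 2) (ksr : k * s < r).
Local Notation psi := (cone r k c1 c2).
Hypothesis v_small : forall z : spacetime R, 0 <= z.1.1 <= s -> 0 < psi z -> `|v z| <= nu.
Hypothesis u_0 : forall x y, u (0, x, y) = 0.
Hypothesis ut_0 : forall x y, ut (0, x, y) = g (x, y).
Hypothesis h00 : 0 < h0.
Hypothesis g_indep : forall x y h, `|h| < h0 -> 0 < psi (0, x, y) -> g (x, y + h) = g (x, y).

Let T0 : 0 < T. Proof. exact: le_lt_trans sT. Qed.

Lemma u1_0 x y : u1 (0, x, y) = 0.
Proof.
have := u_1 x y T0.
under eq_fun do rewrite u_0.
by move=> [_ <-]; rewrite -derive1E derive1_cst.
Qed.

Lemma u2_0 x y : u2 (0, x, y) = 0.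
Proof.
have := u_2 x y T0.
under eq_fun do rewrite u_0.
by move=> [_ <-]; rewrite -derive1E derive1_cst.
Qed.

(** The translate of [u] by [h] in x2 solves the same equation, and its difference from [u] has zero
    Cauchy data in the cone. The difference of the nonlinear terms is [v] times the difference of
    [DD] plus the difference of [v] times the translated [DD], so [energy_uniqueness] applies with
    smallness asked of [v] itself, at points of the cone. *)
Lemma u_indep h t x y : `|h| < h0 -> 0 <= t <= s -> 0 < psi (t, x, y) -> u (t, x, y + h) = u (t, x, y).
Proof.
move=> hh ts ps.
have k0 : 0 <= k by move: nu0 nuk => a b; lra.
have D0 t' x' y' : 0 <= t' <= s -> 0 < psi (t', x', y') -> df h ut (t', x', y') = 0.
  apply: (@energy_uniqueness R T s r k c1 c2 nu v vt v1 (sh h DD) (df h ut) (df h u1) (df h u2)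
    (df h utt) (df h ut1) (df h ut2) (df h u11) (df h u22)) => //.
  - split.
    + exact: cont_before_sub.
    + exact: cont_before_sub.
    + exact: cont_before_sub.
    + by apply: csh; rewrite /DD; cont_before_tac.
  - by split; apply: cdf.
  - by split; apply: cdf.
  - exact: cdf.
  - exact: cdf.
  - by move=> t1 x1 y1 tT; apply: is_derive_sub; [exact: u1_t|exact: ut_t].
  - by move=> t1 x1 y1 tT; apply: is_derive_sub; [exact: u1_1|exact: ut_1].
  - by split; apply: df_t.
  - exact: df_1.
  - exact: df_1.
  - exact: df_2.
  - exact: df_2.
  - move=> z zs; have zT : 0 <= z.1.1 < T by case/andP: zs => -> /le_lt_trans; exact.
    have E1 := wave_expanded zT.
    have E2 := @wave_expanded (z.1, z.2 + h) zT.
    rewrite /df /sh.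
    move: E1 E2; rewrite /v /DD.
    move: (utt _) (u11 _) (u22 _) (ut1 _) (ut _) (u1 _) => B1 B2 B3 B4 B5 B6.
    move: (utt _) (u11 _) (u22 _) (ut1 _) (ut _) (u1 _) => A1 A2 A3 A4 A5 A6.
    move=> E1 E2.
    transitivity ((A1 - A2 - A3) - (B1 - B2 - B3)); first by ring.
    by rewrite E1 E2; ring.
  - move=> x1 y1 p0; rewrite /df /sh /= !u1_0 !u2_0 !ut_0 !subrr g_indep//.
    by rewrite subrr.
have U0 : df h u (t, x, y) = 0.
  (* The cone widens towards the past, so the segment below [(t, x, y)] lies in it; [df h u] is
     constant there and starts from 0. *)
  have Z t' : 0 <= t' <= t -> df h ut (t', x, y) = 0.
    move=> /andP[t'0 t't]; case/andP: ts => t0 ts.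
    apply: D0; first by rewrite t'0 (le_trans t't).
    apply: lt_le_trans ps _; apply: cone_decr => //.
    by apply: ltW; apply: le_lt_trans ksr; rewrite ler_wpM2l.
  apply: (@ode_zero R (fun t => df h u (t, x, y)) (fun t => df h ut (t, x, y)) 0 0 t 0).
  - move=> t' /andP[_ t't]; apply: df_t => //.
    by case/andP: ts => _ ts; exact: le_lt_trans t't (le_lt_trans ts sT).
  - by move=> t' /Z ->; rewrite normr0 mul0r.
  - by case/andP: ts => ->; rewrite lexx.
  - by rewrite /df /sh /= !u_0 subrr.
  - by case/andP: ts => ->; rewrite lexx.
by move: U0; rewrite /df /sh /= => /eqP; rewrite subr_eq0 => /eqP.
Qed.

Lemma u22_0 t x y : 0 <= t <= s -> 0 < psi (t, x, y) -> u22 (t, x, y) = 0.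
Proof.
move=> ts ps; have tT : t < T by case/andP: ts => _ /le_lt_trans; exact.
(* Nested neighbourhoods: [u2] has to vanish near [y], not only at [y], to be differentiated
   again. *)
have near_const : \forall y' \near y, \forall y'' \near y', u (t, x, y'') = u (t, x, y).
  have : \forall y' \near y, `|y' - y| < h0.
    have /nbhs_ballP : nbhs y (ball y h0) by exact: nbhsx_ballx.
    move=> _; near=> y'; rewrite distrC; near: y'; exact: (cvgr_dist_lt _ _ cvg_id).
  move=> /near_join; apply: filterS => y'; apply: filterS => y'' hy.
  by have := u_indep hy ts ps; rewrite addrC subrK.
have u2z : \forall y' \near y, u2 (t, x, y') = 0.
  apply: filterS near_const => y' nc.
  have [_ <-] := u_2 x y' tT.
  rewrite (near_eq_derive _ (g := cst (u (t, x, y))))//.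
  by rewrite -derive1E derive1_cst.
have [_ <-] := u2_2 x y tT.
rewrite (near_eq_derive _ (g := cst 0))//.
by rewrite -derive1E derive1_cst.
Unshelve. all: by end_near. Qed.

(* [v] solves [(1 - v) v_t + (1 + v) v_x = 0] where [u_22] vanishes, hence is constant along lines. *)
Lemma characteristic (c a b x y vh rho0 : R) : 0 <= a -> b <= s ->
  (forall rho, a <= rho <= b -> 0 < psi (rho, x + c * rho, y)) ->
  c * (1 - vh) = 1 + vh -> a <= rho0 <= b -> v (rho0, x + c * rho0, y) = vh ->
  forall rho, a <= rho <= b -> v (rho, x + c * rho, y) = vh.
Proof.
move=> a0 bs inp cE r0 v0 rho rab.
have bT : b < T by exact: le_lt_trans sT.
have [B HB] := @bounded_before R T s (x - `|c| * s) (x + `|c| * s) y y v1 sT (cont_before_sub cu11 cut1).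
apply/eqP; rewrite -subr_eq0; apply/eqP.
pose F rho := v (rho, x + c * rho, y) - vh.
pose dF rho := vt (rho, x + c * rho, y) + c * v1 (rho, x + c * rho, y).
apply: (@ode_zero R F dF (2 * `|c + 1| * B) a b rho0) => //; last by rewrite /F v0 subrr.
- move=> t /andP[_ tb]; have tT : t < T by exact: le_lt_trans bT.
  have h1 := u1_line c x y tT.
  have ht := ut_line c x y tT.
  apply: is_derive_eq1 (is_derive_sub (is_derive_sub h1 ht) (is_derive_const vh t)) _.
  by rewrite /dF /vt /v1; ring.
- move=> t /[dup] tab /andP[ta tb].
  have ts : 0 <= t <= s by rewrite (le_trans a0 ta) (le_trans tb bs).
  have pt := inp t tab.
  have vz := v_small (z := (t, x + c * t, y)) ts pt.
  have tT : 0 <= t < T by case/andP: ts => -> /le_lt_trans; exact.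
  have W := @wave_expanded (t, x + c * t, y) tT.
  rewrite u22_0// subr0 in W.
  have B1 : `|v1 (t, x + c * t, y)| <= B.
    apply: HB => //; last by rewrite lexx.
    have : `|c * t| <= `|c| * s.
      by rewrite normrM ler_wpM2l// ger0_norm//; case/andP: ts.
    by rewrite ler_norml => /andP[? ?]; apply/andP; split; lra.
  (* With [u22 = 0] the equation is [(1 - v) vt + (1 + v) v1 = 0]. Inserting [c (1 - vh) = 1 + vh]
     leaves a multiple of [F], and [1 - v >= 1 / 2] turns this into the bound of [ode_zero]. *)
  have E : (1 - v (t, x + c * t, y)) * dF t = - (c + 1) * v1 (t, x + c * t, y) * F t.
    rewrite /dF /F.
    have W' : vt (t, x + c * t, y) + v1 (t, x + c * t, y) = - (v (t, x + c * t, y) *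
       (v1 (t, x + c * t, y) - vt (t, x + c * t, y))).
      rewrite -[LHS]opprK; congr (- _).
      transitivity (utt (t, x + c * t, y) - u11 (t, x + c * t, y)); first by rewrite /vt /v1; ring.
      by rewrite W /DD /v1 /vt; ring.
    move: W'; move: (v _) (vt _) (v1 _) => V Vt V1 W'.
    have -> : (1 - V) * (Vt + c * V1) = (Vt + V1 + V * (V1 - Vt)) - V1 * (1 + V) + c * (1 - V) * V1.
      by ring.
    rewrite W' addNr sub0r.
    have -> : c * (1 - V) = 1 + vh - c * (V - vh) by rewrite -cE; ring.
    ring.
  have h2 : 1 / 2 <= 1 - v (t, x + c * t, y).
    by move: (le_trans vz nu_half); rewrite ler_norml => /andP[? ?]; lra.
  have : `|(1 - v (t, x + c * t, y)) * dF t| <= `|c + 1| * B * `|F t|.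
    by rewrite E !normrM normrN ler_wpM2r// ler_wpM2l.
  rewrite normrM ger0_norm; last by lra.
  have h3 : 1 / 2 * `|dF t| <= (1 - v (t, x + c * t, y)) * `|dF t| by rewrite ler_wpM2r.
  move=> h4; have := le_trans h3 h4; lra.
Qed.

End Strip.

(** * A priori bound on Du and crossing of characteristics *)

Section Shock.
Variables (tau delta mu p h0 : R) (g : plane R -> R).
Hypotheses (tau0 : 0 < tau) (tauT : tau < T) (delta0 : 0 < delta) (mutau : mu * tau = 4 * delta)
  (mu_small : mu <= 1 / 100).
(** [10 * mu] is five times the bound [2 * mu] on [v], as the energy estimate asks. Since
    [10 * mu * tau = 40 * delta], the left edge [k t - 62 delta] of the cone is at most
    [t - 22 delta] up to time [tau], while the characteristics issued from [[- delta, 0]] stay to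
    the right of [t - 13 delta]. *)
Local Notation k := (1 + 10 * mu).
Local Notation r := (2 * tau + 62 * delta).
Local Notation psi := (cone r k (2 * tau) p).
Hypothesis u_0 : forall x y, u (0, x, y) = 0.
Hypothesis ut_0 : forall x y, ut (0, x, y) = g (x, y).
Hypothesis h00 : 0 < h0.
Hypothesis g_indep : forall x y h, `|h| < h0 -> 0 < psi (0, x, y) -> g (x, y + h) = g (x, y).
Hypothesis g_small : forall x y, 0 < psi (0, x, y) -> `|g (x, y)| <= mu.

Let mu0 : 0 < mu.
Proof. by rewrite -(pmulr_lgt0 _ tau0) mutau mulr_gt0. Qed.

Let k_bounds : 1 <= k <= 2.
Proof. by move: mu0 mu_small => a b; apply/andP; split; lra. Qed.

Let kt_r t : 0 <= t <= tau -> 0 <= k * t /\ k * t + tau < r.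
Proof.
move=> /andP[t0 ttau]; have /andP[k1 _] := k_bounds; split.
  by rewrite mulr_ge0// (le_trans _ k1).
have : k * t <= k * tau by rewrite ler_wpM2l// (le_trans _ k1).
have -> : k * tau = tau + 10 * (mu * tau) by ring.
by rewrite mutau; move: delta0 => a b; lra.
Qed.

Let v_0 x y : v (0, x, y) = - g (x, y).
Proof. by rewrite /v (@u1_0 tau (ltW tau0) tauT u_0 x y) sub0r ut_0. Qed.

Let slope (w : R) := (1 + w) / (1 - w).

Let slopeE w : `|w| <= 2 * mu -> slope w * (1 - w) = 1 + w /\ `|slope w - 1| <= 3 * `|w|.
Proof.
move=> wm; have w1 : `|w| <= 1 / 4 by move: mu_small => a; lra.
have w2 : 3 / 4 <= 1 - w by move: w1; rewrite ler_norml => /andP[? ?]; lra.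
have w3 : 1 - w != 0 by rewrite gt_eqF//; lra.
split; first by rewrite /slope divfK.
have -> : slope w - 1 = 2 * w / (1 - w) by rewrite /slope; field.
rewrite normrM normfV normrM ger0_norm// [`|1 - w|]ger0_norm; last by lra.
rewrite ler_pdivrMr; last by lra.
have : `|w| * (3 / 4) <= `|w| * (1 - w) by rewrite ler_wpM2l.
rewrite -mulrA; have := normr_ge0 w; lra.
Qed.

Let v_const s : 0 <= s <= tau ->
  (forall z, 0 <= z.1.1 <= s -> 0 < psi z -> `|v z| <= 2 * mu) ->
  forall x y vh rho0, `|vh| <= 2 * mu ->
  (forall rho, 0 <= rho <= s -> 0 < psi (rho, x + slope vh * rho, y)) ->
  0 <= rho0 <= s -> v (rho0, x + slope vh * rho0, y) = vh ->
  forall rho, 0 <= rho <= s -> v (rho, x + slope vh * rho, y) = vh.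
Proof.
move=> /andP[s0 stau] vs x y vh rho0 vhm inp rs v0 rho rhos.
have [E _] := slopeE vhm.
have sT : s < T by exact: le_lt_trans tauT.
have [_ kr] := kt_r (t := s) (introT andP (conj s0 stau)).
have [mu0' mus] := (mu0, mu_small).
apply: (@characteristic s r k (2 * tau) p (2 * mu) h0 g _ _ _ _ _ _ _ _ _ _ _ _ (slope vh) 0 s x y vh rho0) => //; lra.
Qed.

(** Going back along the characteristic to time 0, [v] keeps its value, and there it equals [- g],
    which is bounded by [mu]. *)
Let v_improve s : 0 <= s <= tau ->
  (forall z, 0 <= z.1.1 <= s -> 0 < psi z -> `|v z| <= 2 * mu) ->
  forall z, 0 <= z.1.1 <= s -> 0 < psi z -> `|v z| <= mu.
Proof.
move=> stau vs [[t x] y] /= /andP[t0 ts] pz.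
set vh := v (t, x, y).
have vhm : `|vh| <= 2 * mu by apply: vs => //=; rewrite t0.
have [E sl] := slopeE vhm.
set c := slope vh in E sl.
have ttau : 0 <= t <= tau by rewrite t0 (le_trans ts)//; case/andP: stau.
have [kt0 ktr] := kt_r ttau.
(* In fact [|c| <= 1 + 6 * mu]: backwards in time the discs grow at least as fast as the
   characteristic moves, so it does not leave the cone. *)
have ck : `|c| <= k.
  have := ler_normD (c - 1) 1; rewrite subrK normr1 => cn.
  by move: vhm sl cn mu0 => a b d e; lra.
have inp rho : 0 <= rho <= t -> 0 < psi (rho, x - c * t + c * rho, y).
  move=> /andP[rho0 rhot]; move: pz; rewrite /cone /=.
  set X := x - 2 * tau; set Y := y - p; set d := t - rho; set Rr := r - k * t.
  have d0 : 0 <= d by rewrite subr_ge0.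
  have R0 : 0 <= Rr by rewrite /Rr; move: ktr tau0 => a b; lra.
  move=> pz.
  have -> : r - k * rho = Rr + k * d by rewrite /Rr /d; ring.
  have -> : x - c * t + c * rho - 2 * tau = X - c * d by rewrite /X /d; ring.
  have -> : (Rr + k * d) ^+ 2 - ((X - c * d) ^+ 2 + Y ^+ 2) =
     (Rr ^+ 2 - (X ^+ 2 + Y ^+ 2)) + (2 * d * (k * Rr + c * X) + (k ^+ 2 - c ^+ 2) * d ^+ 2) by ring.
  have XR : `|X| <= Rr.
    rewrite ler_norml; apply: sqr_le_bound => //.
    by have := sqr_ge0 Y; move: pz => a b; lra.
  have h1 : 0 <= k * Rr + c * X.
    have : `|c * X| <= k * Rr by rewrite normrM ler_pM.
    by rewrite ler_norml => /andP[? _]; lra.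
  have h2 : 0 <= k ^+ 2 - c ^+ 2.
    rewrite subr_ge0 -[c ^+ 2]real_normK ?num_real// ler_pXn2r ?nnegrE//.
    by have /andP[k1 _] := k_bounds; lra.
  by rewrite ltr_wpDr// addr_ge0// mulr_ge0 ?sqr_ge0// mulr_ge0.
have vs' z : 0 <= z.1.1 <= t -> 0 < psi z -> `|v z| <= 2 * mu.
  by move=> /andP[z0 zt]; apply: vs; rewrite z0 (le_trans zt).
have tt : 0 <= t <= t by rewrite t0 lexx.
have vt' : v (t, x - c * t + c * t, y) = vh by rewrite subrK.
have z0t : 0 <= (0 : R) <= t by rewrite t0 lexx.
have := v_const ttau vs' vhm inp tt vt' z0t.
have := inp 0 z0t.
rewrite -/c mulr0 addr0 => ps0; rewrite v_0 => <-.
by rewrite normrN g_small.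
Qed.

Let cpsi : cont_before T psi.
Proof. rewrite /cone; cont_before_tac. Qed.

Let cv : cont_before T (fun z => `|v z|).
Proof.
apply: (cont_before_comp (h := Num.norm)); first exact: norm_continuous.
exact: cont_before_sub.
Qed.

(** A boundary point is a limit of interior ones along the segment to the axis. The closed cone
    matters for the bootstrap, where time sections have to be compact. *)
Let v_closure s : 0 <= s <= tau ->
  (forall z, 0 <= z.1.1 <= s -> 0 < psi z -> `|v z| <= mu) ->
  forall z, 0 <= z.1.1 <= s -> 0 <= psi z -> `|v z| <= mu.
Proof.
move=> /andP[s0 stau] vs [[t x] y] /= /andP[t0 ts] pz.
have ttau : 0 <= t <= tau by rewrite t0 (le_trans ts).
have tT : t < T by apply: le_lt_trans tauT; case/andP: ttau.
have [_ ktr] := kt_r ttau.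
rewrite leNgt; apply/negP => vz.
pose L (a : R) : spacetime R := (t, 2 * tau + a * (x - 2 * tau), p + a * (y - p)).
have L1 : L 1 = (t, x, y) by rewrite /L; congr (_, _, _); ring.
have cL : {for 1, continuous L}.
  apply: continuous_pair2; first apply: continuous_pair2; first exact: cvg_cst.
  - apply: (@continuousD _ _ _ (cst (2 * tau)) (fun a : R => a * (x - 2 * tau))); first exact: cst_continuous.
    by apply: (@continuousM _ _ id (cst (x - 2 * tau))); [exact: cvg_id|exact: cst_continuous].
  - apply: (@continuousD _ _ _ (cst p) (fun a : R => a * (y - p))); first exact: cst_continuous.
    by apply: (@continuousM _ _ id (cst (y - p))); [exact: cvg_id|exact: cst_continuous].
have cLv : {for 1, continuous (fun a => `|v (L a)|)}.
  by apply: (@continuous_comp _ _ _ L (fun z => `|v z|)) => //; rewrite L1; exact: cv.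
have : \forall a \near (1 : R), mu < `|v (L a)|.
  apply: (cvgr_gt _ cLv); by rewrite L1.
move=> /nbhs_ballP[e /= e0 He].
pose a := 1 - Num.min (e / 2) (1 / 2).
have m0 : 0 < Num.min (e / 2) (1 / 2) by rewrite lt_min divr_gt0//=; lra.
have ma : Num.min (e / 2) (1 / 2) <= e / 2 by rewrite ge_min lexx.
have mb : Num.min (e / 2) (1 / 2) <= 1 / 2 by rewrite ge_min lexx orbT.
have : mu < `|v (L a)|.
  apply: He; rewrite -ball_normE /= /a opprB addrCA subrr addr0 gtr0_norm//.
  by move: ma e0 => c1 c2; lra.
apply/negP; rewrite -leNgt; apply: vs => /=; first by rewrite t0.
move: pz; rewrite /cone /=.
set X := x - 2 * tau; set Y := y - p.
have -> : 2 * tau + a * X - 2 * tau = a * X by ring.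
have -> : p + a * Y - p = a * Y by ring.
move=> pz.
have -> : (r - k * t) ^+ 2 - ((a * X) ^+ 2 + (a * Y) ^+ 2) =
   (1 - a ^+ 2) * (r - k * t) ^+ 2 + a ^+ 2 * ((r - k * t) ^+ 2 - (X ^+ 2 + Y ^+ 2)) by ring.
apply: ltr_wpDr; first by rewrite mulr_ge0 ?sqr_ge0.
have aa : 0 <= a < 1 by rewrite /a; apply/andP; split; lra.
rewrite mulr_gt0//; first by rewrite subr_gt0 expr_lt1//; case/andP: aa.
by rewrite exprn_gt0//; move: ktr tau0 => c1 c2; lra.
Qed.

Let psi_box0 t x y : 0 <= t <= tau -> 0 <= psi (t, x, y) ->
  (2 * tau - r <= x <= 2 * tau + r) && (p - r <= y <= p + r).
Proof.
move=> ttau; rewrite /cone /= subr_ge0 => h.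
have [kt0 ktr] := kt_r ttau.
have R0 : 0 <= r - k * t by move: ktr tau0 => a b; lra.
have h1 : (x - 2 * tau) ^+ 2 <= (r - k * t) ^+ 2.
  by apply: le_trans h; rewrite lerDl sqr_ge0.
have h2 : (y - p) ^+ 2 <= (r - k * t) ^+ 2.
  by apply: le_trans h; rewrite lerDr sqr_ge0.
have /andP[? ?] := sqr_le_bound R0 h1; have /andP[? ?] := sqr_le_bound R0 h2.
by apply/andP; split; apply/andP; split; lra.
Qed.

Let psi_mono t t' x y : 0 <= t -> t <= t' -> t' <= tau -> psi (t', x, y) <= psi (t, x, y).
Proof.
move=> t0 tt' t'tau; have /andP[k1 _] := k_bounds.
have [_ h] := kt_r (t := t') (introT andP (conj (le_trans t0 tt') t'tau)).
by apply: cone_decr => //; move: h tau0 => a b; lra.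
Qed.

(** Continuity method on the set [A] of good times: it is closed by continuity of [v], and it is
    open because [v_improve] leaves the gap between [mu] and [2 * mu], which survives for a short
    time by compactness. *)
Let v_bootstrap z : 0 <= z.1.1 <= tau -> 0 < psi z -> `|v z| <= 2 * mu.
Proof.
pose good s := forall z : spacetime R, 0 <= z.1.1 <= s -> 0 <= psi z -> `|v z| <= 2 * mu.
suff G : good tau by move=> zt pz; apply: G => //; exact: ltW.
pose A := [set s | 0 <= s <= tau /\ good s].
have improve s : 0 <= s <= tau -> good s -> forall z : spacetime R, 0 <= z.1.1 <= s -> 0 <= psi z -> `|v z| <= mu.
  move=> st gs; apply: v_closure => //; apply: v_improve => // z' zs pz.
  by apply: gs => //; exact: ltW.
have A0 : A 0.
  have z0 : 0 <= (0 : R) <= tau by rewrite lexx ltW.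
  split=> // z' zs pz.
  have : `|v z'| <= mu.
    apply: (v_closure z0) => // -[[t x] y] /= /andP[t0 t1] ps.
    have t00 : t = 0 by apply/eqP; rewrite eq_le t0 t1.
    by move: ps; rewrite t00 v_0 normrN; exact: g_small.
  by move: mu0 => a b; lra.
have subA : has_sup A.
  by split; [exists 0|exists tau => s [/andP[]]].
set S := sup A.
have S0 : 0 <= S by exact: ub_le_sup subA.2 _ A0.
have Stau : S <= tau by apply: ge_sup; [exact: subA.1|move=> s [/andP[]]].
have ltS t : t < S -> exists2 s, A s & t < s.
  move=> tS; have [|s As h] := sup_adherent (eps := S - t) _ subA.
    by rewrite subr_gt0.
  by exists s => //; move: h; rewrite -/S; lra.
have GS : good S.
  move=> [[t x] y] /= /andP[t0]; rewrite le_eqVlt => /orP[/eqP tS|tS] pz; last first.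
    have [s [_ gs] ts] := ltS t tS.
    by apply: gs => //=; rewrite t0 ltW.
  subst t; rewrite leNgt; apply/negP => vz.
  have ST : S < T by exact: le_lt_trans tauT.
  have [S00|SN0] := eqVneq S 0.
    have := A0.2 (0, x, y); rewrite /= lexx -[in psi _]S00 => /(_ erefl pz).
    by rewrite -[in v _]S00 leNgt vz.
  have Sp : 0 < S by rewrite lt_neqAle eq_sym SN0.
  have c : {for S, continuous (fun t => `|v (t, x, y)|)}.
    apply: (@continuous_comp _ _ _ (fun t : R => (t, x, y) : spacetime R) (fun z => `|v z|)); last exact: cv.
    apply: continuous_pair2; last exact: cvg_cst.
    by apply: continuous_pair2; [exact: cvg_id|exact: cvg_cst].
  have : \forall t \near S, 2 * mu < `|v (t, x, y)| /\ 0 < t.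
    by apply: filterI; [exact: (cvgr_gt _ c)|exact: lt_nbhsr].
  move=> /nbhs_ballP[e /= e0 He].
  have [|vb tp] := He (S - e / 2).
    rewrite -ball_normE /= opprB addrCA subrr addr0 gtr0_norm ?divr_gt0//.
    by rewrite ltr_pdivrMr// ltr_pMr// ltr1n.
  have tS : S - e / 2 < S by rewrite ltrBlDr ltrDl divr_gt0.
  have [s [/andP[_ stau] gs] ts] := ltS _ tS.
  move: vb; apply/negP; rewrite -leNgt; apply: gs => /=; first by rewrite !ltW.
  apply: le_trans pz _; apply: psi_mono => //; exact: ltW.
have [//|Slt] : S = tau \/ S < tau.
- by move: Stau; rewrite le_eqVlt => /orP[/eqP|]; [left|right].
- by move=> <-.
exfalso.
have S0tau : 0 <= S <= tau by rewrite S0.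
have ST : S < T by exact: le_lt_trans tauT.
have vmu := improve S S0tau GS.
pose B := `[2 * tau - r, 2 * tau + r] `*` `[p - r, p + r] : set (R * R).
have cB : compact B by apply: compact_setX; exact: segment_compact.
have := (iffLR (compact_near_coveringP B) cB) R (nbhs S)
  (fun t q => 0 <= psi (t, q.1, q.2) -> `|v (t, q.1, q.2)| <= 2 * mu) _.
have near_f (f : spacetime R -> R) (x y : R) (P : R -> Prop) : cont_before T f ->
    (\forall a \near f (S, x, y), P a) ->
    \forall q \near (x, y) & t \near S, P (f (t, q.1, q.2)).
  move=> cf Pf.
  have c : {for ((x, y), S), continuous (fun q : R * R * R => f (q.2, q.1.1, q.1.2))}.
    apply: (@continuous_comp _ _ _ (fun q : R * R * R => (q.2, q.1.1, q.1.2) : spacetime R) f); last exact: cf.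
    apply: continuous_pair2; first apply: continuous_pair2; first exact: cvg_snd.
      by apply: continuous_comp; exact: cvg_fst.
    by apply: continuous_comp; [exact: cvg_fst|exact: cvg_snd].
  exact: (c _ Pf).
move=> cov; have {cov} : \forall t \near S, B `<=` (fun q => 0 <= psi (t, q.1, q.2) -> `|v (t, q.1, q.2)| <= 2 * mu).
  apply: cov => -[x y] _.
  (* Points off the closed cone stay off it for nearby times, so the implication holds vacuously;
     elsewhere the strict inequality persists. *)
  have [pneg|ppos] := ltP (psi (S, x, y)) 0.
    have := near_f psi x y (fun a => a < 0) cpsi (lt_nbhsl pneg).
    by apply: filterS => -[q t] /= h1 h2; move: h1; rewrite ltNge h2.
  have vS : `|v (S, x, y)| < 2 * mu.
    have : `|v (S, x, y)| <= mu by apply: vmu => //=; rewrite S0 lexx.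
    by move: mu0 => a b; lra.
  have := near_f (fun z => `|v z|) x y (fun a => a < 2 * mu) cv (lt_nbhsl vS).
  by apply: filterS => -[q t] /= h1 _; exact: ltW.
move=> /nbhs_ballP[e /= e0 He].
pose S' := Num.min tau (S + e / 2).
have SS' : S < S' by rewrite lt_min Slt ltrDl divr_gt0.
have S'tau : S' <= tau by rewrite ge_min lexx.
have S'e : S' <= S + e / 2 by rewrite ge_min lexx orbT.
have AS' : A S'.
  split; first by rewrite (le_trans S0 (ltW SS')).
  move=> [[t x] y] /= /andP[t0 tS'] pz.
  have [tS|St] := leP t S; first by apply: GS => //=; rewrite t0.
  have tt : 0 <= t <= tau by rewrite t0 (le_trans tS').
  apply: (He t _ (x, y)) => //.
    rewrite -ball_normE /= distrC gtr0_norm ?subr_gt0//.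
    by move: tS' S'e e0 => a b c; lra.
  have /andP[? ?] := psi_box0 tt pz.
  by split; rewrite /= in_itv.
have := ub_le_sup subA.2 AS'.
by rewrite leNgt SS'.
Qed.

(* The characteristics issued from [- delta] and [0] meet before time [tau]. *)
Lemma shock : g (0, p) - g (- delta, p) < delta / tau.
Proof.
rewrite ltNge; apply/negP => gd.
have tt : 0 <= tau <= tau by rewrite lexx ltW.
have inp vh x : `|vh| <= mu -> - delta <= x <= 0 ->
    forall rho, 0 <= rho <= tau -> 0 < psi (rho, x + slope vh * rho, p).
  move=> vm /andP[x1 x2] rho /andP[rho0 rhot].
  have vm' : `|vh| <= 2 * mu by move: vm mu0 => a b; lra.
  have [_ sl'] := slopeE vm'.
  have sl : `|slope vh - 1| <= 3 * mu by apply: le_trans sl' _; rewrite ler_wpM2l.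
  have mr : mu * rho <= 4 * delta by rewrite -mutau ler_wpM2l// ltW.
  have mr0 : 0 <= mu * rho by rewrite mulr_ge0// ltW.
  have sr : `|(slope vh - 1) * rho| <= 3 * (mu * rho).
    by rewrite normrM (ger0_norm rho0) mulrA ler_wpM2r.
  rewrite /cone /= subrr expr0n/= addr0 subr_gt0.
  have rr : 0 <= r - k * rho.
    have [_ h] := kt_r (t := rho) (introT andP (conj rho0 rhot)).
    by move: h tau0 => a b; lra.
  rewrite -[ltLHS]real_normK ?num_real// ltr_pXn2r ?nnegrE//.
  have -> : x + slope vh * rho - 2 * tau = (slope vh - 1) * rho + (x + rho - 2 * tau) by ring.
  have -> : r - k * rho = 2 * tau + 62 * delta - rho - 10 * (mu * rho) by ring.
  move: sr; rewrite ler_norml ltr_norml => /andP[sr1 sr2].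
  by move: delta0 tau0 => d0 t0; apply/andP; split; lra.
have psi0 x : - delta <= x <= 0 -> 0 < psi (0, x, p).
  move=> xd; have := inp 0 x; rewrite normr0 (ltW mu0) => /(_ erefl xd 0).
  by rewrite lexx ltW// mulr0 addr0; exact.
have md : - delta <= - delta <= 0 by rewrite lexx oppr_le0 ltW.
have zd : - delta <= (0 : R) <= 0 by rewrite lexx oppr_le0 ltW.
have vm1 : `|- g (- delta, p)| <= mu by rewrite normrN g_small// psi0.
have vm2 : `|- g (0, p)| <= mu by rewrite normrN g_small// psi0.
set a1 := - g (- delta, p) in vm1 *; set a2 := - g (0, p) in vm2 *.
have Ea : delta / tau <= a1 - a2 by rewrite /a1 /a2; move: gd => a; lra.
have a12 : 0 < a1 - a2 by apply: lt_le_trans Ea; rewrite divr_gt0.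
have m2 (w : R) : `|w| <= mu -> `|w| <= 2 * mu by move: mu0 => a b; lra.
have main x vh : `|vh| <= mu -> - delta <= x <= 0 -> v (0, x, p) = vh ->
    forall rho, 0 <= rho <= tau -> v (rho, x + slope vh * rho, p) = vh.
  move=> vhm xd v0.
  apply: (v_const tt v_bootstrap (m2 _ vhm) (inp vh x vhm xd) (rho0 := 0)).
    by rewrite lexx ltW.
  by rewrite mulr0 addr0.
have L1 := main (- delta) a1 vm1 md (v_0 _ _).
have L2 := main 0 a2 vm2 zd (v_0 _ _).
have w1 (w : R) : `|w| <= mu -> 0 < 1 - w <= 11 / 10.
  by rewrite ler_norml => /andP[? ?]; move: mu_small => ?; apply/andP; split; lra.
have /andP[p1 q1] := w1 _ vm1; have /andP[p2 q2] := w1 _ vm2.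
have ds : slope a1 - slope a2 = 2 * (a1 - a2) / ((1 - a1) * (1 - a2)).
  by rewrite /slope; field; rewrite !gt_eqF.
have pp : (1 - a1) * (1 - a2) <= 2.
  have := ler_pM (ltW p1) (ltW p2) q1 q2; lra.
have ds1 : delta / tau <= slope a1 - slope a2.
  apply: le_trans Ea _; rewrite ds ler_pdivlMr ?mulr_gt0//.
  by rewrite [leRHS]mulrC ler_wpM2l// ltW.
have ds0 : 0 < slope a1 - slope a2 by apply: lt_le_trans ds1; rewrite divr_gt0.
(* The crossing time of the two lines. It is at most [tau] because [slope a1 - slope a2] is at least
   [a1 - a2 >= delta / tau], the product [(1 - a1) (1 - a2)] being at most 2. *)
pose t := delta / (slope a1 - slope a2).
have t0 : 0 <= t by rewrite divr_ge0 ?ltW.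
have ttau : t <= tau.
  rewrite /t ler_pdivrMr// mulrC -ler_pdivrMr//.
have tI : 0 <= t <= tau by rewrite t0.
have X : - delta + slope a1 * t = 0 + slope a2 * t.
  have : (slope a1 - slope a2) * t = delta by rewrite /t mulrC divfK// gt_eqF.
  by rewrite mulrBl => <-; ring.
have := L1 t tI; rewrite X L2// => E.
by move: a12; rewrite E subrr ltxx.
Qed.

End Shock.

End SmoothSolution.

Lemma smooth_solution_shock (R : realType) (T tau delta mu p h0 : R) (f g : plane R -> R) u :
  smooth_solution T f g u -> (forall x, f x = 0) ->
  0 < tau -> tau < T -> 0 < delta -> mu * tau = 4 * delta -> mu <= 1 / 100 -> 0 < h0 ->
  (forall x y h, `|h| < h0 -> 0 < cone (2 * tau + 62 * delta) (1 + 10 * mu) (2 * tau) p (0, x, y) ->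
    g (x, y + h) = g (x, y)) ->
  (forall x y, 0 < cone (2 * tau + 62 * delta) (1 + 10 * mu) (2 * tau) p (0, x, y) ->
    `|g (x, y)| <= mu) ->
  g (0, p) - g (- delta, p) < delta / tau.
Proof.
move=> [su eqn uf ug] f0 tau0 tauT delta0 mutau mus h00 gi gs.
have sut : smooth_on [set z : spacetime R | z.1.1 < T] (d_t u) by exact: smooth_derive.
have su1 : smooth_on [set z : spacetime R | z.1.1 < T] (d_1 u) by exact: smooth_derive.
have su2 : smooth_on [set z : spacetime R | z.1.1 < T] (d_2 u) by exact: smooth_derive.
have E1 z : z.1.1 < T -> d_1 (d_t u) z = d_t (d_1 u) z.
  exact: (@smooth_swap R T u ((1, 0, 0) : spacetime R) (0, 1, 0) z su).
have E2 z : z.1.1 < T -> d_2 (d_t u) z = d_t (d_2 u) z.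
  exact: (@smooth_swap R T u ((1, 0, 0) : spacetime R) (0, 0, 1) z su).
have ctt : cont_before T (d_t (d_t u)) by apply: smooth_cont; exact: smooth_derive.
have ct1 : cont_before T (d_t (d_1 u)) by apply: smooth_cont; exact: smooth_derive.
have ct2 : cont_before T (d_t (d_2 u)) by apply: smooth_cont; exact: smooth_derive.
have c11 : cont_before T (d_1 (d_1 u)) by apply: smooth_cont; exact: smooth_derive.
have c22 : cont_before T (d_2 (d_2 u)) by apply: smooth_cont; exact: smooth_derive.
have pt1 : partial_1 T (d_t u) (d_t (d_1 u)).
  by move=> t x y tT; exact: (is_derive_eq1 (smooth_partial_1 sut x y tT) (E1 (t, x, y) tT)).
have pt2 : partial_2 T (d_t u) (d_t (d_2 u)).
  by move=> t x y tT; exact: (is_derive_eq1 (smooth_partial_2 sut x y tT) (E2 (t, x, y) tT)).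
have lt (c t x y : R) : t < T -> is_derive t 1 (fun s => d_t u (s, x + c * s, y))
    (d_t (d_t u) (t, x + c * t, y) + c * d_t (d_1 u) (t, x + c * t, y)).
  move=> tT; apply: is_derive_eq1 (smooth_line c x y sut tT) _.
  by rewrite (E1 (t, x + c * t, y) tT).
have l1 (c t x y : R) : t < T -> is_derive t 1 (fun s => d_1 u (s, x + c * s, y))
    (d_t (d_1 u) (t, x + c * t, y) + c * d_1 (d_1 u) (t, x + c * t, y)).
  by move=> tT; exact: (smooth_line c x y su1 tT).
have we (z : spacetime R) : 0 <= z.1.1 < T -> d_t (d_t u) z - d_1 (d_1 u) z - d_2 (d_2 u) z =
  (d_1 u z - d_t u z) * (d_1 (d_1 u) z - 2 * d_t (d_1 u) z + d_t (d_t u) z).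
  by move=> zT; apply: (smooth_wave_expanded su _ (eqn z zT)); case/andP: zT.
have u0 x y : u (0, x, y) = 0 by have := uf (x, y); rewrite f0.
have ut0 x y : d_t u (0, x, y) = g (x, y) by have := ug (x, y).
exact: (@shock R T u (d_t u) (d_1 u) (d_2 u) (d_t (d_t u)) (d_t (d_1 u)) (d_t (d_2 u)) (d_1 (d_1 u))
  (d_2 (d_2 u)) (smooth_cont sut) (smooth_cont su1) (smooth_cont su2) ctt ct1 ct2 c11 c22
  (smooth_partial_t su) (smooth_partial_1 su) (smooth_partial_2 su) (smooth_partial_t sut)
  pt1 pt2 (smooth_partial_t su1) (smooth_partial_1 su1) (smooth_partial_t su2) (smooth_partial_2 su2)
  lt l1 we tau delta mu p h0 g tau0 tauT delta0 mutau mus u0 ut0 h00 gi gs).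
Qed.

(** * Lebesgue measure on the plane *)

Section PlaneMeasure.
Variable R : realType.
Local Notation lam := (@lebesgue_measure R).
Local Notation mplane := (measurableTypeR R * measurableTypeR R)%type.

(** Links the topology of the plane to the product sigma-algebra: an open set is the union of the
    boxes with rational corners that it contains. *)
Lemma open_measurable_plane (A : set (plane R)) : open A -> measurable (A : set mplane).
Proof.
move=> oA.
pose box (q : rat * rat * (rat * rat)) : set (plane R) :=
  `]ratr q.1.1, ratr q.1.2[%classic `*` `]ratr q.2.1, ratr q.2.2[%classic.
pose F q : set mplane := if pselect (box q `<=` A) then box q else set0.
have -> : A = \bigcup_q F q.
  rewrite eqEsubset; split => [[x y] Axy|z [q _]]; last first.
    by rewrite /F; case: pselect => // qA; exact: qA.
  have /nbhs_ballP[e /= e0 He] : nbhs (x, y) A by exact: open_nbhs_nbhs.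
  have rat_near (c : R) : exists q1 q2 : rat, [/\ c - e < ratr q1, ratr q1 < c, c < ratr q2 & ratr q2 < c + e].
    have /rat_in_itvoo[q1] : c - e < c by rewrite ltrBlDr ltrDl.
    have /rat_in_itvoo[q2] : c < c + e by rewrite ltrDl.
    by rewrite !in_itv/= => /andP[h1 h2] /andP[h3 h4]; exists q1, q2.
  have [q1 [q2 [a1 a2 a3 a4]]] := rat_near x.
  have [q3 [q4 [b1 b2 b3 b4]]] := rat_near y.
  exists (q1, q2, (q3, q4)) => //; rewrite /F; case: pselect => [p|n].
    by split; rewrite /= in_itv/= ?a2 ?b2.
  exfalso; apply: n.
  move=> [x' y'] [/= hx hy]; move: hx hy; rewrite !in_itv/= => /andP[h1 h2] /andP[h3 h4].
  by apply: He; split; rewrite /= -ball_normE /= ltr_norml; apply/andP; split; lra.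
apply: countable_bigcupT_measurable => [|q].
  exact: countableP.
rewrite /F; case: pselect => p; last exact: measurable0.
rewrite /box.
by apply: measurableX; exact: measurable_itv.
Qed.

Lemma continuous_measurable_plane (f : plane R -> R) : continuous f ->
  measurable_fun (setT : set mplane) f.
Proof.
move=> /continuousP cf; apply: (measurability _ (RGenOpens.measurableE R)).
move=> _ [_ [a [b ->] <-]]; rewrite setTI; apply: open_measurable_plane.
exact/cf/interval_open.
Qed.

Lemma compact_plane_box (K : set (plane R)) : compact K ->
  exists2 N : R, 0 < N & K `<=` `[- N, N]%classic `*` `[- N, N]%classic.
Proof.
move=> /compact_bounded[M [_ HM]].
exists (`|M| + 1); first by rewrite ltr_wpDl.
move=> [x y] Kxy; have : `|(x, y)| <= `|M| + 1.
  by apply: HM Kxy; rewrite (le_lt_trans (ler_norm M))// ltrDl.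
rewrite prod_normE /= ge_max => /andP[].
by rewrite !ler_norml => hx hy; split; rewrite /= in_itv.
Qed.

Lemma compact_measurable_plane (K : set (plane R)) : compact K -> measurable (K : set mplane).
Proof.
move=> cK; rewrite -[K]setCK; apply: measurableC; apply: open_measurable_plane.
by apply: closed_openC; apply: compact_closed cK; exact: norm_hausdorff.
Qed.

Lemma leb2_rect (A B : set R) : measurable (A : set (measurableTypeR R)) ->
  measurable (B : set (measurableTypeR R)) -> leb2 R (A `*` B) = (lam A * lam B)%E.
Proof. by move=> mA mB; rewrite /leb2 /= product_measure1E. Qed.

Lemma leb2_box_lty (a b c d : R) : (leb2 R (`[a, b] `*` `[c, d]) < +oo)%E.
Proof.
rewrite leb2_rect// !lebesgue_measure_itv/=.
by do 2!case: ifP => _; rewrite ?mule0 ?mul0e -?EFinD -?EFinM ?ltry.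
Qed.

Lemma integrable_bounded_support (f : plane R -> R) (M N : R) :
  measurable_fun (setT : set mplane) f -> (forall z, `|f z| <= M) ->
  (forall z, ~ (`[- N, N] `*` `[- N, N])%classic z -> f z = 0) ->
  (leb2 R).-integrable setT (EFin \o f).
Proof.
move=> mf fM f0.
pose B : set mplane := `[- N, N] `*` `[- N, N].
have mB : measurable B by exact: measurableX.
have fB : f = f \_ B.
  apply/funext => z; rewrite patchE; case: ifPn => // /negP h.
  by apply: f0 => Bz; apply: h; rewrite inE.
rewrite fB -restrict_EFin; apply/integrable_restrict => //; rewrite setTI.
apply: measurable_bounded_integrable => //.
- exact: leb2_box_lty.
- exact: measurable_funS mf.
- exists M; split; first exact: num_real.
  by move=> M' /ltW MM' z _ /=; exact: le_trans (fM z) MM'.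
Qed.

Lemma test_function_continuous (f : plane R -> R) : test_function setT f -> continuous f.
Proof. by move=> [/(_ 0%N)[cf _] _] x; exact: cf. Qed.

Lemma test_function_bounded (f : plane R -> R) : test_function setT f ->
  exists M N : R, [/\ 0 < N, forall z, `|f z| <= M &
    forall z, ~ (`[- N, N] `*` `[- N, N])%classic z -> f z = 0].
Proof.
move=> tf; have cf := test_function_continuous tf; case: tf => _ [K [cK _ K0]].
have [N N0 KN] := compact_plane_box cK.
have : compact (f @` K) by apply: continuous_compact => //; exact: continuous_subspaceT.
move=> /compact_bounded[M [_ HM]].
exists (`|M| + 1), N; split=> //.
  move=> z; have [Kz|/K0 ->] := pselect (K z); last by rewrite normr0 addr_ge0.
  apply: (HM (`|M| + 1)); last by exists z.
  by rewrite (le_lt_trans (ler_norm M))// ltrDl.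
by move=> z nB; apply: K0 => Kz; apply: nB; exact: KN.
Qed.

Lemma test_function_measurable (f : plane R -> R) : test_function setT f ->
  measurable_fun (setT : set mplane) f.
Proof. by move/test_function_continuous/continuous_measurable_plane. Qed.

Lemma test_function_integrable (f : plane R -> R) : test_function setT f ->
  (leb2 R).-integrable setT (EFin \o f).
Proof.
move=> tf; have [M [N [_ fM f0]]] := test_function_bounded tf.
by apply: (@integrable_bounded_support f M N) => //; exact: test_function_measurable.
Qed.

Local Open Scope ereal_scope.

(** The pushforward under [x -> a x + b], scaled by [a], agrees with Lebesgue measure on half-open
    intervals, so uniqueness of the latter identifies them. *)
Lemma lebesgue_affine (a b : R) (A : set R) : (0 < a)%R -> measurable (A : set (measurableTypeR R)) ->
  lam [set x | A (a * x + b)%R] = (a^-1)%:E * lam A.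
Proof.
move=> a0 mA.
have mphi : measurable_fun (setT : set (measurableTypeR R))
    ((fun x => a * x + b)%R : measurableTypeR R -> measurableTypeR R).
  by apply: measurable_funD => //; apply: measurable_funM.
pose phi := (fun x => a * x + b)%R : measurableTypeR R -> measurableTypeR R.
have a0' : (0 <= a)%R by exact: ltW.
pose m : {measure set (measurableTypeR R) -> \bar R} := mscale (NngNum a0') (pushforward lam phi).
have E : lam A = m mphi A.
  apply: lebesgue_measure_unique => // _ [[c d]] _ <- /=.
  rewrite /m /mscale /= /pushforward /=.
  have -> : phi @^-1` `]c, d] = `]((c - b) / a)%R, ((d - b) / a)%R]%classic.
    apply/seteqP; split => x /=; rewrite !in_itv/= => /andP[h1 h2]; apply/andP; split.
    - by rewrite ltr_pdivrMr// mulrC ltrBlDr.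
    - by rewrite ler_pdivlMr// mulrC lerBrDr.
    - by move: h1; rewrite ltr_pdivrMr// mulrC ltrBlDr.
    - by move: h2; rewrite ler_pdivlMr// mulrC lerBrDr.
  rewrite !lebesgue_measure_itv/= !lte_fin ltr_pM2r ?invr_gt0// ltrD2r.
  case: ifP => _; last by rewrite mule0.
  rewrite -!EFinD -EFinM; congr (_%:E); field; exact: lt0r_neq0.
rewrite E /m /mscale /= muleA -EFinM mulVf ?gt_eqF// mul1e.
by [].
Qed.

Lemma ge0_integral_affine_pos (a b : R) (f : R -> \bar R) : (0 < a)%R ->
  measurable_fun (setT : set (measurableTypeR R)) f -> (forall x, 0 <= f x) ->
  \int[lam]_x f (a * x + b)%R = (a^-1)%:E * \int[lam]_x f x.
Proof.
move=> a0 mf f0.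
have mphi : measurable_fun (setT : set (measurableTypeR R))
    ((fun x => a * x + b)%R : measurableTypeR R -> measurableTypeR R).
  by apply: measurable_funD => //; apply: measurable_funM.
have a0' : (0 <= a^-1)%R by rewrite invr_ge0 ltW.
rewrite -(@ge0_integral_mscale _ _ _ _ _ measurableT (NngNum a0'))//.
have := @ge0_integral_pushforward _ _ _ _ R _ mphi lam setT f measurableT mf (fun x _ => f0 x).
rewrite preimage_setT => /= <-.
apply: eq_measure_integral => A mA _.
exact: (lebesgue_affine b a0 mA).
Qed.

Lemma ge0_integral_opp (f : R -> \bar R) :
  measurable_fun (setT : set (measurableTypeR R)) f -> (forall x, 0 <= f x) ->
  \int[lam]_x f (- x)%R = \int[lam]_x f x.
Proof.
move=> mf f0.
have mphi : measurable_fun (setT : set (measurableTypeR R))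
    (-%R : measurableTypeR R -> measurableTypeR R) by [].
have := @ge0_integral_pushforward _ _ _ _ R _ mphi lam setT f measurableT mf (fun x _ => f0 x).
rewrite preimage_setT => /= <-.
apply: eq_measure_integral => A mA _; exact: lebesgue_measureN.
Qed.

Lemma ge0_integral_affine (a b : R) (f : R -> \bar R) : a != 0%R ->
  measurable_fun (setT : set (measurableTypeR R)) f -> (forall x, 0 <= f x) ->
  \int[lam]_x f (a * x + b)%R = (`|a|^-1)%:E * \int[lam]_x f x.
Proof.
move=> a0 mf f0; have [ap|an] := ltP 0%R a.
  by rewrite gtr0_norm// ge0_integral_affine_pos.
have {an}an : (a < 0)%R by rewrite lt_neqAle a0.
rewrite ltr0_norm// -(ge0_integral_opp mf f0).
have mN : measurable_fun (setT : set (measurableTypeR R)) (fun x => f (- x)%R).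
  exact: (measurableT_comp mf).
rewrite -(ge0_integral_affine_pos (- b)%R (f := fun x => f (- x)%R)) ?oppr_gt0//.
by apply: eq_integral => x _; congr f; rewrite mulNr -opprD opprK.
Qed.

Lemma ge0_integral_affine2 (a1 b1 a2 b2 : R) (f : plane R -> \bar R) : a1 != 0%R -> a2 != 0%R ->
  measurable_fun (setT : set mplane) f -> (forall z, 0 <= f z) ->
  \int[leb2 R]_z f (a1 * z.1 + b1, a2 * z.2 + b2)%R =
  (`|a1|^-1 * `|a2|^-1)%:E * \int[leb2 R]_z f z.
Proof.
move=> a10 a20 mf f0.
have mS : measurable_fun (setT : set mplane)
   ((fun z : mplane => (a1 * z.1 + b1, a2 * z.2 + b2)%R) : mplane -> mplane).
  apply/measurable_fun_pairP; split.
    by apply: measurable_funD => //; apply: measurable_funM => //; exact: measurable_fst.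
  by apply: measurable_funD => //; apply: measurable_funM => //; exact: measurable_snd.
have mfS : measurable_fun (setT : set mplane) (fun z : mplane => f (a1 * z.1 + b1, a2 * z.2 + b2)%R).
  exact: (measurableT_comp mf mS).
rewrite /leb2 fubini_tonelli1// [in RHS]fubini_tonelli1// /fubini_F.
have mfx x : measurable_fun (setT : set (measurableTypeR R)) (fun y => f (x, y)).
  exact: measurableT_comp mf (measurable_pair1 x).
under eq_integral.
  move=> x _ /=; rewrite (ge0_integral_affine b2 (f := fun y => f ((a1 * x + b1)%R, y)))//; over.
have mF : measurable_fun (setT : set (measurableTypeR R)) (fun x => \int[lam]_y f (x, y)).
  exact: measurable_fun_fubini_tonelli_F.
have mF1 : measurable_fun (setT : set (measurableTypeR R)) (fun x => \int[lam]_y f ((a1 * x + b1)%R, y)).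
  apply: (measurableT_comp mF (g := fun x : measurableTypeR R => (a1 * x + b1)%R : measurableTypeR R)).
  by apply: measurable_funD => //; apply: measurable_funM.
have F0 x : setT x -> 0 <= \int[lam]_y f ((a1 * x + b1)%R, y) by move=> _; exact: integral_ge0.
have c0 : 0 <= (`|a2|^-1)%:E by rewrite lee_fin invr_ge0.
rewrite (ge0_integralZl _ measurableT mF1 F0 c0).
rewrite (ge0_integral_affine b1 (f := fun x => \int[lam]_y f (x, y)))//.
  by rewrite muleA -EFinM mulrC.
by move=> x; exact: integral_ge0.
Qed.

Local Close Scope ereal_scope.

Lemma int2_affine (a1 b1 a2 b2 : R) (f : plane R -> R) : a1 != 0 -> a2 != 0 ->
  measurable_fun (setT : set mplane) f -> (leb2 R).-integrable setT (EFin \o f) ->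
  int2 (fun z => f (a1 * z.1 + b1, a2 * z.2 + b2)) = `|a1|^-1 * `|a2|^-1 * int2 f.
Proof.
move=> a10 a20 mf intf; rewrite /int2 /Rintegral.
pose S (z : plane R) := (a1 * z.1 + b1, a2 * z.2 + b2).
have mEf : measurable_fun (setT : set mplane) (EFin \o f) by exact/measurable_EFinP.
rewrite integralE [in RHS]integralE.
have -> : (\int[leb2 R]_z (fun z => (f (S z))%:E)^\+ z =
   (`|a1|^-1 * `|a2|^-1)%:E * \int[leb2 R]_z (EFin \o f)^\+ z)%E.
  have H := ge0_integral_affine2 b1 b2 a10 a20 (measurable_funepos mEf) (funepos_ge0 _).
  by apply: etrans H; apply: eq_integral => z _; rewrite !funeposE.
have -> : (\int[leb2 R]_z (fun z => (f (S z))%:E)^\- z =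
   (`|a1|^-1 * `|a2|^-1)%:E * \int[leb2 R]_z (EFin \o f)^\- z)%E.
  have H := ge0_integral_affine2 b1 b2 a10 a20 (measurable_funeneg mEf) (funeneg_ge0 _).
  by apply: etrans H; apply: eq_integral => z _; rewrite !funenegE.
have p := integrable_pos_fin_num measurableT intf.
have n := integrable_neg_fin_num measurableT intf.
rewrite fineB ?fin_numM// [in RHS]fineB// mulrBr.
by rewrite fineM// fineM.
Qed.

End PlaneMeasure.

(** * Test functions *)

Section CkClosure.
Variables (R : realType) (V : normedModType R).
Implicit Types f g : V -> R.

Lemma Ck_lower k f : Ck k.+1 setT f -> Ck k setT f.
Proof.
elim: k f => [|k IH] f; first by case.
by case=> cf df; split=> // v; have [d1 d2] := df v; split => //; exact: IH.
Qed.

Lemma Ck_cst k (c : R) : Ck k setT (fun _ : V => c).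
Proof.
elim: k c => [|k IH] c; first by split=> // x _; exact: cst_continuous.
split; first by move=> x _; exact: cst_continuous.
move=> v; split; first by move=> x _; exact: derivable_cst.
have -> : 'D_v (fun _ : V => c) = (fun=> 0) by apply/funext => x; rewrite derive_cst.
exact: IH.
Qed.

Lemma Ck_add k f g : Ck k setT f -> Ck k setT g -> Ck k setT (fun x => f x + g x).
Proof.
elim: k f g => [|k IH] f g [cf df] [cg dg].
  by split=> // x _; apply: continuousD; [exact: cf|exact: cg].
split; first by move=> x _; apply: continuousD; [exact: cf|exact: cg].
move=> v; have [f1 f2] := df v; have [g1 g2] := dg v.
split; first by move=> x _; apply: derivableD; [exact: f1|exact: g1].
have -> : 'D_v (fun x => f x + g x) = (fun x => 'D_v f x + 'D_v g x).
  by apply/funext => x; apply: deriveD; [exact: f1|exact: g1].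
exact: IH.
Qed.

Lemma Ck_mul k f g : Ck k setT f -> Ck k setT g -> Ck k setT (fun x => f x * g x).
Proof.
elim: k f g => [|k IH] f g /[dup] Cf [cf df] /[dup] Cg [cg dg].
  by split=> // x _; apply: continuousM; [exact: cf|exact: cg].
split; first by move=> x _; apply: continuousM; [exact: cf|exact: cg].
move=> v; have [f1 f2] := df v; have [g1 g2] := dg v.
split; first by move=> x _; apply: derivableM; [exact: f1|exact: g1].
have -> : 'D_v (fun x => f x * g x) = (fun x => f x * 'D_v g x + g x * 'D_v f x).
  by apply/funext => x; apply: deriveM; [exact: f1|exact: g1].
by apply: Ck_add; apply: IH => //; exact: Ck_lower.
Qed.

Lemma Ck_opp k f : Ck k setT f -> Ck k setT (fun x => - f x).
Proof.
move=> Cf; have -> : (fun x => - f x) = (fun x => -1 * f x).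
  by apply/funext => x; rewrite mulN1r.
by apply: Ck_mul => //; exact: Ck_cst.
Qed.

Lemma Ck_pow k n f : Ck k setT f -> Ck k setT (fun x => f x ^+ n).
Proof.
move=> Cf; elim: n => [|n IH]; first exact: Ck_cst.
have -> : (fun x => f x ^+ n.+1) = (fun x => f x * f x ^+ n).
  by apply/funext => x; rewrite exprS.
exact: Ck_mul.
Qed.

End CkClosure.

(** * Functions flat at the origin *)

Section Flat.
Variable R : realType.
Implicit Types (p : {poly R}) (x h : R).

(** The polynomial parameter makes the family stable under differentiation: the derivative belongs
    to the polynomial X^2 (p - p'), and smoothness follows by induction. *)
Definition flat p x : R := if x <= 0 then 0 else p.[x^-1] * expR (- x^-1).

Lemma horner_norm_le p (y : R) : 1 <= y ->
  `|p.[y]| <= (\sum_(i < size p) `|p`_i|) * y ^+ size p.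
Proof.
move=> y1; rewrite horner_coef; apply: le_trans (ler_norm_sum _ _ _) _.
rewrite mulr_suml; apply: ler_sum => i _.
rewrite normrM ler_wpM2l// ger0_norm ?exprn_ge0 ?(le_trans ler01)//.
by rewrite ler_weXn2l// ltnW.
Qed.

Lemma expRN_le (y : R) n : 0 < y -> expR (- y) <= (n.+1%:R / y) ^+ n.+1.
Proof.
move=> y0.
have h : y / n.+1%:R <= expR (y / n.+1%:R).
  by apply: le_trans (expR_ge1Dx _); rewrite lerDr.
have h2 : (y / n.+1%:R) ^+ n.+1 <= expR y.
  have -> : expR y = expR (y / n.+1%:R) ^+ n.+1.
    by rewrite -expRM_natl mulrC divfK.
  by rewrite ler_pXn2r ?nnegrE ?expR_ge0// divr_ge0// ltW.
rewrite expRN -[X in _ <= X]invrK -exprVn invf_div lef_pV2 ?posrE ?expR_gt0//.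
by rewrite exprn_gt0// divr_gt0.
Qed.

(** With [n = size p] the exponent [n.+1] in [expRN_le] outweighs the growth of the polynomial and
    leaves one factor [h]. Used for ['X * p] it gives the derivative at 0, as
    [h^-1 * flat p h = flat ('X * p) h]. *)
Lemma flat_small p : exists2 C : R, 0 <= C & forall h, h <= 1 -> `|flat p h| <= C * `|h|.
Proof.
pose n := size p; pose S := \sum_(i < size p) `|p`_i|.
have S0 : 0 <= S by exact: sumr_ge0.
exists (S * n.+1%:R ^+ n.+1); first by rewrite mulr_ge0// exprn_ge0.
move=> h h1; rewrite /flat; case: ifPn => [h0|].
  by rewrite normr0 mulr_ge0// mulr_ge0// exprn_ge0.
rewrite -ltNge => h0; have hV : 1 <= h^-1 by rewrite -[1]invr1 lef_pV2// posrE.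
have hV0 : 0 < h^-1 by rewrite invr_gt0.
rewrite normrM (ger0_norm (expR_ge0 _)) (gtr0_norm h0).
have := ler_pM (normr_ge0 _) (expR_ge0 _) (horner_norm_le p hV) (expRN_le n hV0).
move=> H; apply: le_trans H _.
rewrite -/S -/n invrK exprMn [h ^+ n.+1]exprS.
have -> : S * h^-1 ^+ n * (n.+1%:R ^+ n.+1 * (h * h ^+ n)) =
    S * n.+1%:R ^+ n.+1 * h * (h^-1 ^+ n * h ^+ n) by ring.
by rewrite -exprMn mulVf ?gt_eqF// expr1n mulr1.
Qed.

Lemma is_derive_flat p x : is_derive x 1 (flat p) (flat ('X^2 * (p - p^`())) x).
Proof.
have [x0|x0|->] := ltgtP x 0.
- rewrite {2}/flat (ltW x0).
  apply: (@near_eq_is_derive _ _ _ (cst 0)) => //.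
  near=> y; rewrite /flat ifT//.
  by apply: ltW; near: y; exact: lt_nbhsl.
- rewrite {2}/flat leNgt x0 /=.
  apply: (@near_eq_is_derive _ _ _ (fun y : R => p.[y^-1] * expR (- y^-1))).
    near=> y; rewrite /flat ifF//; apply/negbTE; rewrite -ltNge.
    by near: y; exact: lt_nbhsr.
  have dV : is_derive x 1 (fun y : R => y^-1) (- (x ^- 2)).
    have xn0 : x != 0 by rewrite gt_eqF.
    by have := is_deriveV (f := id) xn0 (is_derive_id x 1); rewrite [_ *: _]mulr1.
  have dp : is_derive x 1 (fun y => p.[y^-1]) (p^`().[x^-1] * - (x ^- 2)).
    exact: (is_derive_comp (is_derive_poly p x^-1) dV).
  have dN : is_derive x 1 (fun y : R => - y^-1) (- - (x ^- 2)) by exact: is_deriveN.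
  have de := @is_derive_comp R expR (fun y => - y^-1) x _ _ (is_derive_expR (- x^-1)) dN.
  apply: is_derive_eq1 (is_derive_mul dp de) _.
  rewrite !hornerE /= -exprVn; ring.
- have [C C0 HC] := flat_small p.
  have [C' C'0 HC'] := flat_small ('X * p).
  rewrite {2}/flat lexx.
  have f0 : flat p 0 = 0 by rewrite /flat lexx.
  suff H : h^-1 *: ((flat p \o shift 0) (h *: 1) - flat p 0) @[h --> (0 : R)^'] --> (0 : R).
    by apply: DeriveDef; [apply/cvg_ex; exists 0|apply/cvg_lim].
  rewrite f0; apply/cvgr0Pnorm_le => e e0; near=> h.
  have h0 : h != 0 by near: h; exact: nbhs_dnbhs_neq.
  have h1 : `|h| <= 1 by near: h; apply: dnbhs0_le.
  have he : `|h| <= e / (C' + 1) by near: h; apply: dnbhs0_le; rewrite divr_gt0// ltr_wpDl.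
  rewrite subr0 /= [h *: 1]mulr1 addr0 -[_ *: _]/(_ * _).
  have -> : h^-1 * flat p h = flat ('X * p) h.
    by rewrite /flat; case: ifP => _; rewrite ?mulr0// hornerM hornerX mulrA.
  apply: le_trans (HC' h _) _; first by rewrite (le_trans (ler_norm h)).
  have : `|h| * (C' + 1) <= e by rewrite -ler_pdivlMr// ltr_wpDl.
  by apply: le_trans; rewrite mulrC ler_wpM2l// lerDl.
Unshelve. all: by end_near. Qed.

Lemma flat1_bounds x : 0 <= flat 1 x <= 1.
Proof.
rewrite /flat; case: ifPn => [_|]; first by rewrite lexx ler01.
rewrite -ltNge => x0; rewrite hornerC mul1r expR_ge0 /=.
by rewrite -[leRHS]expR0 ler_expR oppr_le0 invr_ge0 ltW.
Qed.

Lemma flat1_gt0 x : (0 < flat 1 x) = (0 < x).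
Proof.
rewrite /flat; case: ifPn => x0; first by rewrite ltxx ltNge x0.
by rewrite hornerC mul1r expR_gt0 ltNge x0.
Qed.

(** [L] is the linear part of the affine map [l]. Induction on [k] runs over all [p], each
    derivative being [L v] times another member of the family. *)
Lemma Ck_flat_affine (V : normedModType R) (l L : V -> R) k p :
  (forall z, {for z, continuous l}) ->
  (forall z v h, l (h *: v + z) = h * L v + l z) ->
  Ck k setT (fun z => flat p (l z)).
Proof.
move=> cl lL; elim: k p => [|k IH] p.
  split=> // z _; apply: (@continuous_comp _ _ _ l (flat p)); first exact: cl.
  exact: derive_continuous (is_derive_flat _ _).
split.
  move=> z _; apply: (@continuous_comp _ _ _ l (flat p)); first exact: cl.
  exact: derive_continuous (is_derive_flat _ _).
move=> v.
have D z : is_derive z v (fun z => flat p (l z)) (L v * flat ('X^2 * (p - p^`())) (l z)).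
  have dl : is_derive (0 : R) 1 (fun h : R => L v * h + l z) (L v * 1 + 0).
    exact: (is_derive_add (is_derive_cmul (L v) (is_derive_id (0 : R) 1)) (is_derive_const (l z) 0)).
  have df : is_derive (L v * 0 + l z) 1 (flat p) (flat ('X^2 * (p - p^`())) (l z)).
    by rewrite mulr0 add0r; exact: is_derive_flat.
  have [H1 H2] := @is_derive_comp R (flat p) (fun h => L v * h + l z) 0 _ _ df dl.
  have E : (fun h : R => h^-1 *: (((fun h : R => flat p (L v * h + l z)) \o shift 0) (h *: 1) -
      flat p (L v * 0 + l z))) =
    (fun h : R => h^-1 *: (((fun z => flat p (l z)) \o shift z) (h *: v) - flat p (l z))).
    apply/funext => h /=; rewrite lL mulr0 add0r addr0 [h *: 1]mulr1.
    by rewrite [L v * h]mulrC.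
  move: H1 H2; rewrite /derivable /derive /= E => H1 H2.
  by apply: DeriveDef => //; rewrite /derive H2 mulr1 addr0 mulrC.
split; first by move=> z _; have [] := D z.
have -> : 'D_v (fun z => flat p (l z)) = (fun z => L v * flat ('X^2 * (p - p^`())) (l z)).
  by apply/funext => z; have [_ ->] := D z.
by apply: Ck_mul; [exact: Ck_cst|exact: IH].
Qed.

End Flat.

Section Bump.
Variables (R : realType) (a b c d : R).

Definition rect_bump (z : plane R) : R :=
  flat 1 (z.1 - a) * flat 1 (b - z.1) * (flat 1 (z.2 - c) * flat 1 (d - z.2)).

Lemma rect_bump_bounds z : 0 <= rect_bump z <= 1.
Proof.
have [/andP[? ?] /andP[? ?]] := (flat1_bounds (z.1 - a), flat1_bounds (b - z.1)).
have [/andP[? ?] /andP[? ?]] := (flat1_bounds (z.2 - c), flat1_bounds (d - z.2)).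
by rewrite /rect_bump !mulr_ge0//= !mulr_ile1// ?mulr_ge0.
Qed.

Lemma rect_bump_gt0 z : (0 < rect_bump z) = (a < z.1 < b) && (c < z.2 < d).
Proof.
have fge x : 0 <= flat 1 x :> R by have /andP[] := flat1_bounds x.
have mg (x y : R) : 0 <= x -> 0 <= y -> (0 < x * y) = (0 < x) && (0 < y).
  move=> x0 y0; rewrite !lt_def mulf_eq0 negb_or !mulr_ge0// x0 y0 !andbT.
  by [].
by rewrite /rect_bump !mg ?mulr_ge0// !flat1_gt0 !subr_gt0.
Qed.

Lemma rect_bump_out z : ~ (`[a, b] `*` `[c, d])%classic z -> rect_bump z = 0.
Proof.
move=> nz; apply/eqP; rewrite eq_le; have /andP[-> _] := rect_bump_bounds z.
rewrite andbT leNgt rect_bump_gt0; apply/negP => /andP[/andP[? ?] /andP[? ?]].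
by apply: nz; split; rewrite /= in_itv/= !ltW.
Qed.

Lemma Ck_rect_bump k : Ck k setT rect_bump.
Proof.
have c1 (z : plane R) : {for z, continuous (fun z : plane R => z.1)} by exact: cvg_fst.
have c2 (z : plane R) : {for z, continuous (fun z : plane R => z.2)} by exact: cvg_snd.
apply: Ck_mul; apply: Ck_mul.
- apply: (@Ck_flat_affine _ _ (fun z : plane R => z.1 - a) (fun v : plane R => v.1)).
    by move=> z; apply: continuousB; [exact: c1|exact: cst_continuous].
  by move=> z v h /=; rewrite -addrA.
- apply: (@Ck_flat_affine _ _ (fun z : plane R => b - z.1) (fun v : plane R => - v.1)).
    by move=> z; apply: continuousB; [exact: cst_continuous|exact: c1].
  by move=> z v h /=; rewrite -[h *: _]/(h * _); ring.
- apply: (@Ck_flat_affine _ _ (fun z : plane R => z.2 - c) (fun v : plane R => v.2)).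
    by move=> z; apply: continuousB; [exact: c2|exact: cst_continuous].
  by move=> z v h /=; rewrite -addrA.
- apply: (@Ck_flat_affine _ _ (fun z : plane R => d - z.2) (fun v : plane R => - v.2)).
    by move=> z; apply: continuousB; [exact: cst_continuous|exact: c2].
  by move=> z v h /=; rewrite -[h *: _]/(h * _); ring.
Qed.

(* As [n] grows these functions increase to the indicator of the open rectangle. *)
Definition plateau n (z : plane R) : R := 1 - (1 - rect_bump z) ^+ n.

Lemma plateau_out n z : ~ (`[a, b] `*` `[c, d])%classic z -> plateau n z = 0.
Proof. by move=> nz; rewrite /plateau rect_bump_out// subr0 expr1n subrr. Qed.

Lemma plateau_bounds n z : 0 <= plateau n z <= 1.
Proof.
have /andP[b0 b1] := rect_bump_bounds z; rewrite /plateau subr_ge0 gerBl.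
by rewrite exprn_ge0 ?subr_ge0// exprn_ile1// ?subr_ge0// gerBl.
Qed.

Lemma plateau_test n : test_function setT (plateau n).
Proof.
split.
  move=> k; apply: Ck_add; first exact: Ck_cst.
  apply: Ck_opp; apply: Ck_pow; apply: Ck_add; first exact: Ck_cst.
  by apply: Ck_opp; exact: Ck_rect_bump.
exists (`[a, b] `*` `[c, d])%classic; split => //; last exact: plateau_out.
by apply: compact_setX; exact: segment_compact.
Qed.

Lemma plateau_cvg z :
  plateau n z @[n --> \oo] --> (\1_(`]a, b[ `*` `]c, d[ : set (plane R)) z : R).
Proof.
rewrite indicE; have [zin|] := boolP (0 < rect_bump z).
  rewrite mem_set; last first.
    by move: zin; rewrite rect_bump_gt0 => /andP[? ?]; split; rewrite /= in_itv.
  rewrite -[X in _ --> X]subr0; apply: cvgB; first exact: cvg_cst.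
  apply: cvg_expr; have /andP[b0 b1] := rect_bump_bounds z.
  by rewrite ger0_norm ?subr_ge0// ltrBlDr ltrDl.
move=> nz; rewrite memNset; last first.
  move=> [/=]; rewrite !in_itv/= => h1 h2; move: nz; rewrite rect_bump_gt0 h1 h2.
  by [].
have bz : rect_bump z = 0.
  by apply/eqP; rewrite eq_le; have /andP[-> _] := rect_bump_bounds z; rewrite andbT leNgt.
have -> : (fun n => plateau n z) = (fun=> 0).
  by apply/funext => n; rewrite /plateau bz subr0 expr1n subrr.
exact: cvg_cst.
Qed.

End Bump.

Section Dynkin.
Local Open Scope ereal_scope.
Context (R : realType) (d d' : measure_display) (T : measurableType d) (T' : measurableType d')
  (mu : {measure set T -> \bar R}).

(** Pi-lambda argument: the sets whose preimage in [B] carries integral 0 form a Dynkin system. With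
    [p] a projection it extends vanishing from open to measurable rectangles one coordinate at a
    time; with [p] the identity it reaches the whole product sigma-algebra. *)
Lemma integral_preimage_eq0 (f : T -> \bar R) (p : T -> T') (B : set T) (G : set (set T')) :
  @measurable _ T' = <<s G >> -> setI_closed G -> measurable B -> measurable_fun setT p ->
  mu.-integrable setT f -> \int[mu]_(x in B) f x = 0 ->
  (forall A, G A -> \int[mu]_(x in B `&` p @^-1` A) f x = 0) ->
  forall A, measurable A -> \int[mu]_(x in B `&` p @^-1` A) f x = 0.
Proof.
move=> mG GI mB mp intf B0 G0 A mA.
have mpre S : measurable S -> measurable (p @^-1` S).
  by move=> mS; rewrite -[X in measurable X]setTI; exact: mp.
have mfS S : measurable S -> measurable_fun S f.
  by move=> mS; apply: measurable_funTS; exact: measurable_int intf.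
have sGA : <<s G >> A by rewrite -mG.
apply: (dynkin_induction (P := fun A => \int[mu]_(x in B `&` p @^-1` A) f x = 0) mG GI _ _ _ _ sGA).
- by rewrite preimage_setT setIT.
- by move=> S /G0.
- move=> S mS S0.
  have mBS : measurable (B `&` p @^-1` S) by apply: measurableI => //; exact: mpre.
  have mBC : measurable (B `&` p @^-1` (~` S)).
    by apply: measurableI => //; apply: mpre; exact: measurableC.
  have E : B = (B `&` p @^-1` S) `|` (B `&` p @^-1` (~` S)).
    by rewrite -setIUr preimage_setC setUv setIT.
  have := B0; rewrite [X in \int[mu]_(x in X) _]E integral_setU//.
  + by rewrite S0 add0e.
  + exact: mfS (measurableU _ _ mBS mBC).
  + by rewrite disj_set2E preimage_setC setIACA setICr setI0.
- move=> F mF tF F0.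
  rewrite preimage_bigcup setI_bigcupr integral_bigcup//.
  + by apply: eseries0 => i _ _; exact: F0.
  + apply/trivIsetP => i j _ _ ij; move/trivIsetP : tF => /(_ i j I I ij) FF.
    rewrite -subset0 => x [[_ Fi] [_ Fj]].
    by have : (F i `&` F j) (p x) by []; rewrite FF.
  + by move=> k; apply: measurableI => //; exact: mpre.
  + apply: (integrableS measurableT) => //.
    by apply: bigcupT_measurable => k; apply: measurableI => //; exact: mpre.
Qed.

End Dynkin.

(** * The lemma of du Bois-Reymond *)

Section DuBoisReymond.
Variable R : realType.
Local Notation mplane := (measurableTypeR R * measurableTypeR R)%type.
Implicit Types h : plane R -> R.

Lemma loc_integrable_rect h (a b c d : R) : loc_integrable2 h ->
  (leb2 R).-integrable (`[a, b] `*` `[c, d]) (EFin \o h).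
Proof. by apply; apply: compact_setX; exact: segment_compact. Qed.

Let open_rect (a b c d : R) : set mplane := `]a, b[ `*` `]c, d[.
Let closed_rect (a b c d : R) : set mplane := `[a, b] `*` `[c, d].

Let mopen a b c d : measurable (open_rect a b c d).
Proof. by apply: measurableX; exact: measurable_itv. Qed.

Let mclosed a b c d : measurable (closed_rect a b c d).
Proof. by apply: measurableX; exact: measurable_itv. Qed.

Let open_closed a b c d : open_rect a b c d `<=` closed_rect a b c d.
Proof.
by move=> z [/=]; rewrite !in_itv/= => /andP[? ?] /andP[? ?]; split; rewrite /= in_itv/= !ltW.
Qed.

(** The test functions [plateau] tend to the indicator of the open rectangle, and [|h|] on the
    closed one dominates. *)
Lemma open_rect_integral0 h : loc_integrable2 h ->
  (forall psi, test_function setT psi -> int2 (fun z => h z * psi z) = 0) ->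
  forall a b c d, (\int[leb2 R]_(z in open_rect a b c d) (h z)%:E = 0)%E.
Proof.
move=> lh H a b c d.
have ih : (leb2 R).-integrable (closed_rect a b c d) (EFin \o h) by exact: loc_integrable_rect.
have mh : measurable_fun (closed_rect a b c d) h by apply/measurable_EFinP; exact: measurable_int ih.
have mpl n : measurable_fun (setT : set mplane) (plateau a b c d n).
  by apply: test_function_measurable; exact: plateau_test.
have mhn n : measurable_fun (closed_rect a b c d) (fun z => h z * plateau a b c d n z).
  by apply: measurable_funM => //; exact: measurable_funTS.
have dom n z : `|h z * plateau a b c d n z| <= `|h z|.
  rewrite normrM ler_piMr//; have /andP[p0 p1] := plateau_bounds a b c d n z.
  by rewrite ger0_norm.
have ihn n : (leb2 R).-integrable (closed_rect a b c d) (fun z => (h z * plateau a b c d n z)%:E).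
  apply: le_integrable ih => //; first exact/measurable_EFinP.
  by move=> z _ /=; rewrite lee_fin.
have In n : (\int[leb2 R]_(z in closed_rect a b c d) (h z * plateau a b c d n z)%:E = 0)%E.
  have := H _ (plateau_test a b c d n); rewrite /int2 => E.
  have hres : (fun z => h z * plateau a b c d n z) = (fun z => h z * plateau a b c d n z) \_ (closed_rect a b c d).
    apply/funext => z; rewrite patchE; case: ifPn => // /negP nz.
    by rewrite plateau_out ?mulr0// => Bz; apply: nz; rewrite inE.
  move: E; rewrite hres -Rintegral_mkcond /Rintegral => E.
  by rewrite -[LHS]fineK ?E//; exact: integrable_fin_num.
have lim : (fun n => \int[leb2 R]_(z in closed_rect a b c d) (h z * plateau a b c d n z)%:E)%E @ \oo -->
   (\int[leb2 R]_(z in closed_rect a b c d) (h z * \1_(open_rect a b c d) z)%:E)%E.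
  apply: (@dominated_cvg _ mplane R (leb2 R) _ (mclosed a b c d)
    (fun n z => (h z * plateau a b c d n z)%:E) (fun z => (h z * \1_(open_rect a b c d) z)%:E)
    (fun z => `|h z|%:E)) => //.
  - by move=> n; exact/measurable_EFinP.
  - move=> z _; apply: cvg_EFin; first exact: nearW.
    by apply: cvgM; [exact: cvg_cst|exact: plateau_cvg].
  - exact: (integrable_abse (ih)).
  - by move=> n z _ /=; rewrite lee_fin.
have L0 : (\int[leb2 R]_(z in closed_rect a b c d) (h z * \1_(open_rect a b c d) z)%:E = 0)%E.
  move: lim; rewrite (_ : (fun n => _) = (fun=> 0%E)); last by apply/funext => n; exact: In.
  move=> /(cvg_lim (@ereal_hausdorff R)) <-.
  by apply/(cvg_lim (@ereal_hausdorff R)); exact: cvg_cst.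
rewrite -[RHS]L0 integral_mkcond [RHS]integral_mkcond; apply: eq_integral => z _.
rewrite !patchE indicE; case: ifPn => zo.
  rewrite mem_set; last by apply: open_closed; move: zo; rewrite inE.
  by rewrite mulr1.
by case: ifP; rewrite ?mulr0.
Qed.

Let hcut h (N : R) : plane R -> R := h \_ (open_rect (- N) N (- N) N).

Let cut_integrable h N : loc_integrable2 h -> (leb2 R).-integrable setT (EFin \o hcut h N).
Proof.
move=> lh; rewrite /hcut -restrict_EFin; apply/integrable_restrict => //; rewrite setTI.
have := @loc_integrable_rect h (- N) N (- N) N lh.
by apply: integrableS; [exact: mclosed|exact: mopen|exact: open_closed].
Qed.

Let ooI (a b c d : R) : `]a, b[%classic `&` `]c, d[%classic = `]Num.max a c, Num.min b d[%classic :> set R.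
Proof.
apply/seteqP; split => x /=; rewrite !in_itv/=.
  by move=> [/andP[? ?] /andP[? ?]]; rewrite gt_max lt_min; apply/andP; split; apply/andP.
by rewrite gt_max lt_min => /andP[/andP[? ?] /andP[? ?]]; split; apply/andP.
Qed.

Let openI (a b c d a' b' c' d' : R) : open_rect a b c d `&` open_rect a' b' c' d' =
  open_rect (Num.max a a') (Num.min b b') (Num.max c c') (Num.min d d').
Proof. by rewrite /open_rect -setXI !ooI. Qed.

Let cut_rect h N A : measurable A ->
  (\int[leb2 R]_(z in A) (hcut h N z)%:E =
   \int[leb2 R]_(z in A `&` open_rect (- N) N (- N) N) (h z)%:E)%E.
Proof.
move=> mA; rewrite integral_mkcondr; apply: eq_integral => z _.
by rewrite /hcut !patchE; case: ifP.
Qed.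

(** Cut to a square, [h] is integrable with integral 0 over every open rectangle, hence over every
    measurable set; so the cut function vanishes almost everywhere, and countably many squares
    exhaust the plane. *)
Lemma du_bois_reymond h : loc_integrable2 h ->
  (forall psi, test_function setT psi -> int2 (fun z => h z * psi z) = 0) ->
  {ae leb2 R, forall z, h z = 0}.
Proof.
move=> lh H.
have cutN (N : R) A : measurable A -> (\int[leb2 R]_(z in A) (hcut h N z)%:E = 0)%E.
  pose f := EFin \o hcut h N.
  have intf : (leb2 R).-integrable setT f by exact: cut_integrable.
  have GI : setI_closed (@RGenOpens.G R).
    move=> _ _ [a [b ->]] [c [d ->]]; rewrite ooI.
    by exists (Num.max a c), (Num.min b d).
  have mG : @measurable _ (measurableTypeR R) = <<s (@RGenOpens.G R) >> := RGenOpens.measurableE R.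
  have rect a b c d : (\int[leb2 R]_(z in open_rect a b c d) f z = 0)%E.
    by rewrite cut_rect//; rewrite openI; exact: open_rect_integral0.
  (* Off the open square [f] vanishes, so full strips can be traded for rectangles; this provides
     the total integral 0 that the Dynkin argument starts from. *)
  have sub (A' B' : set mplane) : measurable A' -> measurable B' ->
      A' `&` open_rect (- N) N (- N) N = B' `&` open_rect (- N) N (- N) N ->
      (\int[leb2 R]_(z in A') f z = \int[leb2 R]_(z in B') f z)%E.
    by move=> mA mB E; rewrite !cut_rect// E.
  have step1 c d (A' : set (measurableTypeR R)) : measurable A' ->
      (\int[leb2 R]_(z in (setT `*` `]c, d[) `&` fst @^-1` A') f z = 0)%E.
    have mB : measurable ((setT `*` `]c, d[) : set mplane) by apply: measurableX.
    apply: (@integral_preimage_eq0 _ _ _ mplane _ _ f fst _ _ mG GI) => //.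
    - rewrite -(rect (- N) N c d); apply: sub => //.
      apply/seteqP; split => -[x y] /= [[h1 h2] [h3 h4]]; split; split => //.
    - move=> _ [a [b ->]]; rewrite -(rect a b c d).
      congr integral; apply/seteqP; split => [[x y] /= [[_ h2] h3]|[x y] /= [h1 h2]].
        by split.
      by split=> //; split.
  have step2 (A' B' : set (measurableTypeR R)) : measurable A' -> measurable B' ->
      (\int[leb2 R]_(z in (A' `*` setT) `&` snd @^-1` B') f z = 0)%E.
    move=> mA'.
    have mB : measurable ((A' `*` setT) : set mplane) by apply: measurableX.
    apply: (@integral_preimage_eq0 _ _ _ mplane _ _ f snd _ _ mG GI) => //.
    - rewrite -(step1 (- N) N A' mA'); apply: sub => //.
        apply: measurableI; first by apply: measurableX.
        by rewrite -[X in measurable X]setTI; apply: measurable_fst.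
      apply/seteqP; split => -[x y] /=.
        by move=> [[h1 h2] [h3 h4]]; split.
      by move=> [[[h1 h2] h3] [h4 h5]]; split.
    - move=> _ [c [d ->]]; rewrite -(step1 c d A' mA').
      congr integral; apply/seteqP; split => -[x y] /= [[h1 h2] h3]; split => //.
  have rect2 (A' B' : set (measurableTypeR R)) : measurable A' -> measurable B' ->
      (\int[leb2 R]_(z in A' `*` B') f z = 0)%E.
    move=> mA' mB'; rewrite -(step2 A' B' mA' mB').
    congr integral; apply/seteqP; split => -[x y] /= => [[h1 h2]|[[h1 h2] h3]]; split => //.
  move=> mA.
  pose G2 := [set A `*` B | A in @measurable _ (measurableTypeR R) & B in @measurable _ (measurableTypeR R)].
  have := @integral_preimage_eq0 R _ _ mplane mplane (leb2 R) f id setT G2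
    (measurable_prod_measurableType _ _) _ measurableT (@measurable_id _ _ setT) intf _ _ A mA.
  rewrite preimage_id setTI; apply.
  - move=> _ _ [A1 mA1 [B1 mB1 <-]] [A2 mA2 [B2 mB2 <-]]; rewrite -setXI.
    by exists (A1 `&` A2); [exact: measurableI|exists (B1 `&` B2) => //; exact: measurableI].
  - by rewrite -setXTT; exact: rect2.
  - by move=> _ [A1 mA1 [B1 mB1 <-]]; rewrite setTI preimage_id; exact: rect2.
have aeN n : ae_eq (leb2 R) setT (EFin \o hcut h n%:R) (cst 0%E).
  apply: integral_ae_eq => //; first exact: cut_integrable.
  by move=> E _ mE; rewrite integral0; exact: cutN.
have : {ae leb2 R, forall z, forall n : nat, hcut h n%:R z = 0}.
  apply/ae_foralln => n; apply: filterS (aeN n) => z /(_ I) /= [].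
  by [].
move=> Hall; apply: (@filterS _ _ (ae_filter_ringOfSetsType (leb2 R)) _ _ _ Hall) => z Hz.
pose M := Num.max `|z.1| `|z.2|.
have [n Mn] : exists n : nat, M < n%:R.
  exists (Num.truncn M).+1; exact: truncnS_gt.
have := Hz n; rewrite /hcut patchE mem_set//.
move: Mn; rewrite /M gt_max !ltr_norml => /andP[h1 h2].
by split; rewrite /= in_itv.
Qed.

End DuBoisReymond.

(** * Fourier transform of integrable functions *)

Section SigmaFinitePlane.
Variable R : realType.

(* The canonical sigma-finiteness of a product is shadowed by the instance for subprobabilities;
   a copy of [leb2] can carry it. *)
Definition sleb2 : set (measurableTypeR R * measurableTypeR R)%type -> \bar R := leb2 R.

Let sleb2_0 : sleb2 set0 = 0%E. Proof. exact: measure0. Qed.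
Let sleb2_ge0 A : (0 <= sleb2 A)%E. Proof. exact: measure_ge0. Qed.
Let sleb2_additive : semi_sigma_additive sleb2.
Proof. exact: (@measure_semi_sigma_additive _ _ _ (leb2 R)). Qed.

HB.instance Definition _ := isMeasure.Build _ _ _ sleb2 sleb2_0 sleb2_ge0 sleb2_additive.

Let sleb2_sigma_finite : sigma_finite setT sleb2.
Proof.
exists (fun n => `[- n%:R, n%:R] `*` `[- n%:R, n%:R]).
  apply/esym/seteqP; split => // z _.
  pose M := Num.max `|z.1| `|z.2|.
  exists (Num.truncn M).+1 => //.
  have := truncnS_gt M; rewrite /M gt_max !ltr_norml => /andP[/andP[h1 h2] /andP[h3 h4]].
  by split; rewrite /= in_itv/= !ltW.
by move=> n; split; [apply: measurableX|exact: leb2_box_lty].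
Qed.

HB.instance Definition _ := Measure_isSigmaFinite.Build _ _ _ sleb2 sleb2_sigma_finite.

End SigmaFinitePlane.

Section FourierIntegral.
Variable R : realType.
Local Notation lam := (@lebesgue_measure R).
Local Notation mplane := (measurableTypeR R * measurableTypeR R)%type.
Local Notation L2 := (@sleb2 R).
Implicit Types (g : plane R -> R) (xi : plane R).

Lemma dot2C (x y : plane R) : dot2 x y = dot2 y x.
Proof. by rewrite /dot2 ![x.1 * _]mulrC ![x.2 * _]mulrC. Qed.

Lemma Re_fourier_integral g xi : complex.Re (fourier_integral g xi) =
  int2 (fun y => g y * cos (2 * pi * dot2 y xi)).
Proof. by congr int2; apply/funext => y /=; rewrite cosN mul0r subr0. Qed.

Lemma Im_fourier_integral g xi : complex.Im (fourier_integral g xi) =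
  int2 (fun y => - (g y * sin (2 * pi * dot2 y xi))).
Proof. by congr int2; apply/funext => y /=; rewrite sinN mul0r addr0 mulrN. Qed.

Section Kernel.
Variables (A B : plane R -> R) (t : R -> R).
Hypotheses (mA : measurable_fun (setT : set mplane) A) (mB : measurable_fun (setT : set mplane) B).
Hypotheses (iA : (leb2 R).-integrable setT (EFin \o A)) (iB : (leb2 R).-integrable setT (EFin \o B)).
Hypotheses (ct : continuous t) (t1 : forall s, `|t s| <= 1).

(** A real kernel [t] bounded by 1 covers real and imaginary parts alike: [t] is the cosine for the
    former and minus the sine for the latter. *)
Let ker (z : mplane * mplane) := (A z.1 * B z.2 * t (2 * pi * dot2 z.2 z.1))%:E.

Let mker : measurable_fun setT ker.
Proof.
apply/measurable_EFinP; apply: measurable_funM.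
  apply: measurable_funM.
    exact: (measurableT_comp mA measurable_fst).
  exact: (measurableT_comp mB measurable_snd).
apply: (measurableT_comp (continuous_measurable_fun ct)).
apply: measurable_funM => //; apply: measurable_funD; apply: measurable_funM.
- exact: (measurableT_comp measurable_fst measurable_snd).
- exact: (measurableT_comp measurable_fst measurable_fst).
- exact: (measurableT_comp measurable_snd measurable_snd).
- exact: (measurableT_comp measurable_snd measurable_fst).
Qed.

Let iker : (L2 \x L2)%E.-integrable setT ker.
Proof.
apply/integrable12ltyP => //.
have mAa : measurable_fun (setT : set mplane) (fun x => `|A x|%:E).
  by apply/measurable_EFinP; exact: measurableT_comp.
have mBa : measurable_fun (setT : set mplane) (fun x => `|B x|%:E).
  by apply/measurable_EFinP; exact: measurableT_comp.
have fB : (\int[L2]_y `|B y|%:E < +oo)%E by case/integrableP : iB.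
have fA : (\int[L2]_y `|A y|%:E < +oo)%E by case/integrableP : iA.
have fB' : (\int[L2]_y `|B y|%:E)%E \is a fin_num.
  by rewrite ge0_fin_numE//; apply: integral_ge0 => y _; rewrite lee_fin.
have fA' : (\int[L2]_y `|A y|%:E)%E \is a fin_num.
  by rewrite ge0_fin_numE//; apply: integral_ge0 => y _; rewrite lee_fin.
have h1 x : (\int[L2]_y `|ker (x, y)| <= `|A x|%:E * \int[L2]_y `|B y|%:E)%E.
  rewrite -ge0_integralZl//.
  apply: ge0_le_integral => //.
  - apply: measurableT_comp => //.
    exact: (measurableT_comp mker (measurable_pair1 x)).
  - by apply: emeasurable_funM => //; exact: measurable_cst.
  - move=> y _; rewrite /ker /= -EFinM lee_fin !normrM.
    by rewrite ler_piMr// mulr_ge0.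
apply: (@le_lt_trans _ _ (\int[L2]_x (`|A x|%:E * \int[L2]_y `|B y|%:E))%E).
  apply: ge0_le_integral => //.
  - by move=> x _; apply: integral_ge0.
  - apply: (@measurable_fun_fubini_tonelli_F _ _ _ _ _ L2 (fun z => `|ker z|%E)) => //.
    exact: measurableT_comp.
  - by apply: emeasurable_funM => //; exact: measurable_cst.
rewrite ge0_integralZr//.
- by rewrite -(fineK fA') -(fineK fB') -EFinM ltry.
- by apply: integral_ge0 => y _; rewrite lee_fin.
Qed.

Let inner1 x : (\int[L2]_y ker (x, y))%E = (A x * int2 (fun y => B y * t (2 * pi * dot2 y x)))%:E.
Proof.
have i1 : L2.-integrable setT (fun y => (B y * t (2 * pi * dot2 y x))%:E).
  apply: le_integrable iB => //.
    apply/measurable_EFinP; apply: measurable_funM => //.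
    apply: (measurableT_comp (continuous_measurable_fun ct)).
    apply: measurable_funM => //; apply: measurable_funD; apply: measurable_funM => //.
  by move=> y _ /=; rewrite lee_fin normrM ler_piMr.
rewrite /ker /=; under eq_integral do rewrite -mulrA EFinM.
rewrite integralZl// EFinM; congr (_ * _)%E.
by rewrite /int2 /Rintegral fineK//; exact: integrable_fin_num.
Qed.

Let inner2 y : (\int[L2]_x ker (x, y))%E = (B y * int2 (fun x => A x * t (2 * pi * dot2 x y)))%:E.
Proof.
have i1 : L2.-integrable setT (fun x => (A x * t (2 * pi * dot2 x y))%:E).
  apply: le_integrable iA => //.
    apply/measurable_EFinP; apply: measurable_funM => //.
    apply: (measurableT_comp (continuous_measurable_fun ct)).
    apply: measurable_funM => //; apply: measurable_funD; apply: measurable_funM => //.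
  by move=> x _ /=; rewrite lee_fin normrM ler_piMr.
transitivity (\int[L2]_x ((B y)%:E * (A x * t (2 * pi * dot2 x y))%:E))%E.
  apply: eq_integral => x _; rewrite /ker /= -EFinM dot2C; congr (_%:E).
  by rewrite mulrCA mulrA.
rewrite integralZl// EFinM; congr (_ * _)%E.
by rewrite /int2 /Rintegral fineK//; exact: integrable_fin_num.
Qed.

(** One component of the multiplication formula, which moves the Fourier transform from one factor
    of an integral to the other. *)
Lemma kernel_swap : int2 (fun x => A x * int2 (fun y => B y * t (2 * pi * dot2 y x))) =
  int2 (fun y => B y * int2 (fun x => A x * t (2 * pi * dot2 x y))).
Proof.
rewrite /int2 /Rintegral; congr fine.
have := Fubini iker.
under [X in X = _ -> _]eq_integral do rewrite inner1.
by under [X in _ = X -> _]eq_integral do rewrite inner2.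
Qed.

Lemma kernel_integrable :
  (leb2 R).-integrable setT (fun x => (A x * int2 (fun y => B y * t (2 * pi * dot2 y x)))%:E).
Proof.
have := integrable_fubini_F iker.
by under [X in integrable _ _ X -> _]eq_fun do rewrite /fubini_F inner1.
Qed.

End Kernel.

Lemma loc_integrable_transform g (t : R -> R) : measurable_fun (setT : set mplane) g ->
  (leb2 R).-integrable setT (EFin \o g) -> continuous t -> (forall s, `|t s| <= 1) ->
  loc_integrable2 (fun xi => int2 (fun y => g y * t (2 * pi * dot2 y xi))).
Proof.
move=> mg ig ct t1 K cK.
have [N N0 KN] := compact_plane_box cK.
pose B : set mplane := `[- N, N] `*` `[- N, N].
have mB : measurable B by apply: measurableX.
have mK := compact_measurable_plane cK.
(* With the indicator of a box as first factor, integrability of the kernel becomes local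
   integrability of the transform. *)
pose A := \1_B : plane R -> R.
have mA : measurable_fun (setT : set mplane) A by exact: measurable_indic.
have iA : (leb2 R).-integrable setT (EFin \o A).
  apply: (@integrable_bounded_support _ A 1 N) => //.
    by move=> z; rewrite /A indicE; case: (_ \in _); rewrite ?normr1 ?normr0.
  by move=> z nB; rewrite /A indicE memNset.
have := kernel_integrable mA mg iA ig ct t1.
move=> /(integrableS measurableT mK (@subsetT _ _)).
apply: eq_integrable => // z; rewrite inE => Kz.
by rewrite /A indicE mem_set ?mul1r//; exact: KN.
Qed.

Lemma is_fourier_integrable g : measurable_fun (setT : set mplane) g ->
  (leb2 R).-integrable setT (EFin \o g) -> is_fourier g (fourier_integral g).
Proof.
move=> mg ig.
have c1 (s : R) : `|cos s| <= 1 by rewrite ler_norml cos_geN1 cos_le1.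
have s1 (s : R) : `|sin s| <= 1 by rewrite ler_norml sin_geN1 sin_le1.
have cc := @continuous_cos R.
have cs := @continuous_sin R.
split.
- exists 0%N; apply: eq_integrable ig => // z _ /=.
  by rewrite expr0 divr1.
- under eq_fun do rewrite Re_fourier_integral.
  exact: loc_integrable_transform.
- under eq_fun do rewrite Im_fourier_integral.
  have cNs : continuous (fun s : R => - sin s).
    by move=> s; apply: continuousN; exact: cs.
  under eq_fun => xi do under eq_fun do rewrite -mulrN.
  by apply: (@loc_integrable_transform _ (fun s => - sin s)) => // s; rewrite normrN.
- move=> psi tpsi.
  have mpsi := test_function_measurable tpsi.
  have ipsi := test_function_integrable tpsi.
  rewrite /cint2; congr (_ +i* _)%C.
  + transitivity (int2 (fun xi => psi xi * int2 (fun y => g y * cos (2 * pi * dot2 y xi)))).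
      by congr int2; apply/funext => xi; rewrite -Re_fourier_integral /= mulr0 subr0 mulrC.
    rewrite (kernel_swap mpsi mg ipsi ig cc c1).
    by congr int2; apply/funext => x; rewrite -Re_fourier_integral /= mul0r subr0.
  + have cNs : continuous (fun s : R => - sin s).
      by move=> s; apply: continuousN; exact: cs.
    have s1' (s : R) : `|- sin s| <= 1 by rewrite normrN.
    transitivity (int2 (fun xi => psi xi * int2 (fun y => g y * - sin (2 * pi * dot2 y xi)))).
      congr int2; apply/funext => xi.
      transitivity (psi xi * complex.Im (fourier_integral g xi)); first by rewrite /= mulr0 add0r mulrC.
      by rewrite Im_fourier_integral; congr (_ * int2 _); apply/funext => y; rewrite mulrN.
    rewrite (kernel_swap mpsi mg ipsi ig cNs s1').
    congr int2; apply/funext => x.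
    transitivity (g x * complex.Im (fourier_integral psi x)); last by rewrite /= mul0r addr0.
    by rewrite Im_fourier_integral; congr (_ * int2 _); apply/funext => y; rewrite mulrN.
Qed.

Lemma integrable_loc_test (h psi : plane R -> R) : loc_integrable2 h -> test_function setT psi ->
  (leb2 R).-integrable setT (fun z => (h z * psi z)%:E).
Proof.
move=> lh tpsi; have [M [N [N0 pM p0]]] := test_function_bounded tpsi.
pose B : set mplane := `[- N, N] `*` `[- N, N].
have mB : measurable B by apply: measurableX.
have E : (fun z => h z * psi z) = (fun z => h z * psi z) \_ B.
  apply/funext => z; rewrite patchE; case: ifPn => // /negP nz.
  by rewrite p0 ?mulr0// => Bz; apply: nz; rewrite inE.
have ihB : (leb2 R).-integrable B (EFin \o h) by exact: loc_integrable_rect.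
suff : (leb2 R).-integrable setT (EFin \o ((fun z => h z * psi z) \_ B)) by rewrite -E.
rewrite -restrict_EFin; apply/integrable_restrict => //; rewrite setTI.
have iMh : (leb2 R).-integrable B (fun z => M%:E * (h z)%:E)%E by exact: integrableZl.
apply: le_integrable iMh => //.
  apply/measurable_EFinP; apply: measurable_funM.
    by apply/measurable_EFinP; exact: measurable_int ihB.
  by apply: measurable_funTS; exact: test_function_measurable.
move=> z _ /=; rewrite lee_fin !normrM mulrC ler_wpM2r//.
by apply: le_trans (pM z) _; exact: ler_norm.
Qed.

Lemma loc_integrable_eq_ae (h1 h2 : plane R -> R) : loc_integrable2 h1 -> loc_integrable2 h2 ->
  (forall psi, test_function setT psi -> int2 (fun z => h1 z * psi z) = int2 (fun z => h2 z * psi z)) ->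
  {ae leb2 R, forall z, h1 z = h2 z}.
Proof.
move=> l1 l2 H.
have : {ae leb2 R, forall z, h1 z - h2 z = 0}.
  apply: du_bois_reymond.
    move=> K cK; have mK := compact_measurable_plane cK.
    have := integrableB mK (l1 K cK) (l2 K cK).
    by apply: eq_integrable.
  move=> psi tpsi.
  transitivity (int2 (fun z => h1 z * psi z - h2 z * psi z)).
    by congr int2; apply/funext => z; rewrite mulrBl.
  rewrite /int2 RintegralB//; [|exact: integrable_loc_test|exact: integrable_loc_test].
  by have := H psi tpsi; rewrite /int2 => ->; rewrite subrr.
move=> Hae; apply: (@filterS _ _ (ae_filter_ringOfSetsType (leb2 R)) _ _ _ Hae) => z.
by move/eqP; rewrite subr_eq0 => /eqP.
Qed.

Lemma is_fourier_unique g F1 F2 : is_fourier g F1 -> is_fourier g F2 ->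
  {ae leb2 R, forall z, complex.Re (F1 z) ^+ 2 + complex.Im (F1 z) ^+ 2 =
    complex.Re (F2 z) ^+ 2 + complex.Im (F2 z) ^+ 2}.
Proof.
move=> [_ r1 i1 d1] [_ r2 i2 d2].
have cE (F : plane R -> R[i]) psi : cint2 (fun xi => F xi * (psi xi)%:C%C) =
    (int2 (fun xi => complex.Re (F xi) * psi xi) +i* int2 (fun xi => complex.Im (F xi) * psi xi))%C.
  by rewrite /cint2; congr (int2 _ +i* int2 _)%C; apply/funext => xi;
    case: (F xi) => a b /=; rewrite mulr0 ?subr0 ?add0r.
have RR : {ae leb2 R, forall z, complex.Re (F1 z) = complex.Re (F2 z)}.
  apply: loc_integrable_eq_ae => // psi tpsi.
  by have := etrans (d1 psi tpsi) (esym (d2 psi tpsi)); rewrite !cE => -[].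
have II : {ae leb2 R, forall z, complex.Im (F1 z) = complex.Im (F2 z)}.
  apply: loc_integrable_eq_ae => // psi tpsi.
  by have := etrans (d1 psi tpsi) (esym (d2 psi tpsi)); rewrite !cE => -[].
have Hae := @filterI _ _ (ae_filter_ringOfSetsType (leb2 R)) _ _ RR II.
by apply: (@filterS _ _ (ae_filter_ringOfSetsType (leb2 R)) _ _ _ Hae) => z [/= -> ->].
Qed.

Lemma loc_integrable_measurable (h : plane R -> R) : loc_integrable2 h ->
  measurable_fun (setT : set mplane) h.
Proof.
move=> lh.
have -> : (setT : set mplane) = \bigcup_n (`[- n%:R, n%:R] `*` `[- n%:R, n%:R]).
  apply/esym/seteqP; split => // z _.
  pose M := Num.max `|z.1| `|z.2|.
  exists (Num.truncn M).+1 => //.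
  have := truncnS_gt M; rewrite /M gt_max !ltr_norml => /andP[/andP[h1 h2] /andP[h3 h4]].
  by split; rewrite /= in_itv/= !ltW.
apply/measurable_fun_bigcup => n; first by apply: measurableX.
by apply/measurable_EFinP; apply: measurable_int; exact: loc_integrable_rect.
Qed.

(** [fourier] is picked by [xget] among all functions satisfying the duality relation; their moduli
    agree almost everywhere, so any explicit transform computes the norm. *)
Lemma weighted_normE (w : plane R -> R) g F : measurable_fun (setT : set mplane) w ->
  (forall xi, 0 <= w xi) -> is_fourier g F ->
  weighted_norm w g =
  sqrte (\int[leb2 R]_xi (w xi * (complex.Re (F xi) ^+ 2 + complex.Im (F xi) ^+ 2))%:E)%E.
Proof.
move=> mw w0 gF; rewrite /weighted_norm; congr sqrte.
have gF' : is_fourier g (fourier g).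
  by rewrite /fourier; case: xgetP => [_ -> //|/(_ F)]; exact.
have mFm G : is_fourier g G -> measurable_fun (setT : set mplane)
    (fun xi => (w xi * (complex.Re (G xi) ^+ 2 + complex.Im (G xi) ^+ 2))%:E).
  move=> [_ /loc_integrable_measurable mr /loc_integrable_measurable mi _].
  apply/measurable_EFinP; apply: measurable_funM => //.
  by apply: measurable_funD; exact: measurable_funX.
apply: ge0_ae_eq_integral => //.
- exact: mFm.
- exact: mFm.
- by move=> z _; rewrite lee_fin mulr_ge0// addr_ge0 ?sqr_ge0.
- by move=> z _; rewrite lee_fin mulr_ge0// addr_ge0 ?sqr_ge0.
- have Hae := is_fourier_unique gF' gF.
  by apply: (@filterS _ _ (ae_filter_ringOfSetsType (leb2 R)) _ _ _ Hae) => z -> _.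
Qed.

End FourierIntegral.

(** * Wave packets *)

Section Oscillation.
Variable R : realType.
Local Notation mu := (@lebesgue_measure R).
Local Notation mplane := (measurableTypeR R * measurableTypeR R)%type.

Lemma Rintegral_segment_le (f : R -> R) (l r M : R) : l <= r -> continuous f ->
  (forall x, l <= x <= r -> `|f x| <= M) -> `|\int[mu]_(x in `[l, r]) f x| <= M * (r - l).
Proof.
move=> lr cf fM.
have := @Rintegral_segment_dist R f (cst 0) l r M lr (fun y _ => cf y) (fun y _ => @cst_continuous _ _ 0 y).
have -> : \int[mu]_(y in `[l, r]) cst 0 y = 0 by rewrite Rintegral_cst//= mul0r.
by rewrite subr0; apply => y yl; rewrite subr0; exact: fM.
Qed.

Lemma is_derive_sinw (w x : R) : is_derive x 1 (fun y => sin (w * y)) (cos (w * x) * w).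
Proof.
have d : is_derive x 1 (fun y : R => w * y) (w * 1) := is_derive_cmul w (is_derive_id x 1).
by apply: is_derive_eq1 (@is_derive_comp R sin (fun y => w * y) x _ _ (is_derive_sin (w * x)) d) _; rewrite mulr1.
Qed.

Lemma is_derive_cosw (w x : R) : is_derive x 1 (fun y => cos (w * y)) (- sin (w * x) * w).
Proof.
have d : is_derive x 1 (fun y : R => w * y) (w * 1) := is_derive_cmul w (is_derive_id x 1).
by apply: is_derive_eq1 (@is_derive_comp R cos (fun y => w * y) x _ _ (is_derive_cos (w * x)) d) _; rewrite mulr1.
Qed.

Lemma continuous_sinw (w : R) : continuous (fun y => sin (w * y)).
Proof. by move=> x; exact: derive_continuous (is_derive_sinw w x). Qed.

Lemma continuous_cosw (w : R) : continuous (fun y => cos (w * y)).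
Proof. by move=> x; exact: derive_continuous (is_derive_cosw w x). Qed.

Lemma continuous_mul (f g : R -> R) : continuous f -> continuous g -> continuous (fun x => f x * g x).
Proof. by move=> cf cg x; apply: continuousM; [exact: cf|exact: cg]. Qed.

Section Parts.
Variables (F f : R -> R) (l r w : R).
Hypotheses (lr : l < r) (dF : forall x : R, is_derive x 1 F (f x)) (cf : continuous f)
  (Fl : F l = 0) (Fr : F r = 0).

Let cF : continuous F. Proof. by move=> x; exact: derive_continuous (dF x). Qed.

Let parts (t t' : R -> R) : (forall x : R, is_derive x 1 t (t' x)) -> continuous t' ->
  \int[mu]_(x in `[l, r]) (F x * t' x) = - \int[mu]_(x in `[l, r]) (f x * t x).
Proof.
move=> dt ct'; have ct : continuous t by move=> x; exact: derive_continuous (dt x).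
have c1 := continuous_mul cf ct; have c2 := continuous_mul cF ct'.
have := @FTC_segment R (fun x => F x * t x) (fun x => f x * t x + F x * t' x) l r lr
  (fun x _ => is_derive_mul (dF x) (dt x)) (fun x _ => continuousD (c1 x) (c2 x)).
rewrite Fl Fr !mul0r subrr RintegralD//.
- by move/eqP; rewrite addrC addr_eq0 => /eqP.
- by apply: integrable_segment => y _; exact: c1.
- by apply: integrable_segment => y _; exact: c2.
Qed.

Lemma parts_cos : w * \int[mu]_(x in `[l, r]) (F x * cos (w * x)) =
  - \int[mu]_(x in `[l, r]) (f x * sin (w * x)).
Proof.
rewrite -(parts (is_derive_sinw w)); last first.
  by apply: continuous_mul; [exact: continuous_cosw|move=> x; exact: cst_continuous].
rewrite -RintegralZl//.
  by apply: eq_Rintegral => x _; ring.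
by apply: integrable_segment => y _; apply: continuous_mul; [exact: cF|exact: continuous_cosw].
Qed.

Lemma parts_sin : w * \int[mu]_(x in `[l, r]) (F x * sin (w * x)) =
  \int[mu]_(x in `[l, r]) (f x * cos (w * x)).
Proof.
rewrite -[RHS]opprK -(parts (is_derive_cosw w)); last first.
  apply: continuous_mul; last by move=> x; exact: cst_continuous.
  by move=> x; apply: continuousN; exact: continuous_sinw.
rewrite -mulN1r -!RintegralZl//.
- by apply: eq_Rintegral => x _; ring.
- apply: integrable_segment => y _; apply: continuous_mul; first exact: cF.
  apply: continuous_mul; last by move=> x; exact: cst_continuous.
  by move=> x; apply: continuousN; exact: continuous_sinw.
- by apply: integrable_segment => y _; apply: continuous_mul; [exact: cF|exact: continuous_sinw].
Qed.

End Parts.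

(** Three integrations by parts give a squared transform of order [|xi| ^ -6], enough against the
    factor [|xi| ^ (7 / 2)] of the weight. The boundary terms involve [pf0], [pf1] and [pf2]; the
    sizes that enter are those of [pf0] and [pf3]. *)
Record profile := Profile {
  pf0 : R -> R; pf1 : R -> R; pf2 : R -> R; pf3 : R -> R; pfL : R; pfM : R;
  pf_d0 : forall x : R, is_derive x 1 pf0 (pf1 x);
  pf_d1 : forall x : R, is_derive x 1 pf1 (pf2 x);
  pf_d2 : forall x : R, is_derive x 1 pf2 (pf3 x);
  pf_c3 : continuous pf3;
  pf_L : 0 < pfL;
  pf_out : forall x, pfL <= `|x| -> [/\ pf0 x = 0, pf1 x = 0 & pf2 x = 0];
  pf_M0 : forall x, `|pf0 x| <= pfM;
  pf_M3 : forall x, `|pf3 x| <= pfM }.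

Variables (P : profile) (sg p : R).
Hypothesis sg0 : 0 < sg.

Definition scaled x : R := pf0 P ((x - p) / sg).

Let scaled_derive (f f' : R -> R) n : (forall x : R, is_derive x 1 f (f' x)) ->
  forall x : R, is_derive x 1 (fun x => f ((x - p) / sg) / sg ^+ n) (f' ((x - p) / sg) / sg ^+ n.+1).
Proof.
move=> df x.
have d : is_derive x 1 (fun x : R => (x - p) / sg) ((1 - 0) * sg^-1 + (x - p) * 0).
  exact: (is_derive_mul (is_derive_sub (is_derive_id x 1) (is_derive_const p x)) (is_derive_const sg^-1 x)).
have h := @is_derive_comp R f (fun x => (x - p) / sg) x _ _ (df ((x - p) / sg)) d.
apply: is_derive_eq1 (is_derive_mul h (is_derive_const (sg ^+ n)^-1 x)) _.
by rewrite subr0 mul1r !mulr0 !addr0 exprS invfM mulrA.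
Qed.

Let edge (f : R -> R) : (forall x, pfL P <= `|x| -> f x = 0) ->
  f ((p - pfL P * sg - p) / sg) = 0 /\ f ((p + pfL P * sg - p) / sg) = 0.
Proof.
move=> f0; have L0 := pf_L P.
have -> : (p - pfL P * sg - p) / sg = - pfL P by field; rewrite gt_eqF.
have -> : (p + pfL P * sg - p) / sg = pfL P by field; rewrite gt_eqF.
by split; apply: f0; rewrite ?normrN gtr0_norm.
Qed.

Lemma scaled_out x : ~ `[p - pfL P * sg, p + pfL P * sg]%classic x -> scaled x = 0.
Proof.
move=> nx; rewrite /scaled; have [|-> //] := @pf_out P ((x - p) / sg).
rewrite normrM normfV (gtr0_norm sg0) ler_pdivlMr// leNgt; apply/negP => h; apply: nx.
by move: h; rewrite ltr_norml /= in_itv/= => /andP[? ?]; apply/andP; split; lra.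
Qed.

Let scaled_derive0 (x : R) : is_derive x 1 scaled (pf1 P ((x - p) / sg) / sg ^+ 1).
Proof.
have -> : scaled = fun x => pf0 P ((x - p) / sg) / sg ^+ 0.
  by apply/funext => y; rewrite expr0 divr1.
exact: scaled_derive 0%N (@pf_d0 P) x.
Qed.

Lemma continuous_scaled : continuous scaled.
Proof. by move=> x; exact: derive_continuous (scaled_derive0 x). Qed.

Definition osc_cos (xi : R) := \int[mu]_(x in `[p - pfL P * sg, p + pfL P * sg]) (scaled x * cos (2 * pi * xi * x)).
Definition osc_sin (xi : R) := \int[mu]_(x in `[p - pfL P * sg, p + pfL P * sg]) (scaled x * sin (2 * pi * xi * x)).

Definition osc_const := 32 * pfL P ^+ 2 * pfM P ^+ 2.

(** The trivial bound serves low frequencies and the one from three integrations by parts high ones;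
    [(1 + y) ^+ 3 <= 4 * (1 + y ^+ 3)] merges them into one. *)
Let osc_combine (I xi : R) : `|I| <= pfM P * (2 * pfL P * sg) ->
  `|2 * pi * xi| ^+ 3 * `|I| <= pfM P / sg ^+ 3 * (2 * pfL P * sg) ->
  I ^+ 2 <= osc_const * 2 * sg ^+ 2 / (1 + (sg * xi) ^+ 2) ^+ 3.
Proof.
move=> h1 h2.
have L0 := pf_L P.
have M0 : 0 <= pfM P by apply: le_trans (pf_M0 P 0).
set J := pfM P * (2 * pfL P * sg) in h1.
have J0 : 0 <= J by rewrite !mulr_ge0// ltW.
have pi1 : 1 <= 2 * pi :> R by have := @pi_ge2 R; lra.
have h3 : `|sg * xi| ^+ 3 * `|I| <= J.
  have -> : J = sg ^+ 3 * (pfM P / sg ^+ 3 * (2 * pfL P * sg)).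
    by rewrite /J; field; rewrite gt_eqF.
  apply: le_trans (ler_wpM2l _ h2); last by rewrite exprn_ge0// ltW.
  rewrite mulrA ler_wpM2r// normrM exprMn (gtr0_norm sg0) ler_wpM2l ?exprn_ge0 ?(ltW sg0)//.
  rewrite [`|2 * pi * xi|]normrM [leRHS]exprMn -[leLHS]mul1r ler_wpM2r ?exprn_ge0//.
  by rewrite exprn_ege1// ger0_norm// (le_trans ler01).
set s := sg * xi in h3 *.
have s2 : `|s| ^+ 2 = s ^+ 2 by rewrite real_normK ?num_real.
have den : 0 < (1 + s ^+ 2) ^+ 3 by rewrite exprn_gt0// ltr_wpDr ?sqr_ge0.
rewrite ler_pdivlMr//.
have I2 : I ^+ 2 <= J ^+ 2 by rewrite -[leLHS]real_normK ?num_real// ler_pXn2r ?nnegrE.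
have I6 : (s ^+ 2) ^+ 3 * I ^+ 2 <= J ^+ 2.
  have -> : (s ^+ 2) ^+ 3 * I ^+ 2 = (`|s| ^+ 3 * `|I|) ^+ 2.
    by rewrite -s2 -[I ^+ 2]real_normK ?num_real//; ring.
  by rewrite ler_pXn2r ?nnegrE// mulr_ge0// exprn_ge0.
have cube (y : R) : 0 <= y -> (1 + y) ^+ 3 <= 4 * (1 + y ^+ 3).
  move=> y0; have -> : 4 * (1 + y ^+ 3) = (1 + y) ^+ 3 + 3 * ((1 - y) ^+ 2 * (1 + y)) by ring.
  rewrite lerDl; apply: mulr_ge0 => //; apply: mulr_ge0; first exact: sqr_ge0.
  by rewrite addr_ge0.
have h4 : I ^+ 2 * (1 + s ^+ 2) ^+ 3 <= I ^+ 2 * (4 * (1 + (s ^+ 2) ^+ 3)).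
  by rewrite ler_wpM2l ?sqr_ge0// cube ?sqr_ge0.
apply: le_trans h4 _.
have -> : osc_const * 2 * sg ^+ 2 = 16 * J ^+ 2 by rewrite /osc_const /J; ring.
have -> : I ^+ 2 * (4 * (1 + (s ^+ 2) ^+ 3)) = 4 * (I ^+ 2 + (s ^+ 2) ^+ 3 * I ^+ 2) by ring.
by have := sqr_ge0 J; lra.
Qed.

Let Lr : p - pfL P * sg < p + pfL P * sg.
Proof. by have : 0 < pfL P * sg by [rewrite mulr_gt0// pf_L]; lra. Qed.

Let width : p + pfL P * sg - (p - pfL P * sg) = 2 * pfL P * sg.
Proof. by ring. Qed.

Let size0 (t : R -> R) : continuous t -> (forall s, `|t s| <= 1) ->
  `|\int[mu]_(x in `[p - pfL P * sg, p + pfL P * sg]) (scaled x * t x)| <= pfM P * (2 * pfL P * sg).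
Proof.
move=> ct t1; rewrite -width; apply: Rintegral_segment_le; first exact: ltW.
  by apply: continuous_mul => //; exact: continuous_scaled.
by move=> x _; rewrite normrM -[leRHS]mulr1 ler_pM// pf_M0.
Qed.

Let size3 (t : R -> R) : continuous t -> (forall s, `|t s| <= 1) ->
  `|\int[mu]_(x in `[p - pfL P * sg, p + pfL P * sg]) (pf3 P ((x - p) / sg) / sg ^+ 3 * t x)| <=
  pfM P / sg ^+ 3 * (2 * pfL P * sg).
Proof.
move=> ct t1; rewrite -width; apply: Rintegral_segment_le; first exact: ltW.
  apply: continuous_mul => //.
  apply: continuous_mul; last by move=> x; exact: cst_continuous.
  move=> x; apply: (@continuous_comp _ _ _ (fun x => (x - p) / sg) (pf3 P)); last exact: pf_c3.
  apply: continuousM; last exact: cst_continuous.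
  by apply: continuousB; [exact: cvg_id|exact: cst_continuous].
move=> x _; rewrite normrM -[leRHS]mulr1 ler_pM// normrM [`|_^-1|]ger0_norm ?invr_ge0 ?exprn_ge0 ?(ltW sg0)//.
by rewrite ler_wpM2r ?pf_M3// invr_ge0 exprn_ge0// ltW.
Qed.

Let chain (w : R) : (w ^+ 3 * \int[mu]_(x in `[p - pfL P * sg, p + pfL P * sg]) (scaled x * cos (w * x)) =
    \int[mu]_(x in `[p - pfL P * sg, p + pfL P * sg]) (pf3 P ((x - p) / sg) / sg ^+ 3 * sin (w * x))) /\
  (w ^+ 3 * \int[mu]_(x in `[p - pfL P * sg, p + pfL P * sg]) (scaled x * sin (w * x)) =
   - \int[mu]_(x in `[p - pfL P * sg, p + pfL P * sg]) (pf3 P ((x - p) / sg) / sg ^+ 3 * cos (w * x))).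
Proof.
have cont (f f' : R -> R) n : (forall x : R, is_derive x 1 f (f' x)) -> continuous (fun x => f ((x - p) / sg) / sg ^+ n).
  by move=> d x; exact: derive_continuous (scaled_derive n d x).
have c1 := cont _ _ 1%N (@pf_d1 P); have c2 := cont _ _ 2%N (@pf_d2 P).
have c3 : continuous (fun x => pf3 P ((x - p) / sg) / sg ^+ 3).
  apply: continuous_mul; last by move=> x; exact: cst_continuous.
  move=> x; apply: (@continuous_comp _ _ _ (fun x => (x - p) / sg) (pf3 P)); last exact: pf_c3.
  apply: continuousM; last exact: cst_continuous.
  by apply: continuousB; [exact: cvg_id|exact: cst_continuous].
have d0 := scaled_derive0.
have d1 := scaled_derive 1 (@pf_d1 P); have d2 := scaled_derive 2 (@pf_d2 P).
have [e0l e0r] : scaled (p - pfL P * sg) = 0 /\ scaled (p + pfL P * sg) = 0.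
  by apply: edge => x /pf_out[].
have [e1l e1r] := @edge (pf1 P) (fun x h => let: And3 _ a _ := pf_out h in a).
have [e2l e2r] := @edge (pf2 P) (fun x h => let: And3 _ _ a := pf_out h in a).
have z (f : R -> R) (x : R) n : f x = 0 -> f x / sg ^+ n = 0 by move=> ->; rewrite mul0r.
have w3 (I : R) : w ^+ 3 * I = w * (w * (w * I)) by ring.
split; rewrite w3.
  rewrite (parts_cos w Lr d0 c1 e0l e0r) !mulrN.
  rewrite (parts_sin w Lr d1 c2 (z _ _ 1%N e1l) (z _ _ 1%N e1r)).
  by rewrite (parts_cos w Lr d2 c3 (z _ _ 2%N e2l) (z _ _ 2%N e2r)) opprK.
rewrite (parts_sin w Lr d0 c1 e0l e0r).
rewrite (parts_cos w Lr d1 c2 (z _ _ 1%N e1l) (z _ _ 1%N e1r)) mulrN.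
by rewrite (parts_sin w Lr d2 c3 (z _ _ 2%N e2l) (z _ _ 2%N e2r)).
Qed.

Lemma osc_cos_le xi : osc_cos xi ^+ 2 <= osc_const * 2 * sg ^+ 2 / (1 + (sg * xi) ^+ 2) ^+ 3.
Proof.
apply: osc_combine.
  by apply: size0; [exact: continuous_cosw|move=> s; rewrite ler_norml cos_geN1 cos_le1].
rewrite -normrX -normrM (chain _).1.
by apply: size3; [exact: continuous_sinw|move=> s; rewrite ler_norml sin_geN1 sin_le1].
Qed.

Lemma osc_sin_le xi : osc_sin xi ^+ 2 <= osc_const * 2 * sg ^+ 2 / (1 + (sg * xi) ^+ 2) ^+ 3.
Proof.
apply: osc_combine.
  by apply: size0; [exact: continuous_sinw|move=> s; rewrite ler_norml sin_geN1 sin_le1].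
rewrite -normrX -normrM (chain _).2 normrN.
by apply: size3; [exact: continuous_cosw|move=> s; rewrite ler_norml cos_geN1 cos_le1].
Qed.

End Oscillation.

(** * Two cutoff profiles *)

Section Profiles.
Variable R : realType.
Local Notation mu := (@lebesgue_measure R).

Definition chain3 (f0 f1 f2 f3 : R -> R) :=
  [/\ forall x : R, is_derive x 1 f0 (f1 x), forall x : R, is_derive x 1 f1 (f2 x),
      forall x : R, is_derive x 1 f2 (f3 x) & continuous f3].

(** In general, four is the least exponent for which a power of the positive part has a continuous
    third derivative. *)
Lemma chain3_maxr_pow4 (h0 h1 h2 h3 : R -> R) : chain3 h0 h1 h2 h3 ->
  let m x := Num.max (h0 x) 0 in
  chain3 (fun x => m x ^+ 4) (fun x => 4 * (m x ^+ 3 * h1 x))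
    (fun x => 12 * (m x ^+ 2 * h1 x ^+ 2) + 4 * (m x ^+ 3 * h2 x))
    (fun x => 24 * (m x * h1 x ^+ 3) + 36 * (m x ^+ 2 * (h1 x * h2 x)) + 4 * (m x ^+ 3 * h3 x)).
Proof.
move=> [d0 d1 d2 c3] m.
have dm n (x : R) : is_derive x 1 (fun y => m y ^+ n.+2) (n.+2%:R * m x ^+ n.+1 * h1 x).
  exact: (@is_derive_comp R (fun s => Num.max s 0 ^+ n.+2) h0 x _ _ (is_derive_maxr_pow n (h0 x)) (d0 x)).
split=> [x|x|x|].
- by apply: is_derive_eq1 (dm 2%N x) _; ring.
- by apply: is_derive_eq1 (is_derive_cmul 4 (is_derive_mul (dm 1%N x) (d1 x))) _; ring.
- apply: is_derive_eq1 (is_derive_add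
    (is_derive_cmul 12 (is_derive_mul (dm 0%N x) (is_derive_pow 2 (d1 x))))
    (is_derive_cmul 4 (is_derive_mul (dm 1%N x) (d2 x)))) _.
  by rewrite /=; ring.
have ch0 : continuous h0 by move=> x; exact: derive_continuous (d0 x).
have ch1 : continuous h1 by move=> x; exact: derive_continuous (d1 x).
have ch2 : continuous h2 by move=> x; exact: derive_continuous (d2 x).
have cm : continuous m.
  by move=> x; apply: (@continuous_comp _ _ _ h0 (fun y => Num.max y 0) x (ch0 x)); exact: maxr0_continuous.
have cX (f : R -> R) n : continuous f -> continuous (fun x => f x ^+ n).
  by move=> cf x; apply: (@continuous_comp _ _ _ f (fun y => y ^+ n) x (cf x)); exact: exprn_continuous.
have cZ (c : R) (f : R -> R) : continuous f -> continuous (fun x => c * f x).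
  by move=> cf; apply: continuous_mul => // x; exact: cst_continuous.
have cD (f g : R -> R) : continuous f -> continuous g -> continuous (fun x => f x + g x).
  by move=> cf cg x; exact: continuousD (cf x) (cg x).
apply: (cD); first apply: (cD).
- by apply: cZ; apply: continuous_mul => //; exact: cX.
- by apply: cZ; apply: continuous_mul; [exact: cX|exact: continuous_mul].
- by apply: cZ; apply: continuous_mul; [exact: cX|].
Qed.

Lemma chain3_1B (f0 f1 f2 f3 : R -> R) : chain3 f0 f1 f2 f3 ->
  chain3 (fun x => 1 - f0 x) (fun x => 0 - f1 x) (fun x => 0 - f2 x) (fun x => 0 - f3 x).
Proof.
move=> [d0 d1 d2 c3]; split=> [x|x|x|x].
- exact: (is_derive_sub (is_derive_const 1 x) (d0 x)).
- exact: (is_derive_sub (is_derive_const 0 x) (d1 x)).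
- exact: (is_derive_sub (is_derive_const 0 x) (d2 x)).
- by apply: continuousB; [exact: cst_continuous|exact: c3].
Qed.

Lemma continuous_support_bounded (f : R -> R) (L : R) : continuous f ->
  (forall x, L <= `|x| -> f x = 0) -> exists2 M, 0 <= M & forall x, `|f x| <= M.
Proof.
move=> cf f0.
have [L0|L0] := leP L 0.
  by exists 0 => // x; rewrite f0 ?normr0// (le_trans L0).
have ca : continuous (fun x => `|f x|).
  by move=> x; apply: (@continuous_comp _ _ _ f (fun y => `|y|) x (cf x)); exact: norm_continuous.
have [c _ cM] := @EVT_max R (fun x => `|f x|) (- L) L (ltac:(lra)) (continuous_subspaceT ca).
exists `|f c| => // x.
have [xL|xL] := leP L `|x|; first by rewrite f0// normr0.
by apply: cM; move: xL; rewrite ltr_norml in_itv/= => /andP[? ?]; rewrite !ltW.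
Qed.

Lemma exists_profile (h0 h1 h2 h3 : R -> R) (L : R) : chain3 h0 h1 h2 h3 -> 0 < L ->
  (forall x, L <= `|x| -> h0 x <= 0) ->
  exists P : profile R, pfL P = L /\ forall x, pf0 P x = Num.max (h0 x) 0 ^+ 4.
Proof.
move=> /chain3_maxr_pow4/= ch L0 hL.
have m0 x : L <= `|x| -> Num.max (h0 x) 0 = 0 by move=> /hL h; apply/max_idPr.
move: ch; set f0 := fun x => _ ^+ 4; set f1 := fun x => 4 * _.
set f2 := (X in chain3 _ _ X _); set f3 := (X in chain3 _ _ _ X) => -[d0 d1 d2 c3].
have cf0 : continuous f0 by move=> x; exact: derive_continuous (d0 x).
have z0 x : L <= `|x| -> f0 x = 0 by move=> /m0 h; rewrite /f0 h; ring.
have z1 x : L <= `|x| -> f1 x = 0 by move=> /m0 h; rewrite /f1 h; ring.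
have z2 x : L <= `|x| -> f2 x = 0 by move=> /m0 h; rewrite /f2 h; ring.
have z3 x : L <= `|x| -> f3 x = 0 by move=> /m0 h; rewrite /f3 h; ring.
have [M M0 hM] := continuous_support_bounded cf0 z0.
have [M' M'0 hM'] := continuous_support_bounded c3 z3.
have out x : L <= `|x| -> [/\ f0 x = 0, f1 x = 0 & f2 x = 0].
  by move=> h; split; [exact: z0|exact: z1|exact: z2].
have b0 x : `|f0 x| <= M + M' by rewrite (le_trans (hM x))// lerDl.
have b3 x : `|f3 x| <= M + M' by rewrite (le_trans (hM' x))// lerDr.
by exists (Profile d0 d1 d2 c3 L0 out b0 b3).
Qed.

Lemma exists_peak : exists P : profile R,
  [/\ pfL P = 1, pf0 P 0 = 1 & forall x, 0 <= pf0 P x <= 1].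
Proof.
have ch : chain3 (fun x : R => 1 - x ^+ 2) (fun x => - 2 * x) (fun=> - 2) (fun=> 0).
  split=> [x|x|x|].
  - apply: is_derive_eq1 (is_derive_sub (is_derive_const 1 x) (is_derive_pow 2 (is_derive_id x 1))) _.
    by rewrite /=; ring.
  - by apply: is_derive_eq1 (is_derive_cmul (- 2) (is_derive_id x 1)) _; rewrite mulr1.
  - exact: is_derive_const.
  - by move=> x; exact: cst_continuous.
have [|P [PL Pm]] := exists_profile ch ltr01.
  by move=> x x1; rewrite subr_le0 -[leRHS]real_normK ?num_real// exprn_ege1.
exists P; split => //; first by rewrite Pm expr0n subr0 max_l// expr1n.
move=> x; rewrite Pm exprn_ge0 ?le_max ?lexx ?orbT//=.
rewrite exprn_ile1// ?le_max ?lexx ?orbT// ge_max ler01 andbT.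
by have := sqr_ge0 x; lra.
Qed.

(** As [22 ^ 2 - 400 = 84], the inner function is 0 for [|x| <= 20] and at least 1 for [|x| >= 22];
    the positive part construction is then applied once more, to 1 minus it. In units of the width,
    the margin from 18 to 20 pays for mollification and translation. *)
Lemma exists_plateau : exists P : profile R,
  [/\ pfL P = 22, forall x, `|x| <= 20 -> pf0 P x = 1 & forall x, 0 <= pf0 P x <= 1].
Proof.
have ch : chain3 (fun x : R => (x ^+ 2 - 400) * 84^-1) (fun x => x / 42) (fun=> 42^-1) (fun=> 0).
  split=> [x|x|x|].
  - apply: is_derive_eq1 (is_derive_mul
      (is_derive_sub (is_derive_pow 2 (is_derive_id x 1)) (is_derive_const 400 x)) (is_derive_const 84^-1 x)) _.
    by rewrite /=; field.
  - by apply: is_derive_eq1 (is_derive_mul (is_derive_id x 1) (is_derive_const 42^-1 x)) _; ring.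
  - exact: is_derive_const.
  - by move=> x; exact: cst_continuous.
have ch2 := chain3_1B (chain3_maxr_pow4 ch).
set k := fun x : R => Num.max ((x ^+ 2 - 400) * 84^-1) 0 ^+ 4.
have k_ge0 x : 0 <= k x by apply: exprn_ge0; rewrite le_max lexx orbT.
have [|P [PL Pm]] := exists_profile ch2 (ltac:(lra) : 0 < 22 :> R).
  move=> x x1; rewrite subr_le0 exprn_ege1// le_max; apply/orP; left.
  have : 22 ^+ 2 <= x ^+ 2 by rewrite -[leRHS]real_normK ?num_real// ler_pXn2r ?nnegrE//.
  by lra.
have {}Pm x : pf0 P x = Num.max (1 - k x) 0 ^+ 4 by exact: Pm.
exists P; split => // x.
  move=> x20; rewrite Pm.
  have -> : k x = 0.
    suff e : Num.max ((x ^+ 2 - 400) * 84^-1) 0 = 0 by rewrite /k e expr0n.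
    apply/max_idPr.
    have : x ^+ 2 <= 20 ^+ 2 by rewrite -[leLHS]real_normK ?num_real// ler_pXn2r ?nnegrE//.
    lra.
  by rewrite subr0 max_l// expr1n.
rewrite Pm exprn_ge0 ?le_max ?lexx ?orbT//=.
rewrite exprn_ile1// ?le_max ?lexx ?orbT// ge_max ler01 andbT.
by have := k_ge0 x; lra.
Qed.

End Profiles.

Section Packet.
Variable R : realType.
Local Notation mu := (@lebesgue_measure R).
Local Notation mplane := (measurableTypeR R * measurableTypeR R)%type.

Lemma integral_segment_support (f : R -> R) (l r : R) : (forall x, ~ `[l, r]%classic x -> f x = 0) ->
  (\int[mu]_(x in `[l, r]) (f x)%:E = \int[mu]_x (f x)%:E)%E.
Proof.
move=> f0; rewrite integral_mkcond; apply: eq_integral => x _; rewrite patchE.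
by case: ifPn => // /negP xn; rewrite f0// => h; apply: xn; rewrite inE.
Qed.

Lemma int2_tensor (F G : R -> R) (l1 r1 l2 r2 : R) : continuous F -> continuous G ->
  (forall x, ~ `[l1, r1]%classic x -> F x = 0) -> (forall x, ~ `[l2, r2]%classic x -> G x = 0) ->
  (leb2 R).-integrable setT (fun y => (F y.1 * G y.2)%:E) /\
  int2 (fun y => F y.1 * G y.2) = \int[mu]_(x in `[l1, r1]) F x * \int[mu]_(x in `[l2, r2]) G x.
Proof.
move=> cF cG F0 G0.
have iT (f : R -> R) (l r : R) : continuous f -> (forall x, ~ `[l, r]%classic x -> f x = 0) ->
    mu.-integrable setT (EFin \o f).
  move=> cf f0; have := integrable_segment (fun y (_ : l <= y <= r) => cf y).
  rewrite integrable_mkcond//; congr (integrable _ _ _); apply/funext => x.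
  by rewrite patchE; case: ifPn => //= /negP xn; rewrite f0// => h; apply: xn; rewrite inE.
have iF := iT _ _ _ cF F0; have iG := iT _ _ _ cG G0.
have mFG : measurable_fun (setT : set mplane) (fun y => (F y.1 * G y.2)%:E).
  apply/measurable_EFinP; apply: measurable_funM.
    exact: (measurableT_comp (continuous_measurable_fun cF) measurable_fst).
  exact: (measurableT_comp (continuous_measurable_fun cG) measurable_snd).
have finT (f : R -> R) : mu.-integrable setT (EFin \o f) -> (\int[mu]_x `|f x|%:E < +oo)%E.
  by case/integrableP.
have mabs (f : R -> R) : continuous f -> measurable_fun setT (fun x => `|f x|%:E).
  by move=> cf; apply/measurable_EFinP; apply: measurableT_comp => //; exact: continuous_measurable_fun.
have i2 : (leb2 R).-integrable setT (fun y => (F y.1 * G y.2)%:E).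
  apply/integrable12ltyP => //=.
  under eq_integral => x _.
    under eq_integral do rewrite normrM EFinM.
    rewrite ge0_integralZl//; last exact: mabs.
    over.
  rewrite ge0_integralZr//; [|exact: mabs|by apply: integral_ge0].
  by apply: lte_mul_pinfty; rewrite ?integral_ge0 ?ge0_fin_numE ?integral_ge0 ?finT.
split=> //.
rewrite /int2 /Rintegral !integral_segment_support//.
rewrite -fineM; [|exact: (integrable_fin_num _ iF)|exact: (integrable_fin_num _ iG)].
congr fine; rewrite -(integral12_prod_meas1 i2) /fubini_F /=.
under eq_integral => x _ do rewrite (integralZl _ iG)//.
have fG := integrable_fin_num measurableT iG.
by rewrite -(fineK fG) integralZr.
Qed.

Variables (Pa Pb : profile R) (A delta p q : R).
Hypotheses (delta0 : 0 < delta) (q0 : 0 < q).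

Definition packet (y : plane R) := A * (scaled Pa delta 0 y.1 * scaled Pb q p y.2).

Lemma continuous_packet : continuous packet.
Proof.
move=> y.
have c1 : {for y, continuous (fun y : plane R => scaled Pa delta 0 y.1)}.
  by apply: (@continuous_comp _ _ _ fst (scaled Pa delta 0)); [exact: cvg_fst|exact: continuous_scaled].
have c2 : {for y, continuous (fun y : plane R => scaled Pb q p y.2)}.
  by apply: (@continuous_comp _ _ _ snd (scaled Pb q p)); [exact: cvg_snd|exact: continuous_scaled].
exact: (continuousM (@cst_continuous _ _ A y) (continuousM c1 c2)).
Qed.

Let tensor (s t : R -> R) (l m : R) : continuous s -> continuous t ->
  (leb2 R).-integrable setT (fun y => (scaled Pa delta 0 y.1 * s (l * y.1) *
      (scaled Pb q p y.2 * t (m * y.2)))%:E) /\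
  int2 (fun y => scaled Pa delta 0 y.1 * s (l * y.1) * (scaled Pb q p y.2 * t (m * y.2))) =
  \int[mu]_(x in `[0 - pfL Pa * delta, 0 + pfL Pa * delta]) (scaled Pa delta 0 x * s (l * x)) *
  \int[mu]_(x in `[p - pfL Pb * q, p + pfL Pb * q]) (scaled Pb q p x * t (m * x)).
Proof.
move=> cs ct.
have cl (f : R -> R) (c : R) : continuous f -> continuous (fun x => f (c * x)).
  move=> cf x; apply: (@continuous_comp _ _ _ (fun x => c * x) f); last exact: cf.
  by apply: continuousM; [exact: cst_continuous|exact: cvg_id].
apply: (@int2_tensor (fun x => scaled Pa delta 0 x * s (l * x)) (fun x => scaled Pb q p x * t (m * x))).
- by apply: continuous_mul; [exact: continuous_scaled|exact: cl].
- by apply: continuous_mul; [exact: continuous_scaled|exact: cl].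
- by move=> x h; rewrite scaled_out// mul0r.
- by move=> x h; rewrite scaled_out// mul0r.
Qed.

(** By the addition formulas the squared modulus factors as [A^2 (Ca^2 + Sa^2) (Cb^2 + Sb^2)]. The
    centre [p] affects phases only, so the bound is free of it. *)
Lemma packet_fourier_le xi :
  complex.Re (fourier_integral packet xi) ^+ 2 + complex.Im (fourier_integral packet xi) ^+ 2 <=
  (16 * osc_const Pa * osc_const Pb) * (A * delta * q) ^+ 2 /
  ((1 + (delta * xi.1) ^+ 2) ^+ 3 * (1 + (q * xi.2) ^+ 2) ^+ 3).
Proof.
set Ca := osc_cos Pa delta 0 xi.1; set Sa := osc_sin Pa delta 0 xi.1.
set Cb := osc_cos Pb q p xi.2; set Sb := osc_sin Pb q p xi.2.
have cc := @continuous_cos R; have ss := @continuous_sin R.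
have [iCC CC] := tensor (2 * pi * xi.1) (2 * pi * xi.2) cc cc.
have [iSS SS] := tensor (2 * pi * xi.1) (2 * pi * xi.2) ss ss.
have [iSC SC] := tensor (2 * pi * xi.1) (2 * pi * xi.2) ss cc.
have [iCS CS] := tensor (2 * pi * xi.1) (2 * pi * xi.2) cc ss.
have split_dot y : 2 * pi * dot2 y xi = 2 * pi * xi.1 * y.1 + 2 * pi * xi.2 * y.2.
  by rewrite /dot2; ring.
have -> : complex.Re (fourier_integral packet xi) = A * (Ca * Cb - Sa * Sb).
  rewrite Re_fourier_integral /Ca /Cb /Sa /Sb /osc_cos /osc_sin -CC -SS -RintegralB//.
  rewrite -RintegralZl//; last exact: (integrableB _ iCC iSS).
  by congr int2; apply/funext => y; rewrite split_dot cosD /packet; ring.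
have -> : complex.Im (fourier_integral packet xi) = - A * (Sa * Cb + Ca * Sb).
  rewrite Im_fourier_integral /Ca /Cb /Sa /Sb /osc_cos /osc_sin -SC -CS -RintegralD//.
  rewrite -RintegralZl//; last exact: (integrableD _ iSC iCS).
  by congr int2; apply/funext => y; rewrite split_dot sinD /packet; ring.
have -> : (A * (Ca * Cb - Sa * Sb)) ^+ 2 + (- A * (Sa * Cb + Ca * Sb)) ^+ 2 =
   A ^+ 2 * ((Ca ^+ 2 + Sa ^+ 2) * (Cb ^+ 2 + Sb ^+ 2)) by ring.
have hCa := osc_cos_le Pa 0 delta0 xi.1; have hSa := osc_sin_le Pa 0 delta0 xi.1.
have hCb := osc_cos_le Pb p q0 xi.2; have hSb := osc_sin_le Pb p q0 xi.2.
rewrite -/Ca -/Sa -/Cb -/Sb in hCa hSa hCb hSb.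
have -> : 16 * osc_const Pa * osc_const Pb * (A * delta * q) ^+ 2 /
    ((1 + (delta * xi.1) ^+ 2) ^+ 3 * (1 + (q * xi.2) ^+ 2) ^+ 3) =
  A ^+ 2 * ((osc_const Pa * 2 * delta ^+ 2 / (1 + (delta * xi.1) ^+ 2) ^+ 3 * 2) *
  (osc_const Pb * 2 * q ^+ 2 / (1 + (q * xi.2) ^+ 2) ^+ 3 * 2)).
  by rewrite invfM; ring.
rewrite ler_wpM2l ?sqr_ge0// ler_pM ?addr_ge0 ?sqr_ge0//; lra.
Qed.

End Packet.

Lemma measurable_fourier (R : realType) (g : plane R -> R) :
  measurable_fun (setT : set (measurableTypeR R * measurableTypeR R)) g ->
  (leb2 R).-integrable setT (EFin \o g) ->
  measurable_fun (setT : set (measurableTypeR R * measurableTypeR R))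
    (fun xi => complex.Re (fourier_integral g xi)) /\
  measurable_fun (setT : set (measurableTypeR R * measurableTypeR R))
    (fun xi => complex.Im (fourier_integral g xi)).
Proof.
move=> mg ig; have [_ l1 l2 _] := is_fourier_integrable mg ig.
by split; exact: loc_integrable_measurable.
Qed.

Lemma integrable_packet (R : realType) (Pa Pb : profile R) (A delta p q : R) : 0 < delta -> 0 < q ->
  (leb2 R).-integrable setT (EFin \o packet Pa Pb A delta p q).
Proof.
move=> d0 q0.
have [i _] := @int2_tensor R (scaled Pa delta 0) (scaled Pb q p) _ _ _ _ (@continuous_scaled R Pa delta 0)
  (@continuous_scaled R Pb q p) (@scaled_out _ Pa _ _ d0) (@scaled_out _ Pb _ _ q0).
have -> : EFin \o packet Pa Pb A delta p q =
    fun y => (A%:E * (scaled Pa delta 0 y.1 * scaled Pb q p y.2)%:E)%E by [].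
exact: integrableZl.
Qed.

(** * Norm of a packet in the logarithmic space *)

Section PacketNorm.
Variables (R : realType) (beta : R).
Hypothesis hbeta : 1 / 2 < beta.
Local Notation mu := (@lebesgue_measure R).
Local Notation mplane := (measurableTypeR R * measurableTypeR R)%type.
Local Notation w := (hdot_log_weight (7 / 4) beta).

Lemma enorm_ge0 (x : plane R) : 0 <= enorm x.
Proof. exact: sqrtr_ge0. Qed.

Lemma measurable_enorm : measurable_fun (setT : set mplane) (@enorm R).
Proof.
apply: continuous_measurable_plane => x.
have c1 : {for x, continuous (fun x : plane R => x.1)} by exact: cvg_fst.
have c2 : {for x, continuous (fun x : plane R => x.2)} by exact: cvg_snd.
have c : {for x, continuous (fun x : plane R => dot2 x x)}.
  exact: (continuousD (continuousM c1 c1) (continuousM c2 c2)).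
by apply: (@continuous_comp _ _ _ (fun x : plane R => dot2 x x) Num.sqrt x c); exact: sqrt_continuous.
Qed.

Lemma measurable_hdot_log_weight s b : measurable_fun (setT : set mplane) (@hdot_log_weight R s b).
Proof.
rewrite /hdot_log_weight; under eq_fun do rewrite -powRN.
have me := measurable_enorm.
apply: measurable_funM; first exact: (measurableT_comp (measurable_powR _) me).
apply: (measurableT_comp (measurable_powR _)).
apply: measurable_funD => //; apply: measurableT_comp => //.
exact: (measurableT_comp (@measurable_ln R) me).
Qed.

Lemma hdot_log_weight_ge0 s b x : 0 <= @hdot_log_weight R s b x.
Proof. by rewrite divr_ge0// powR_ge0. Qed.

(** [hbeta] makes the exponent [2 * beta] exceed 1 and the base is at least 1, so one power of the
    logarithm remains; this suffices for the limit. *)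
Let w_le x : w x <= enorm x `^ (7 / 2) / (1 + `|ln (enorm x)|).
Proof.
rewrite /hdot_log_weight; have -> : 2 * (7 / 4) = 7 / 2 :> R by field.
rewrite ler_wpM2l ?powR_ge0// lef_pV2 ?posrE ?powR_gt0 ?ltr_wpDr//.
have l1 : 1 <= 1 + `|ln (enorm x)| by rewrite lerDl.
rewrite -{1}[1 + _]powRr1 ?(le_trans ler01)//.
by apply: ler_powR => //; move: hbeta; lra.
Qed.

Let Q (z : plane R) := (1 + z.1 ^+ 2) * (1 + z.2 ^+ 2).

Let Q_ge1 z : 1 <= Q z.
Proof.
rewrite /Q; have := sqr_ge0 z.1; have := sqr_ge0 z.2.
move: (z.1 ^+ 2) (z.2 ^+ 2) => a b a0 b0; have := mulr_ge0 a0 b0; lra.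
Qed.

Let enorm_sqrt_Q z : enorm z <= Num.sqrt (Q z).
Proof.
rewrite ler_sqrt ?(le_trans ler01)// /dot2 /Q.
have := mulr_ge0 (sqr_ge0 z.1) (sqr_ge0 z.2); move: (sqr_ge0 z.1); rewrite !expr2; lra.
Qed.

(** The bound for the integrand of a packet norm after the substitution [xi = (z1 / q^2, z2 / q)],
    up to a constant. The factor [q ^+ 7] cancels the growth [(1 / q^2) ^ (7 / 2)] of the weight;
    the summands 0 match [ge0_integral_affine2]. *)
Definition dilated (q : R) (z : plane R) :=
  q ^+ 7 * w ((q ^+ 2)^-1 * z.1 + 0, q^-1 * z.2 + 0) / ((1 + z.1 ^+ 2) ^+ 3 * (1 + z.2 ^+ 2) ^+ 3).

Lemma dilated_ge0 q z : 0 < q -> 0 <= dilated q z.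
Proof.
move=> q0; apply: divr_ge0; apply: mulr_ge0; rewrite ?hdot_log_weight_ge0//.
all: by rewrite exprn_ge0 ?(ltW q0)// addr_ge0 ?sqr_ge0.
Qed.

Let dil_upper q (z : plane R) : 0 < q -> q <= 1 ->
  enorm ((q ^+ 2)^-1 * z.1 + 0, q^-1 * z.2 + 0) <= q^-1 ^+ 2 * enorm z.
Proof.
move=> q0 q1; have i1 : 1 <= q^-1 by rewrite invf_ge1.
have i0 : 0 <= q^-1 by rewrite (le_trans ler01).
rewrite -[q^-1 ^+ 2]ger0_norm ?exprn_ge0// -sqrtr_sqr -sqrtrM ?sqr_ge0// ler_sqrt; last first.
  by rewrite mulr_ge0 ?sqr_ge0// addr_ge0// -expr2 sqr_ge0.
rewrite /dot2 /= !addr0 -exprVn.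
have -> : (q^-1 ^+ 2) ^+ 2 * (z.1 * z.1 + z.2 * z.2) =
  q^-1 ^+ 2 * z.1 * (q^-1 ^+ 2 * z.1) + q^-1 ^+ 2 * (q^-1 ^+ 2 * z.2 ^+ 2) by ring.
rewrite lerD2l; have -> : q^-1 * z.2 * (q^-1 * z.2) = 1 * (q^-1 ^+ 2 * z.2 ^+ 2) by ring.
apply: ler_wpM2r; first by apply: mulr_ge0; exact: sqr_ge0.
by apply: exprn_ege1.
Qed.

Let dil_lower q (z : plane R) : 0 < q -> q <= 1 ->
  q^-1 * enorm z <= enorm ((q ^+ 2)^-1 * z.1 + 0, q^-1 * z.2 + 0).
Proof.
move=> q0 q1; have i1 : 1 <= q^-1 by rewrite invf_ge1.
have i0 : 0 <= q^-1 by rewrite (le_trans ler01).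
rewrite -[q^-1]ger0_norm// -sqrtr_sqr -sqrtrM ?sqr_ge0// sqrtr_sqr ger0_norm// ler_sqrt; last first.
  by rewrite addr_ge0// -expr2 sqr_ge0.
rewrite /dot2 /= !addr0 -exprVn.
have -> : q^-1 ^+ 2 * (z.1 * z.1 + z.2 * z.2) =
  1 * (q^-1 ^+ 2 * z.1 ^+ 2) + q^-1 * z.2 * (q^-1 * z.2) by ring.
rewrite lerD2r; have -> : q^-1 ^+ 2 * z.1 * (q^-1 ^+ 2 * z.1) = q^-1 ^+ 2 * (q^-1 ^+ 2 * z.1 ^+ 2) by ring.
apply: ler_wpM2r; first by apply: mulr_ge0; exact: sqr_ge0.
by apply: exprn_ege1.
Qed.

(** By [dil_upper] the power of the frequency is bounded, uniformly in [q], by [Q ^+ 2]; against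
    [Q ^+ 3] this leaves the inverse of [Q], which is integrable. The logarithm is kept for the
    limit. *)
Let dilated_le q z : 0 < q -> q <= 1 ->
  dilated q z <= (Q z)^-1 / (1 + `|ln (enorm ((q ^+ 2)^-1 * z.1 + 0, q^-1 * z.2 + 0))|).
Proof.
move=> q0 q1; set x := (_, _).
have q3 : ((1 + z.1 ^+ 2) ^+ 3 * (1 + z.2 ^+ 2) ^+ 3) = Q z ^+ 3 by rewrite exprMn.
have Q0 : 0 < Q z := lt_le_trans ltr01 (Q_ge1 z).
have n0 := enorm_ge0 z.
have l1 : 0 < 1 + `|ln (enorm x)| by rewrite ltr_wpDr.
have e1 : q ^+ 7 * enorm x `^ (7 / 2) <= Q z ^+ 2.
  have h1 : enorm x `^ (7 / 2) <= (q^-1 ^+ 2 * enorm z) `^ (7 / 2).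
    by apply: ge0_ler_powR; rewrite ?nnegrE ?enorm_ge0 ?mulr_ge0 ?exprn_ge0 ?invr_ge0 ?(ltW q0)// dil_upper.
  have h2 : (q^-1 ^+ 2 * enorm z) `^ (7 / 2) = q^-1 ^+ 7 * enorm z `^ (7 / 2).
    rewrite powRM ?exprn_ge0 ?invr_ge0 ?(ltW q0)//; congr (_ * _).
    have i0 : 0 <= q^-1 by rewrite invr_ge0 ltW.
    have -> : q^-1 ^+ 7 = q^-1 `^ (2%:R * (7 / 2)).
      have -> : 2%:R * (7 / 2) = 7%:R :> R by field.
      by rewrite powR_mulrn.
    by rewrite [RHS]powRrM (powR_mulrn 2 i0).
  have h3 : enorm z `^ (7 / 2) <= Q z ^+ 2.
    apply: (@le_trans _ _ (Num.sqrt (Q z) `^ (7 / 2))).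
      by apply: ge0_ler_powR; rewrite ?nnegrE ?sqrtr_ge0.
    apply: (@le_trans _ _ (Num.sqrt (Q z) `^ 4%:R)).
      by apply: ler_powR; [rewrite -sqrtr1 ler_sqrt// (le_trans ler01)|lra].
    by rewrite powR_mulrn ?sqrtr_ge0// (exprM _ 2 2) sqr_sqrtr// ltW.
  rewrite h2 in h1; apply: le_trans (ler_wpM2l _ h1) _; first by rewrite exprn_ge0// ltW.
  by rewrite mulrA -exprMn divff ?gt_eqF// expr1n mul1r.
rewrite /dilated -/x q3.
apply: (@le_trans _ _ (q ^+ 7 * (enorm x `^ (7 / 2) / (1 + `|ln (enorm x)|)) / Q z ^+ 3)).
  by rewrite ler_wpM2r ?invr_ge0 ?exprn_ge0 ?(ltW Q0)// ler_wpM2l ?w_le// exprn_ge0// ltW.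
rewrite mulrA mulrAC ler_wpM2r ?invr_ge0 ?(ltW l1)//.
rewrite ler_pdivrMr ?exprn_gt0//.
have -> : (Q z)^-1 * Q z ^+ 3 = Q z ^+ 2 by field; rewrite gt_eqF.
exact: e1.
Qed.

Let qn (n : nat) : R := n.+1%:R^-1.
Let qn0 n : 0 < qn n. Proof. by rewrite invr_gt0 ltr0n. Qed.
Let qn1 n : qn n <= 1. Proof. by rewrite invf_le1 ?ltr0n// ler1n. Qed.

Let measurable_dilated q : measurable_fun (setT : set mplane) (dilated q).
Proof.
have c1 (x : plane R) : {for x, continuous (fun x : plane R => x.1)} by exact: cvg_fst.
have c2 (x : plane R) : {for x, continuous (fun x : plane R => x.2)} by exact: cvg_snd.
have m1 : measurable_fun (setT : set mplane) (fun x => x.1 : R) by exact: measurable_fst.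
have m2 : measurable_fun (setT : set mplane) (fun x => x.2 : R) by exact: measurable_snd.
apply: measurable_funM.
  apply: measurable_funM => //.
  apply: (measurableT_comp (@measurable_hdot_log_weight _ _)).
  by apply: measurable_fun_pair; apply: measurable_funD => //; apply: measurable_funM.
apply: continuous_measurable_plane => x.
have cs (f : plane R -> R) : {for x, continuous f} -> {for x, continuous (fun x => (1 + f x ^+ 2) ^+ 3)}.
  move=> cf.
  apply: (@continuous_comp _ _ _ f (fun y => (1 + y ^+ 2) ^+ 3)) => //.
  apply: (@continuous_comp _ _ _ (fun y : R => 1 + y ^+ 2) (fun y => y ^+ 3)); last exact: exprn_continuous.
  by apply: continuousD; [exact: cst_continuous|exact: exprn_continuous].
apply: (@continuousV _ _ (fun x : plane R => (1 + x.1 ^+ 2) ^+ 3 * (1 + x.2 ^+ 2) ^+ 3)).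
  by rewrite mulf_neq0// expf_neq0// gt_eqF// ltr_wpDr ?sqr_ge0.
exact: (continuousM (cs _ (c1 x)) (cs _ (c2 x))).
Qed.

Let integrable_invQ : (leb2 R).-integrable setT (fun z => (Q z)^-1%:E).
Proof.
have m1 : measurable_fun (setT : set (measurableTypeR R)) (fun x : R => (1 + x ^+ 2)^-1%:E).
  apply/measurable_EFinP; apply: continuous_measurable_fun; exact: continuous_oneDsqrV.
have p0 (x : R) : (0 <= (1 + x ^+ 2)^-1%:E)%E by rewrite lee_fin invr_ge0 addr_ge0 ?sqr_ge0.
have fin : (\int[mu]_x (1 + x ^+ 2)^-1%:E = pi%:E)%E.
  rewrite (@ge0_symfun_integralT R (fun x => (1 + x ^+ 2)^-1)).
  - have -> : [set x : R | 0 <= x] = `[0, +oo[%classic.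
      by apply/seteqP; split=> x /=; rewrite in_itv/= andbT.
    by rewrite (integral0y_oneDsqr R) -EFinM; congr (_%:E); field.
  - by move=> x; rewrite -lee_fin.
  - exact: continuous_oneDsqrV.
  - by move=> x /=; rewrite sqrrN.
have mQ : measurable_fun (setT : set mplane) (fun z => (Q z)^-1%:E).
  rewrite /Q; under eq_fun do rewrite invfM EFinM.
  apply: emeasurable_funM.
    exact: (measurableT_comp m1 measurable_fst).
  exact: (measurableT_comp m1 measurable_snd).
apply/integrableP; split=> //.
under eq_integral do rewrite gee0_abs ?lee_fin ?invr_ge0 ?(le_trans ler01)//.
rewrite /leb2 fubini_tonelli1//; last first.
  by move=> x; rewrite lee_fin invr_ge0 (le_trans ler01).
rewrite /fubini_F /Q /=.
under eq_integral => x _.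
  under eq_integral do rewrite invfM EFinM.
  rewrite ge0_integralZl// fin.
  over.
by rewrite ge0_integralZr ?lee_fin ?pi_ge0// fin -EFinM ltry.
Qed.

(** Away from the origin the frequency has norm at least [enorm z / q] by [dil_lower], so its
    logarithm tends to infinity; at the origin the weight vanishes. *)
Let dilated_cvg z : (dilated (qn n) z)%:E @[n --> \oo] --> 0%E.
Proof.
apply: cvg_EFin; first by near=> n.
have [z0|zN0] := eqVneq (enorm z) 0.
  apply/cvgrPdist_le => e e0; near=> n.
  have h := dil_upper z (qn0 n) (qn1 n).
  rewrite /= /dilated /hdot_log_weight.
  have -> : enorm ((qn n ^+ 2)^-1 * z.1 + 0, (qn n)^-1 * z.2 + 0) = 0.
    by apply/eqP; rewrite eq_le enorm_ge0 andbT (le_trans h)// z0 mulr0.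
  rewrite powR0; last by rewrite gt_eqF//; lra.
  by rewrite mul0r mulr0 mul0r subr0 normr0 ltW.
have z0 : 0 < enorm z by rewrite lt_def zN0 enorm_ge0.
apply/cvgrPdist_le => e e0; near=> n.
rewrite sub0r normrN ger0_norm; last by rewrite dilated_ge0.
apply: le_trans (dilated_le z (qn0 n) (qn1 n)) _.
set x := enorm _.
have hx : expR e^-1 <= x.
  apply: le_trans (dil_lower z (qn0 n) (qn1 n)).
  rewrite invrK -ler_pdivrMr//.
  apply: (@le_trans _ _ n%:R); last by rewrite ler_nat.
  by near: n; exact: nbhs_infty_ger.
have hl : e^-1 <= ln x.
  rewrite -[e^-1]expRK ler_ln ?posrE ?expR_gt0//.
  exact: lt_le_trans (expR_gt0 _) hx.
rewrite ler_pdivrMr ?ltr_wpDr//.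
have Q1 : (Q z)^-1 <= 1 by rewrite invf_le1// (lt_le_trans ltr01).
apply: le_trans Q1 _.
apply: (@le_trans _ _ (e * e^-1)); first by rewrite divff ?gt_eqF.
rewrite ler_wpM2l ?(ltW e0)//; apply: (le_trans hl); apply: (le_trans (ler_norm _)).
by rewrite lerDr.
Unshelve. all: end_near. Qed.

Lemma dilated_integral_cvg :
  (\int[leb2 R]_z (dilated n.+1%:R^-1 z)%:E)%E @[n --> \oo] --> 0%E.
Proof.
have h := @dominated_cvg _ mplane R (leb2 R) setT measurableT (fun n z => (dilated (qn n) z)%:E)
  (cst 0%E) (fun z => (Q z)^-1%:E).
rewrite integral0 in h; apply: h => //.
- by move=> n; apply/measurable_EFinP; exact: measurable_dilated.
- by move=> z _; exact: dilated_cvg.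
- move=> n z _; rewrite gee0_abs ?lee_fin ?dilated_ge0//.
  apply: le_trans (dilated_le z (qn0 n) (qn1 n)) _.
  rewrite ler_piMr ?invr_ge0 ?(le_trans ler01)// invf_le1 ?ltr_wpDr// lerDl//.
Qed.

(** The powers of [q] balance: the square of height times both widths is [4 q^10 / tau^2], of which
    [q ^+ 7] enters [dilated] and [q ^+ 3] cancels against the Jacobian. What remains is the
    constant [C] times an integral that tends to 0, uniformly in [p]. *)
Lemma packet_norm_cvg (Pa Pb : profile R) (tau e : R) : 0 < tau -> 0 < e ->
  \forall n \near \oo, forall p, let q := n.+1%:R^-1 in
    let g := packet Pa Pb (2 * q ^+ 2 / tau) (q ^+ 2) p q in
    (\int[leb2 R]_xi (w xi * (complex.Re (fourier_integral g xi) ^+ 2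
      + complex.Im (fourier_integral g xi) ^+ 2))%:E <= e%:E)%E.
Proof.
move=> tau0 e0.
pose C := 64 * osc_const Pa * osc_const Pb / tau ^+ 2.
have oc0 (P : profile R) : 0 <= osc_const P.
  apply: mulr_ge0; last exact: sqr_ge0.
  by apply: mulr_ge0 => //; exact: sqr_ge0.
have oo0 c : 0 <= c -> 0 <= c * osc_const Pa * osc_const Pb.
  by move=> c0; apply: mulr_ge0 => //; exact: mulr_ge0.
have C0 : 0 <= C by apply: divr_ge0; [exact: oo0|exact: sqr_ge0].
have C1 : 0 < C + 1 by rewrite ltr_wpDl.
have small : \forall n \near \oo, (\int[leb2 R]_z (dilated n.+1%:R^-1 z)%:E <= (e / (C + 1))%:E)%E.
  have := dilated_integral_cvg => /fine_cvgP[fin /cvgrPdist_le/(_ (e / (C + 1)))].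
  rewrite divr_gt0// => /(_ isT) cv.
  apply: filterS2 fin cv => n fn h.
  rewrite -(fineK fn) lee_fin; apply: le_trans (ler_norm _) _.
  by rewrite sub0r normrN in h.
apply: filterS small => n hn p; set q : R := n.+1%:R^-1; set g := packet _ _ _ _ _ _.
rewrite -/q in hn.
have q0 : 0 < q by rewrite /q invr_gt0 ltr0n.
pose G (xi : plane R) := w xi * ((16 * osc_const Pa * osc_const Pb) * (2 * q ^+ 2 / tau * q ^+ 2 * q) ^+ 2 /
  ((1 + (q ^+ 2 * xi.1) ^+ 2) ^+ 3 * (1 + (q * xi.2) ^+ 2) ^+ 3)).
have G0 xi : 0 <= G xi.
  rewrite mulr_ge0 ?hdot_log_weight_ge0// divr_ge0//.
    by apply: mulr_ge0; [exact: oo0|exact: sqr_ge0].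
  by apply: mulr_ge0; apply: exprn_ge0; rewrite addr_ge0 ?sqr_ge0.
have Gdil z : G ((q ^+ 2)^-1 * z.1 + 0, q^-1 * z.2 + 0) = C * q ^+ 3 * dilated q z.
  have a1 : q ^+ 2 * ((q ^+ 2)^-1 * z.1 + 0) = z.1 by rewrite addr0 mulrA divff ?mul1r// gt_eqF// exprn_gt0.
  have a2 : q * (q^-1 * z.2 + 0) = z.2 by rewrite addr0 mulrA divff ?mul1r// gt_eqF.
  rewrite /G /dilated [in LHS]a1 [in LHS]a2 /C.
  set W := hdot_log_weight _ _ _; set H := (_ ^+ 3 * _ ^+ 3)^-1.
  move: W H (osc_const Pa) (osc_const Pb) => W H oa ob; by field; rewrite gt_eqF.
have mG : measurable_fun (setT : set mplane) G.
  have -> : G = fun xi => C * q ^+ 3 * dilated q (q ^+ 2 * xi.1, q * xi.2).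
    apply/funext => xi; rewrite -Gdil /= !addr0 !mulKf ?gt_eqF ?exprn_gt0// -surjective_pairing.
  apply: measurable_funM => //; apply: (measurableT_comp (measurable_dilated q)).
  by apply: measurable_fun_pair; apply: measurable_funM.
apply: (@le_trans _ _ (\int[leb2 R]_xi (G xi)%:E)%E).
  apply: ge0_le_integral => //.
  - by move=> xi _; rewrite lee_fin mulr_ge0 ?hdot_log_weight_ge0 ?addr_ge0 ?sqr_ge0.
  - apply/measurable_EFinP; apply: measurable_funM; first exact: measurable_hdot_log_weight.
    have [mRe mIm] := measurable_fourier (continuous_measurable_plane (@continuous_packet R Pa Pb (2 * q ^+ 2 / tau)
      (q ^+ 2) p q)) (integrable_packet _ _ _ _ (exprn_gt0 2 q0) q0).
    by apply: measurable_funD; exact: measurable_funX.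
  - exact/measurable_EFinP.
  - move=> xi _; rewrite lee_fin ler_wpM2l ?hdot_log_weight_ge0//.
    by apply: packet_fourier_le => //; rewrite exprn_gt0.
have i2 : (q ^+ 2)^-1 != 0 by rewrite invr_neq0// gt_eqF// exprn_gt0.
have i1 : q^-1 != 0 by rewrite invr_neq0// gt_eqF.
have := @ge0_integral_affine2 R (q ^+ 2)^-1 0 q^-1 0 (EFin \o G) i2 i1.
move=> /(_ (ltac:(exact/measurable_EFinP)) (fun z => G0 z)) /=.
under eq_integral do rewrite Gdil.
under eq_integral do rewrite EFinM.
have md : measurable_fun (setT : set mplane) (fun z => (dilated q z)%:E).
  by apply/measurable_EFinP; exact: measurable_dilated.
have cq0 : 0 <= C * q ^+ 3 by rewrite mulr_ge0// exprn_ge0// ltW.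
rewrite ge0_integralZl//; last by move=> z _; rewrite lee_fin dilated_ge0.
rewrite !gtr0_norm ?invr_gt0 ?exprn_gt0// !invrK -exprSr => hI.
have q3 : 0 < q ^+ 3 by rewrite exprn_gt0.
have : (\int[leb2 R]_z (G z)%:E = C%:E * \int[leb2 R]_z (dilated q z)%:E)%E.
  have := congr1 (fun t => (q ^+ 3)^-1%:E * t)%E hI.
  rewrite !muleA -!EFinM mulVf ?gt_eqF// mul1e => <-.
  by congr (_%:E * _)%E; field; rewrite gt_eqF.
move=> ->; apply: (@le_trans _ _ (C%:E * (e / (C + 1))%:E)%E).
  by rewrite lee_wpmul2l.
rewrite -EFinM lee_fin mulrCA ger_pMr// ler_pdivrMr// mul1r lerDl//.
Unshelve. all: end_near. Qed.

End PacketNorm.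

(** * Superposition of packets *)

Section Superposition.
Variable R : realType.
Local Notation mplane := (measurableTypeR R * measurableTypeR R)%type.
Variable g : nat -> plane R -> R.
Hypotheses (mg : forall k, measurable_fun (setT : set mplane) (g k))
  (g_le1 : forall k y, `|g k y| <= 1)
  (g_box : forall k y, ~ (`[- 2, 2] `*` `[- 2, 2])%classic y -> g k y = 0)
  (g_disjoint : forall j k y, g j y != 0 -> g k y != 0 -> j = k).

(** The supports are disjoint, so the sum has at most one nonzero term; selecting it avoids a series
    of functions. *)
Definition superposition (y : plane R) : R :=
  if pselect (exists k, g k y != 0) is left h then g (sval (cid h)) y else 0.

Lemma superposition_eq k y : g k y != 0 -> superposition y = g k y.
Proof.
move=> gk; rewrite /superposition; case: pselect => [h|[]]; last by exists k.
by rewrite (g_disjoint (svalP (cid h)) gk).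
Qed.

Lemma superposition_eq0 y : (forall k, g k y = 0) -> superposition y = 0.
Proof. by move=> g0; rewrite /superposition; case: pselect => [h|//]; rewrite g0. Qed.

Let partial n y := \sum_(k < n) g k y.

Let partialE k n y : g k y != 0 -> partial n y = if (k < n)%N then g k y else 0.
Proof.
move=> gk; case: ifPn => [kn|]; last first.
  rewrite -leqNgt => nk; apply: big1 => i _; apply/eqP/negPn/negP => gi.
  by have := g_disjoint gi gk => ik; have := ltn_ord i; rewrite ik ltnNge nk.
rewrite /partial (bigD1 (Ordinal kn))//= big1 ?addr0// => i ik.
apply/eqP/negPn/negP => gi; move/negP: ik; apply.
by apply/eqP/val_inj; exact: g_disjoint gi gk.
Qed.

Let partial0 n y : (forall k, g k y = 0) -> partial n y = 0.
Proof. by move=> g0; apply: big1. Qed.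

Let cases y : (exists k, g k y != 0) \/ forall k, g k y = 0.
Proof.
have [h|h] := pselect (exists k, g k y != 0); [by left|right => k].
by apply/eqP/negPn/negP => gk; apply: h; exists k.
Qed.

Let partial_le1 n y : `|partial n y| <= 1.
Proof.
have [[k gk]|g0] := cases y; last by rewrite partial0// normr0.
by rewrite (partialE _ gk); case: ifP => // _; rewrite normr0.
Qed.

Let partial_box n y : ~ (`[- 2, 2] `*` `[- 2, 2])%classic y -> partial n y = 0.
Proof. by move=> yb; apply: big1 => k _; exact: g_box. Qed.

Let partial_cvg y : partial n y @[n --> \oo] --> superposition y.
Proof.
apply/cvgrPdist_le => e e0.
have [[k gk]|g0] := cases y; last first.
  by near=> n; rewrite partial0// superposition_eq0// subrr normr0 ltW.
near=> n; rewrite (partialE n gk) (superposition_eq gk) ifT ?subrr ?normr0 ?(ltW e0)//.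
by near: n; exact: nbhs_infty_gt.
Unshelve. all: end_near. Qed.

Let measurable_partial n : measurable_fun (setT : set mplane) (partial n).
Proof. by apply: measurable_sum => k; exact: mg. Qed.

Lemma superposition_le1 y : `|superposition y| <= 1.
Proof.
have [[k gk]|g0] := cases y; last by rewrite superposition_eq0// normr0.
by rewrite (superposition_eq gk).
Qed.

Lemma superposition_box y : ~ (`[- 2, 2] `*` `[- 2, 2])%classic y -> superposition y = 0.
Proof. by move=> yb; rewrite superposition_eq0// => k; exact: g_box. Qed.

Lemma measurable_superposition : measurable_fun (setT : set mplane) superposition.
Proof.
apply: (@measurable_fun_cvg _ mplane R setT partial) => // y _; exact: partial_cvg.
Qed.

Lemma integrable_superposition : (leb2 R).-integrable setT (EFin \o superposition).
Proof.
exact: (integrable_bounded_support measurable_superposition superposition_le1 superposition_box).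
Qed.

Let integrable_g k : (leb2 R).-integrable setT (EFin \o g k).
Proof. exact: (integrable_bounded_support (mg k) (g_le1 k) (g_box k)). Qed.

Section Coefficient.
Variable t : plane R -> R.
Hypotheses (mt : measurable_fun (setT : set mplane) t) (t1 : forall y, `|t y| <= 1).

Let integrable_t (h : plane R -> R) : measurable_fun (setT : set mplane) h ->
  (leb2 R).-integrable setT (EFin \o h) -> (leb2 R).-integrable setT (fun y => (h y * t y)%:E).
Proof.
move=> mh ih; apply: le_integrable ih => //.
  by apply/measurable_EFinP; exact: measurable_funM.
by move=> y _ /=; rewrite lee_fin normrM ler_piMr.
Qed.

Let int2_partial n : int2 (fun y => partial n y * t y) = \sum_(k < n) int2 (fun y => g k y * t y).
Proof.
elim: n => [|n IH].
  have -> : (fun y => partial 0 y * t y) = fun=> 0.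
    by apply/funext => y; rewrite /partial big_ord0 mul0r.
  by rewrite big_ord0 /int2 /Rintegral integral0.
rewrite big_ord_recr /= -IH -RintegralD//.
- by congr int2; apply/funext => y; rewrite /partial big_ord_recr /= mulrDl.
- apply: integrable_t => //.
  exact: (integrable_bounded_support (measurable_partial n) (partial_le1 n) (partial_box n)).
- exact: integrable_t.
Qed.

Let int2_superposition_cvg :
  \sum_(k < n) int2 (fun y => g k y * t y) @[n --> \oo] --> int2 (fun y => superposition y * t y).
Proof.
have mi (h : plane R -> R) : measurable_fun (setT : set mplane) h -> (forall y, `|h y| <= 1) ->
    (forall y, ~ (`[- 2, 2] `*` `[- 2, 2])%classic y -> h y = 0) ->
    (leb2 R).-integrable setT (fun y => (h y * t y)%:E).
  by move=> mh h1 hb; apply: integrable_t => //; exact: (integrable_bounded_support mh h1 hb).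
pose B := (`[- 2, 2] `*` `[- 2, 2])%classic : set mplane.
have mB : measurable B by apply: measurableX; exact: measurable_itv.
have iB : (leb2 R).-integrable setT (fun y => (\1_B y)%:E).
  have m1 : measurable_fun (setT : set mplane) (\1_B : plane R -> R) by exact: measurable_indic.
  apply: (integrable_bounded_support m1 (M := 1) (N := 2)).
    by move=> y; rewrite indicE; case: (_ \in _); rewrite ?normr1 ?normr0.
  by move=> y yB; rewrite indicE memNset.
have cv := @dominated_cvg _ mplane R (leb2 R) setT measurableT (fun n y => (partial n y * t y)%:E)
  (fun y => (superposition y * t y)%:E) (fun y => (\1_B y)%:E).
have {}cv : (\int[leb2 R]_y (partial n y * t y)%:E)%E @[n --> \oo] -->
    (\int[leb2 R]_y (superposition y * t y)%:E)%E.
  apply: cv => //.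
  - by move=> n; apply/measurable_EFinP; exact: measurable_funM.
  - move=> y _; apply: cvg_EFin; first by near=> n.
    by apply: cvgM; [exact: partial_cvg|exact: cvg_cst].
  - move=> n y _; rewrite abse_EFin lee_fin normrM indicE.
    have [yB|yB] := pselect (B y).
      by rewrite mem_set//; apply: mulr_ile1.
    by rewrite memNset// partial_box// normr0 mul0r.
rewrite -(fineK (integrable_fin_num measurableT (mi _ measurable_superposition superposition_le1
  superposition_box))) in cv.
rewrite [X in X n @[n --> _] --> _](_ : _ = fun n => fine (\int[leb2 R]_y (partial n y * t y)%:E)).
  exact: (fine_cvg cv).
by apply/funext => n; rewrite -int2_partial.
Unshelve. all: end_near. Qed.

(** Repeated use of [(x + s)^2 <= 2 x^2 + 2 s^2], peeling off the first term each time: hence the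
    weights [2 ^+ k.+1]. *)
Let sqr_sum_le (a : nat -> R) n : (\sum_(k < n) a k) ^+ 2 <= \sum_(k < n) (2 ^+ k.+1 * a k ^+ 2).
Proof.
elim: n a => [|n IH] a; first by rewrite !big_ord0 expr0n.
rewrite !big_ord_recl /=.
have h := IH (fun k => a k.+1).
set x := a 0%N; set s := \sum_(i < n) _ in h *.
have -> : \sum_(i < n) (2 ^+ (bump 0 i).+1 * a (bump 0 i) ^+ 2) =
    2 * \sum_(k < n) (2 ^+ k.+1 * a k.+1 ^+ 2).
  by rewrite big_distrr /=; apply: eq_bigr => i _; rewrite [in LHS]exprS mulrA.
rewrite expr1.
have : (x + s) ^+ 2 <= 2 * x ^+ 2 + 2 * s ^+ 2.
  have -> : 2 * x ^+ 2 + 2 * s ^+ 2 = (x + s) ^+ 2 + (x - s) ^+ 2 by ring.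
  by rewrite lerDl sqr_ge0.
by move: h; set r := \sum_(_ < n) _; lra.
Qed.

(** Pointwise in frequency this plays the part of the triangle inequality for an infinite sum;
    dominated convergence lets the coefficients of the partial sums pass to the limit. *)
Lemma superposition_coef_le : ((int2 (fun y => superposition y * t y) ^+ 2)%:E <=
  \sum_(k <oo) (2 ^+ k.+1 * int2 (fun y => g k y * t y) ^+ 2)%:E)%E.
Proof.
set S := (X in (_ <= X)%E).
have cv : ((\sum_(k < n) int2 (fun y => g k y * t y)) ^+ 2)%:E @[n --> \oo] -->
    (int2 (fun y => superposition y * t y) ^+ 2)%:E.
  apply: cvg_EFin; first by near=> n.
  exact: (cvgM int2_superposition_cvg int2_superposition_cvg).
rewrite -(cvg_lim (@ereal_hausdorff R) cv).
apply: lime_le; first by apply/cvg_ex; exists (int2 (fun y => superposition y * t y) ^+ 2)%:E.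
near=> n.
apply: (@le_trans _ _ (\sum_(k < n) (2 ^+ k.+1 * int2 (fun y => g k y * t y) ^+ 2))%:E).
  by rewrite lee_fin; exact: (sqr_sum_le (fun k => int2 (fun y => g k y * t y)) n).
rewrite -sumEFin -(big_mkord xpredT (fun k => (2 ^+ k.+1 * int2 (fun y => g k y * t y) ^+ 2)%:E)).
by apply: nneseries_lim_ge => k _; rewrite lee_fin mulr_ge0 ?sqr_ge0// exprn_ge0.
Unshelve. all: end_near. Qed.

End Coefficient.

(** The weights [2 ^+ k.+1] against the shares [C ^+ 2 / 4 ^+ k.+1] leave a geometric series with
    sum [C ^+ 2]. *)
Lemma superposition_norm_le (w : plane R -> R) (C : R) : measurable_fun (setT : set mplane) w ->
  (forall xi, 0 <= w xi) -> 0 <= C ->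
  (forall k, (\int[leb2 R]_xi (w xi * (complex.Re (fourier_integral (g k) xi) ^+ 2
      + complex.Im (fourier_integral (g k) xi) ^+ 2))%:E <= (C ^+ 2 / 4 ^+ k.+1)%:E)%E) ->
  (weighted_norm w superposition <= C%:E)%E.
Proof.
move=> mw w0 C0 hk.
have mG := measurable_superposition; have iG := integrable_superposition.
rewrite (weighted_normE mw w0 (is_fourier_integrable mG iG)).
have -> : C%:E = sqrte (C ^+ 2)%:E by rewrite /= sqrtr_sqr ger0_norm.
rewrite lee_sqrt ?lee_fin ?sqr_ge0//.
have mdot xi : measurable_fun (setT : set mplane) (fun y => 2 * pi * dot2 y xi).
  apply: measurable_funM => //; apply: measurable_funD; apply: measurable_funM => //.
have mcos xi : measurable_fun (setT : set mplane) (fun y => cos (2 * pi * dot2 y xi)).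
  by apply: (measurableT_comp (continuous_measurable_fun (@continuous_cos R))).
have msin xi : measurable_fun (setT : set mplane) (fun y => - sin (2 * pi * dot2 y xi)).
  apply: measurableT_comp => //.
  by apply: (measurableT_comp (continuous_measurable_fun (@continuous_sin R))).
have ReE h xi : complex.Re (fourier_integral h xi) = int2 (fun y => h y * cos (2 * pi * dot2 y xi)).
  exact: Re_fourier_integral.
have ImE h xi : complex.Im (fourier_integral h xi) = int2 (fun y => h y * - sin (2 * pi * dot2 y xi)).
  by rewrite Im_fourier_integral; congr int2; apply/funext => y; rewrite mulrN.
pose e k xi := w xi * (complex.Re (fourier_integral (g k) xi) ^+ 2
      + complex.Im (fourier_integral (g k) xi) ^+ 2).
have e0 k xi : 0 <= e k xi by rewrite mulr_ge0// addr_ge0 ?sqr_ge0.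
have me k : measurable_fun (setT : set mplane) (e k).
  have [m1 m2] := measurable_fourier (mg k) (integrable_g k).
  by apply: measurable_funM => //; apply: measurable_funD; exact: measurable_funX.
apply: (@le_trans _ _ (\int[leb2 R]_xi (\sum_(k <oo) (2 ^+ k.+1 * e k xi)%:E))%E).
  apply: ge0_le_integral => //.
  - by move=> xi _; rewrite lee_fin mulr_ge0// addr_ge0 ?sqr_ge0.
  - have [m1 m2] := measurable_fourier mG iG.
    apply/measurable_EFinP; apply: measurable_funM => //.
    by apply: measurable_funD; exact: measurable_funX.
  - apply: (@ge0_emeasurable_sum _ mplane R setT (fun k xi => (2 ^+ k.+1 * e k xi)%:E) xpredT) => [k xi _ _|k _].
      by rewrite lee_fin mulr_ge0// exprn_ge0.
    by apply/measurable_EFinP; exact: measurable_funM.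
  - move=> xi _; rewrite EFinM.
    have hR := superposition_coef_le (mcos xi) (fun y => ltac:(by rewrite ler_norml cos_geN1 cos_le1)).
    have hI := superposition_coef_le (msin xi) (fun y => ltac:(by rewrite normrN ler_norml sin_geN1 sin_le1)).
    rewrite -ReE in hR; rewrite -ImE in hI.
    have pos (f : nat -> R) k : (0 <= (2 ^+ k.+1 * f k ^+ 2)%:E)%E.
      by rewrite lee_fin mulr_ge0 ?sqr_ge0// exprn_ge0.
    apply: (@le_trans _ _ ((w xi)%:E * (\sum_(k <oo) (2 ^+ k.+1 * complex.Re (fourier_integral (g k) xi) ^+ 2)%:E +
        \sum_(k <oo) (2 ^+ k.+1 * complex.Im (fourier_integral (g k) xi) ^+ 2)%:E))%E).
      apply: lee_wpmul2l; first by rewrite lee_fin.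
      rewrite EFinD; apply: leeD.
        apply: (le_trans hR); apply: lee_nneseries => [k _ _|k _]; last by rewrite ReE.
        by rewrite lee_fin mulr_ge0 ?sqr_ge0// exprn_ge0.
      apply: (le_trans hI); apply: lee_nneseries => [k _ _|k _]; last by rewrite ImE.
        by rewrite lee_fin mulr_ge0 ?sqr_ge0// exprn_ge0.
    rewrite -nneseriesD; [|by move=> k _ _; exact: (pos (fun k => complex.Re (fourier_integral (g k) xi)))
      |by move=> k _ _; exact: (pos (fun k => complex.Im (fourier_integral (g k) xi)))].
    rewrite -nneseriesZl; last first.
      by move=> k _; rewrite -EFinD -mulrDr lee_fin mulr_ge0 ?exprn_ge0// addr_ge0 ?sqr_ge0.
    apply: lee_nneseries => [k _ _|k _]; rewrite -EFinD -EFinM lee_fin -mulrDr mulrCA//.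
    by apply: mulr_ge0; [exact: exprn_ge0|exact: e0].
rewrite integral_nneseries//; last 2 first.
- by move=> k; apply/measurable_EFinP; exact: measurable_funM.
- by move=> k xi _; rewrite lee_fin mulr_ge0// exprn_ge0.
apply: (@le_trans _ _ (\sum_(k <oo) (C ^+ 2 / 2 ^+ k.+1)%:E)%E).
  apply: lee_nneseries => [k _ _|k _].
    by apply: integral_ge0 => xi _; rewrite lee_fin mulr_ge0// exprn_ge0.
  under eq_integral do rewrite EFinM.
  have mek : measurable_fun (setT : set mplane) (fun xi => (e k xi)%:E) by exact/measurable_EFinP.
  have ek0 xi : (setT : set mplane) xi -> (0 <= (e k xi)%:E)%E by rewrite lee_fin.
  have p0 : (0 <= (2 ^+ k.+1 : R)%:E)%E by rewrite lee_fin exprn_ge0.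
  rewrite (ge0_integralZl _ measurableT mek ek0 p0).
  apply: (le_trans (lee_wpmul2l _ (hk k))); first by rewrite lee_fin exprn_ge0.
  rewrite -EFinM lee_fin le_eqVlt; apply/orP; left; apply/eqP.
  have -> : (4 : R) = 2 * 2 by ring.
  by rewrite exprMn; field; rewrite expf_neq0.
apply: lime_le.
  by apply: is_cvg_nneseries => k _ _; rewrite lee_fin divr_ge0 ?sqr_ge0 ?exprn_ge0.
near=> n; rewrite big_mkord sumEFin lee_fin.
have -> : \sum_(i < n) C ^+ 2 / 2 ^+ i.+1 = C ^+ 2 * (1 - (2 ^+ n)^-1).
  elim: (n) => [|m IH]; first by rewrite big_ord0 expr0 invr1 subrr mulr0.
  rewrite big_ord_recr /= IH [2 ^+ m.+1]exprS.
  have : (2 ^+ m : R) != 0 by rewrite expf_neq0.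
  by move: (2 ^+ m) => z z0; field.
by rewrite ler_piMr ?sqr_ge0// gerBl invr_ge0 exprn_ge0.
Unshelve. all: end_near. Qed.

End Superposition.

(** * Mollified data *)

Lemma profile_lipschitz (R : realType) (P : profile R) :
  exists2 L, 0 <= L & forall x y, `|pf0 P x - pf0 P y| <= L * `|x - y|.
Proof.
have c1 : continuous (pf1 P) by move=> x; exact: derive_continuous (pf_d1 P x).
have [L L0 hL] := continuous_support_bounded c1 (fun x h => let: And3 _ e _ := pf_out h in e).
exists L => //.
have le (x y : R) : y <= x -> `|pf0 P x - pf0 P y| <= L * `|x - y|.
  move=> yx; have [|c _ ->] := @MVT_segment R (pf0 P) (pf1 P) y x yx (fun z _ => pf_d0 P z).
    by apply: continuous_subspaceT => z; exact: derive_continuous (pf_d0 P z).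
  by rewrite normrM ler_wpM2r.
move=> x y; have [yx|xy] := leP y x; first exact: le.
by rewrite distrC [`|x - y|]distrC le// ltW.
Qed.

Section Mollification.
Variable R : realType.
Local Notation mplane := (measurableTypeR R * measurableTypeR R)%type.
Variables (phi G : plane R -> R) (N : R).
Hypotheses (tphi : test_function setT phi) (mG : measurable_fun (setT : set mplane) G)
  (G1 : forall y, `|G y| <= 1)
  (GN : forall y, ~ (`[- N, N] `*` `[- N, N])%classic y -> G y = 0).

(** Substituting [y = x - e z] puts the dependence on [e] into the argument of [G], where the local
    shape of the data is known. *)
Lemma convolution_mollifierE (e : R) x : 0 < e ->
  convolution (mollifier phi e) G x = int2 (fun z => phi z * G (x.1 - e * z.1, x.2 - e * z.2)).
Proof.
move=> e0; have eN0 : e != 0 by rewrite gt_eqF.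
have [M [K [_ phiM _]]] := test_function_bounded tphi.
pose f (y : plane R) := mollifier phi e (x - y) * G y.
have m1 : measurable_fun (setT : set mplane) (fun y => y.1 : R) by exact: measurable_fst.
have m2 : measurable_fun (setT : set mplane) (fun y => y.2 : R) by exact: measurable_snd.
have mf : measurable_fun (setT : set mplane) f.
  apply: measurable_funM => //; apply: measurable_funM => //.
  apply: (measurableT_comp (test_function_measurable tphi)).
  have md1 : measurable_fun (setT : set mplane) (fun y => x.1 - y.1) by exact: measurable_funB.
  have md2 : measurable_fun (setT : set mplane) (fun y => x.2 - y.2) by exact: measurable_funB.
  apply: measurable_fun_pair; apply: measurable_funM => //.
have fi : (leb2 R).-integrable setT (EFin \o f).
  apply: (@integrable_bounded_support R f (e ^- 2 * M) N mf) => y.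
    rewrite -[leRHS]mulr1 normrM ler_pM// normrM ger0_norm ?invr_ge0 ?sqr_ge0//.
    by rewrite ler_wpM2l ?invr_ge0 ?sqr_ge0.
  by move=> yN; rewrite /f GN// mulr0.
have neN0 : - e != 0 by rewrite oppr_eq0.
have := int2_affine x.1 x.2 neN0 neN0 mf fi; rewrite normrN gtr0_norm// => h.
rewrite /convolution -/f.
have -> : int2 f = e ^+ 2 * int2 (fun z => f (- e * z.1 + x.1, - e * z.2 + x.2)).
  by rewrite h; field.
have -> : (fun z => f (- e * z.1 + x.1, - e * z.2 + x.2)) =
    fun z => e ^- 2 * (phi z * G (x.1 - e * z.1, x.2 - e * z.2)).
  apply/funext => z; rewrite /f /mollifier /=.
  have -> : e^-1 * (x.1 - (- e * z.1 + x.1)) = z.1 by field.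
  have -> : e^-1 * (x.2 - (- e * z.2 + x.2)) = z.2 by field.
  by rewrite -surjective_pairing !mulNr [- (e * z.1) + _]addrC [- (e * z.2) + _]addrC mulrA.
rewrite /int2 RintegralZl//; last first.
  apply: le_integrable (test_function_integrable tphi) => //.
    apply/measurable_EFinP; apply: measurable_funM; first exact: test_function_measurable.
    apply: (measurableT_comp mG); apply: measurable_fun_pair.
      by apply: measurable_funB => //; exact: measurable_funM.
    by apply: measurable_funB => //; exact: measurable_funM.
  by move=> z _ /=; rewrite lee_fin normrM ler_piMr.
by rewrite mulrA divff ?mul1r// expf_neq0.
Qed.

End Mollification.

(** * Breakdown for mollified data near one packet *)

Section NoSmoothSolution.
Variables (R : realType) (Pa : profile R) (T tau q p : R) (G phi : plane R -> R).
Local Notation mplane := (measurableTypeR R * measurableTypeR R)%type.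
Local Notation delta := (q ^+ 2).
Hypotheses (Pa1 : pfL Pa = 1) (Pa0 : pf0 Pa 0 = 1) (Pa_01 : forall x, 0 <= pf0 Pa x <= 1).
Hypotheses (tau0 : 0 < tau) (tau_small : tau <= 1 / 16) (q0 : 0 < q) (q_small : 22 * q <= tau)
  (tauT : tau < T).
Hypotheses (mG : measurable_fun (setT : set mplane) G) (G1 : forall y, `|G y| <= 1)
  (G2 : forall y, ~ (`[- 2, 2] `*` `[- 2, 2])%classic y -> G y = 0).
Let A := 2 * delta / tau.
Let Gam x := A * pf0 Pa (x / delta).
(** In the band [|x2 - p| <= 3 tau] only one packet lives, and it does not depend on x2 where
    [|x2 - p| <= 20 q]. For [|x1| > delta] both sides vanish, which explains the inner
    implication. *)
Hypothesis G_shape : forall z : plane R, `|z.2 - p| <= 3 * tau ->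
  (`|z.1| <= delta -> `|z.2 - p| <= 20 * q) -> G z = Gam z.1.
Hypotheses (tphi : test_function setT phi) (phi1 : int2 phi = 1).

Let mu := 4 * delta / tau.

Let delta0 : 0 < delta. Proof. by rewrite exprn_gt0. Qed.
Let A0 : 0 < A. Proof. by rewrite divr_gt0// mulr_gt0. Qed.
Let deltaq : 22 * delta <= tau * q.
Proof. by rewrite expr2 mulrA ler_wpM2r// ltW. Qed.
Let taudelta : 484 * delta <= tau ^+ 2.
Proof.
have -> : 484 * delta = (22 * q) ^+ 2 by ring.
by rewrite ler_pXn2r ?nnegrE ?mulr_ge0 ?(ltW q0) ?(ltW tau0).
Qed.
Let deltatau : 7744 * delta <= tau.
Proof.
have : tau ^+ 2 <= 1 / 16 * tau by rewrite expr2 ler_wpM2r// ltW.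
by move: taudelta; lra.
Qed.

Let base x y : 0 < cone (2 * tau + 62 * delta) (1 + 10 * mu) (2 * tau) p (0, x, y) ->
  `|y - p| <= 2 * tau + 62 * delta /\ (`|x| <= 2 * delta -> `|y - p| <= 18 * q).
Proof.
rewrite /cone /= mulr0 subr0 subr_gt0 => h.
have r0 : 0 <= 2 * tau + 62 * delta by move: tau0 delta0; lra.
have s1 := sqr_ge0 (x - 2 * tau).
split.
  rewrite -[leRHS]ger0_norm// -ler_sqr ?nnegrE// !real_normK ?num_real//.
  by move: h s1; lra.
rewrite ler_norml => /andP[x1 x2].
have q18 : 0 <= 18 * q by rewrite mulr_ge0// ltW.
rewrite -[leRHS]ger0_norm// -ler_sqr ?nnegrE// !real_normK ?num_real//.
(* The squared half chord of the disc at abscissa [x]: of the two factors, the first is at most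
   [64 * delta] and the second at most [324 / 64]. *)
have h2 : (y - p) ^+ 2 <= (62 * delta + x) * (4 * tau + 62 * delta - x).
  have -> : (62 * delta + x) * (4 * tau + 62 * delta - x) =
    (2 * tau + 62 * delta) ^+ 2 - (x - 2 * tau) ^+ 2 by ring.
  by move: h; lra.
apply: (le_trans h2).
apply: (@le_trans _ _ (64 * delta * (4 * tau + 64 * delta))).
  by apply: ler_pM; move: tau0 delta0 x1 x2; lra.
have -> : (18 * q) ^+ 2 = 64 * delta * (324 / 64) by field.
apply: ler_wpM2l; first by rewrite mulr_ge0// ltW.
by move: deltatau tau_small tau0; lra.
Qed.

(** Mollification and the shift [h] each move a coordinate by at most [delta <= q]: the strip of
    half-width [2 * delta] in [base] shrinks to [delta], and the bound [18 * q] grows to [20 * q],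
    as [G_shape] demands. *)
Lemma mollified_shape (M e x y h : R) (z : plane R) : 0 < e -> e * M <= delta ->
  (`[- M, M] `*` `[- M, M])%classic z -> `|h| < delta ->
  0 < cone (2 * tau + 62 * delta) (1 + 10 * mu) (2 * tau) p (0, x, y) ->
  G (x - e * z.1, y + h - e * z.2) = Gam (x - e * z.1).
Proof.
move=> e0 eM [/= z1 z2] hh /base[yr yq].
have ez (s : R) : s \in `[- M, M]%R -> `|e * s| <= delta.
  rewrite in_itv/= => /andP[s1 s2]; rewrite normrM gtr0_norm//.
  by apply: le_trans eM; rewrite ler_wpM2l ?(ltW e0)// ler_norml s1 s2.
have e1 := ez _ z1; have e2 := ez _ z2.
have qd : delta <= q.
  by move: deltaq; have : tau * q <= 1 * q; [apply: ler_wpM2r; move: q0 tau_small; lra|move: delta0; lra].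
have yy : y + h - e * z.2 - p = (y - p) + (h - e * z.2) by ring.
have hd : `|h - e * z.2| <= 2 * delta.
  by apply: le_trans (ler_normB _ _) _; move: hh e2; lra.
apply: G_shape => /=.
  rewrite yy; apply: le_trans (ler_normD _ _) _.
  by move: yr hd deltatau tau0; lra.
move=> x1; rewrite yy; apply: le_trans (ler_normD _ _) _.
have : `|y - p| <= 18 * q.
  apply: yq; have -> : x = (x - e * z.1) + e * z.1 by ring.
  by apply: le_trans (ler_normD _ _) _; move: x1 e1; lra.
by move: hd qd; lra.
Qed.

(** In the disc the mollified datum is a function [c] of x1 within [A / 8] of [Gam], in particular
    bounded by [mu = 2 * A]. As [Gam] rises by [A] from [- delta] to 0, [c] rises by at least
    [3 / 4 * A], more than [delta / tau = A / 2], contrary to [smooth_solution_shock]. *)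
Lemma no_smooth_solution : exists2 e1, 0 < e1 & forall e f u, 0 < e -> e < e1 ->
  (forall x, f x = 0) -> ~ smooth_solution T f (convolution (mollifier phi e) G) u.
Proof.
have [L L0 hL] := profile_lipschitz Pa.
have [B [M [M0 _ phiM]]] := test_function_bounded tphi.
pose K := int2 (fun z => `|phi z|).
have iphi := test_function_integrable tphi.
have K0 : 0 <= K by rewrite /K /int2; apply: Rintegral_ge0.
(* [e * D < delta] yields both [e * M <= delta], for [mollified_shape], and
   [8 * K * L * (e * M) <= delta], for the distance [A / 8] of [c] from [Gam]. *)
pose D := M * (1 + 8 * K * L).
have D0 : 0 < D by rewrite mulr_gt0// ltr_wpDr// !mulr_ge0.
exists (delta / D); first by rewrite divr_gt0.
move=> e f u e0 ed f0 su.
rewrite ltr_pdivlMr// in ed.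
have KL0 : 0 <= 8 * K * L by rewrite !mulr_ge0.
have eM0 : 0 < e * M by rewrite mulr_gt0.
have eD : e * D = e * M + e * M * (8 * K * L) by rewrite /D; ring.
have eM : e * M <= delta.
  by have := mulr_ge0 (ltW eM0) KL0; move: ed; rewrite eD; lra.
have eK : 8 * K * (A * L / delta * (e * M)) <= A.
  have -> : 8 * K * (A * L / delta * (e * M)) = A * (e * M * (8 * K * L) / delta).
    by field; rewrite gt_eqF.
  by rewrite ger_pMr// ler_pdivrMr// mul1r; move: ed; rewrite eD; move: eM0; lra.
pose c (x : R) := int2 (fun z => phi z * Gam (x - e * z.1)).
have convE x y h : `|h| < delta ->
    0 < cone (2 * tau + 62 * delta) (1 + 10 * mu) (2 * tau) p (0, x, y) ->
    convolution (mollifier phi e) G (x, y + h) = c x.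
  move=> hh cn; rewrite (convolution_mollifierE tphi mG G1 G2 _ e0); congr int2; apply/funext => z /=.
  have [zM|zM] := pselect ((`[- M, M] `*` `[- M, M])%classic z); last by rewrite phiM// !mul0r.
  by rewrite (mollified_shape e0 eM zM hh cn).
have h00 : `|0 : R| < delta by rewrite normr0.
have cGam : continuous Gam.
  have c1 : continuous (fun x : R => pf0 Pa (x / delta)).
    move=> x; apply: (@continuous_comp _ _ _ (fun x : R => x / delta) (pf0 Pa)).
      by apply: continuousM; [exact: cvg_id|exact: cst_continuous].
    exact: derive_continuous (pf_d0 Pa _).
  by move=> x; exact: (continuousM (@cst_continuous _ _ A x) (c1 x)).
have Gam_bound x : 0 <= Gam x <= A.
  have /andP[a0 a1] := Pa_01 (x / delta).
  by rewrite /Gam mulr_ge0 ?(ltW A0)//= ler_piMr// ltW.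
have Gam_lip x y : `|Gam x - Gam y| <= A * L / delta * `|x - y|.
  have i0 : 0 < delta^-1 by rewrite invr_gt0.
  have := hL (x / delta) (y / delta); rewrite -[x / _ - _]mulrBl normrM (gtr0_norm i0) => h.
  have -> : A * L / delta * `|x - y| = A * (L * (`|x - y| / delta)) by ring.
  by rewrite /Gam -mulrBr normrM (gtr0_norm A0); apply: ler_wpM2l => //; exact: ltW.
have near_c x : `|c x - Gam x| <= A / 8.
  have mGam : measurable_fun (setT : set mplane) (fun z => Gam (x - e * z.1)).
    apply: (measurableT_comp (continuous_measurable_fun cGam)).
    by apply: measurable_funB => //; apply: measurable_funM => //; exact: measurable_fst.
  have mphi := test_function_measurable tphi.
  have i1 : (leb2 R).-integrable setT (fun z => (phi z * Gam (x - e * z.1))%:E).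
    apply: le_integrable (integrableZl measurableT A iphi) => //.
      by apply/measurable_EFinP; exact: measurable_funM.
    move=> z _ /=; rewrite lee_fin normrM [leRHS]normrM mulrC ler_wpM2r//.
    have /andP[b0 b1] := Gam_bound (x - e * z.1).
    by rewrite (ger0_norm b0) (gtr0_norm A0).
  have i2 : (leb2 R).-integrable setT (fun z => (Gam x * phi z)%:E) by exact: (integrableZl measurableT (Gam x) iphi).
  have -> : c x - Gam x = int2 (fun z => phi z * Gam (x - e * z.1) - Gam x * phi z).
    rewrite /int2 RintegralB//; congr (_ - _).
    by rewrite RintegralZl// -/(int2 phi) phi1 mulr1.
  have iB : (leb2 R).-integrable setT (EFin \o (fun z => phi z * Gam (x - e * z.1) - Gam x * phi z)).
    exact: (integrableB measurableT i1 i2).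
  have iN : (leb2 R).-integrable setT (EFin \o (fun z => `|phi z|)) by exact: integrable_norm.
  apply: le_trans (le_normr_Rintegral measurableT iB) _.
  apply: (@le_trans _ _ (int2 (fun z => A * L / delta * (e * M) * `|phi z|))).
    apply: le_Rintegral => //.
    - exact: (integrable_norm iB).
    - exact: (integrableZl measurableT (A * L / delta * (e * M)) iN).
    move=> z _; have [zM|zM] := pselect ((`[- M, M] `*` `[- M, M])%classic z); last first.
      by rewrite phiM// mul0r mulr0 subrr normr0 mulr0.
    rewrite [Gam x * _]mulrC -mulrBr normrM mulrC ler_wpM2r//.
    apply: le_trans (Gam_lip _ _) _.
    apply: ler_wpM2l; first by apply: divr_ge0; [apply: mulr_ge0 => //|]; exact: ltW.
    have -> : x - e * z.1 - x = - (e * z.1) by ring.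
    case: zM => /= + _; rewrite in_itv/= => /andP[z1 z2].
    by rewrite normrN normrM gtr0_norm// ler_wpM2l ?(ltW e0)// ler_norml z1 z2.
  rewrite /int2 RintegralZl//.
  by rewrite -/(int2 _) -/K; move: eK; lra.
have in0 : 0 < cone (2 * tau + 62 * delta) (1 + 10 * mu) (2 * tau) p (0, 0, p).
  rewrite /cone /= mulr0 subr0 subrr expr0n addr0 sub0r sqrrN subr_gt0.
  by rewrite ltr_pXn2r ?nnegrE//; move: tau0 delta0; lra.
have in1 : 0 < cone (2 * tau + 62 * delta) (1 + 10 * mu) (2 * tau) p (0, - delta, p).
  rewrite /cone /= mulr0 subr0 subrr expr0n addr0 -[(- delta - _) ^+ 2]sqrrN subr_gt0.
  by rewrite ltr_pXn2r ?nnegrE//; move: tau0 delta0; lra.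
have mutau : mu * tau = 4 * delta by rewrite /mu; field; rewrite gt_eqF.
have mus : mu <= 1 / 100 by rewrite ler_pdivrMr//; move: deltatau tau0; lra.
have muA : mu = 2 * A by rewrite /mu /A; ring.
have : convolution (mollifier phi e) G (0, p) - convolution (mollifier phi e) G (- delta, p) < delta / tau.
  apply: (@smooth_solution_shock R T tau delta mu p delta f _ u) => //.
    move=> x y h hh cn; rewrite (convE _ _ _ hh cn).
    by have := convE _ _ _ h00 cn; rewrite addr0.
  move=> x y cn; have := convE _ _ _ h00 cn; rewrite addr0 => ->.
  have := near_c x; have := Gam_bound x; rewrite !ler_norml muA => /andP[? ?] /andP[? ?].
  by apply/andP; split; move: A0; lra.
have := convE _ _ _ h00 in0; rewrite addr0 => ->.
have := convE _ _ _ h00 in1; rewrite addr0 => ->.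
have Gam0 : Gam 0 = A by rewrite /Gam mul0r Pa0 mulr1.
have Gam1 : Gam (- delta) = 0.
  rewrite /Gam mulNr divff ?gt_eqF//; have [|-> _ _] := @pf_out R Pa (- 1); last by rewrite mulr0.
  by rewrite Pa1 normrN normr1.
have dA : delta / tau = A / 2 by rewrite /A; field; rewrite gt_eqF.
have := near_c 0; have := near_c (- delta).
rewrite Gam0 Gam1 dA !ler_norml => /andP[? ?] /andP[? ?].
by move: A0; lra.
Qed.

End NoSmoothSolution.

Lemma scaled_neq0 (R : realType) (P : profile R) (sg p x : R) : 0 < sg -> scaled P sg p x != 0 ->
  `|x - p| <= pfL P * sg.
Proof.
move=> sg0; apply: contraR; rewrite -ltNge => h; apply/eqP/scaled_out => //.
rewrite /= in_itv/= => /andP[h1 h2]; move: h; rewrite ltNge => /negP; apply.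
by rewrite ler_norml; apply/andP; split; lra.
Qed.

(** Neighbouring centres differ by a factor 2, which leaves room between the bands. The enlarged
    factor 3 covers the whole base of the cone of packet [k], so that no other packet reaches into
    it. *)
Lemma dyadic_gap (R : realType) (j k : nat) (y : R) : j != k ->
  `|y - 2 ^- j| <= 2 ^- j / 16 -> `|y - 2 ^- k| <= 3 * (2 ^- k / 16) -> False.
Proof.
have P n : 0 < 2 ^- n :> R by rewrite invr_gt0 exprn_gt0.
have lt m n : (m < n)%N -> 2 ^- n <= 2 ^- m / 2 :> R.
  move=> mn; rewrite -invfM -exprSr lef_pV2 ?posrE ?exprn_gt0//.
  by rewrite ler_weXn2l// ler1n.
rewrite neq_ltn !ler_norml => /orP[] /lt + /andP[h1 h2] /andP[h3 h4].
  by have := P j; have := P k; move: h1 h2 h3 h4; lra.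
by have := P j; have := P k; move: h1 h2 h3 h4; lra.
Qed.

Lemma convolution0 (R : realType) (h : plane R -> R) x : convolution h (fun=> 0) x = 0.
Proof.
rewrite /convolution /int2 /Rintegral.
by under eq_integral do rewrite mulr0; rewrite integral0.
Qed.

Lemma zero_weighted (R : realType) (s b : R) :
  Hdot_log s b (fun=> 0 : R) /\ hdot_log_norm s b (fun=> 0 : R) = 0%E.
Proof.
have mw := @measurable_hdot_log_weight R s b.
have m0 : measurable_fun (setT : set (measurableTypeR R * measurableTypeR R)) (fun=> 0 : R) by [].
have i0 : (leb2 R).-integrable setT (EFin \o (fun=> 0 : R)) by exact: integrable0.
have F0 := is_fourier_integrable m0 i0.
have n0 : hdot_log_norm s b (fun=> 0 : R) = 0%E.
  rewrite /hdot_log_norm (weighted_normE mw (@hdot_log_weight_ge0 R s b) F0).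
  have z xi : complex.Re (fourier_integral (fun=> 0 : R) xi) = 0 /\
      complex.Im (fourier_integral (fun=> 0 : R) xi) = 0.
    rewrite Re_fourier_integral Im_fourier_integral /int2 /Rintegral.
    by split; rewrite integral0_eq// => y _; rewrite ?mul0r ?oppr0.
  rewrite integral0_eq ?sqrte0// => xi _; have [-> ->] := z xi.
  by rewrite expr0n addr0 mulr0.
split=> //; split; first by exists (fourier_integral (fun=> 0)).
by rewrite -/(hdot_log_norm s b _) n0 ltry.
Qed.

Theorem theorem1p4 (R : realType) (beta : R) (hbeta : 1 / 2 < beta)
    (eta : R) (heta : 0 < eta) :
  exists f g : plane R -> R,
    [/\ Hdot_log (11 / 4) beta f /\ Hdot_log (7 / 4) beta g,
        compactly_supported_in setT f /\ compactly_supported_in setT g,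
        (hdot_log_norm (11 / 4) beta f + hdot_log_norm (7 / 4) beta g
           <= eta%:E)%E,
        forall T : R, 0 < T ->
          ~ exists u ut : spacetime R -> R,
              [/\ proper_solution T f g u ut,
                  C_Hdot_log (11 / 4) beta T u &
                  C_Hdot_log (7 / 4) beta T ut] &
        exists2 lambda0 : R, 0 < lambda0 &
          forall lambda : R, 0 < lambda < lambda0 ->
          forall T : R, 0 < T ->
          ~ exists u ut : spacetime R -> R,
              [/\ proper_solution T f g u ut,
                  C_Hdot (11 / 4 - lambda) T u &
                  C_Hdot (7 / 4 - lambda) T ut]].
Proof.
have [Pa [PaL Pa0 Pa_01]] := exists_peak R.
have [Pb [PbL Pb1 Pb_01]] := exists_plateau R.
pose tau (k : nat) : R := 2 ^- k / 16.
have pow0 k : 0 < 2 ^- k :> R by rewrite invr_gt0 exprn_gt0.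
have pow1 k : 2 ^- k <= 1 :> R by rewrite invf_le1 ?exprn_gt0// exprn_ege1// ler1n.
have tau0 k : 0 < tau k by rewrite divr_gt0.
have tau1 k : tau k <= 1 / 16 by rewrite ler_wpM2r.
(* The width is chosen after [tau k]: for fixed [tau k] a narrow packet has squared norm below its
   share [eta ^+ 2 / 4 ^+ k.+1], and the superposition then has norm at most [eta]. *)
have [N HN] : {N : nat -> nat & forall k, let q : R := (N k).+1%:R^-1 in 22 * q <= tau k /\
    forall p, let g := packet Pa Pb (2 * q ^+ 2 / tau k) (q ^+ 2) p q in
    (\int[leb2 R]_xi (hdot_log_weight (7 / 4) beta xi * (complex.Re (fourier_integral g xi) ^+ 2
      + complex.Im (fourier_integral g xi) ^+ 2))%:E <= (eta ^+ 2 / 4 ^+ k.+1)%:E)%E}.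
  apply: (@choice _ _ (fun k n => let q : R := n.+1%:R^-1 in 22 * q <= tau k /\ _)) => k.
  have e0 : 0 < eta ^+ 2 / 4 ^+ k.+1 by rewrite divr_gt0// exprn_gt0.
  have := packet_norm_cvg hbeta Pa Pb (tau0 k) e0.
  have : \forall n \near \oo, 22 * (n.+1%:R^-1 : R) <= tau k.
    near=> n; rewrite ler_pdivrMr ?ltr0n// -ler_pdivrMl//.
    apply: (@le_trans _ _ n%:R); last by rewrite ler_nat.
    by near: n; exact: nbhs_infty_ger.
  move=> h1 h2; have [n [a b]] := filter_ex (filterI h1 h2).
  by exists n; split.
pose q k : R := (N k).+1%:R^-1.
have q0 k : 0 < q k by rewrite invr_gt0 ltr0n.
have q22 k : 22 * q k <= tau k by have [] := HN k.
have q1 k : q k <= 1 by have := q22 k; have := tau1 k; have := q0 k; lra.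
have d0 k : 0 < q k ^+ 2 by rewrite exprn_gt0.
have d1 k : q k ^+ 2 <= q k by rewrite expr2 ler_piMr// ltW.
pose p k : R := 2 ^- k.
pose g k := packet Pa Pb (2 * q k ^+ 2 / tau k) (q k ^+ 2) (p k) (q k).
pose G := superposition g.
have s01 (P : profile R) sg c x : (forall x, 0 <= pf0 P x <= 1) -> `|scaled P sg c x| <= 1.
  by move=> P01; have /andP[a b] := P01 ((x - c) / sg); rewrite ger0_norm.
have supp k y : g k y != 0 -> `|y.1| <= q k ^+ 2 /\ `|y.2 - p k| <= tau k.
  rewrite /g /packet !mulf_eq0 !negb_or => /andP[_ /andP[/(scaled_neq0 (d0 k)) a /(scaled_neq0 (q0 k)) b]].
  rewrite PaL mul1r subr0 in a; rewrite PbL in b; split => //.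
  exact: le_trans b (q22 k).
have mg k : measurable_fun (setT : set (measurableTypeR R * measurableTypeR R)) (g k).
  by apply: continuous_measurable_plane; exact: continuous_packet.
have g1 k y : `|g k y| <= 1.
  rewrite /g /packet normrM; apply: mulr_ile1 => //; last by rewrite normrM mulr_ile1// s01.
  have A0 : 0 < 2 * q k ^+ 2 / tau k by apply: divr_gt0 => //; exact: mulr_gt0.
  rewrite (gtr0_norm A0) ler_pdivrMr// mul1r.
  by have := q22 k; have := d1 k; have := q0 k; lra.
have gbox k y : ~ (`[- 2, 2] `*` `[- 2, 2])%classic y -> g k y = 0.
  move=> yb; apply/eqP/negPn/negP => /supp[]; rewrite !ler_norml => /andP[a1 a2] /andP[b1 b2].
  have := q1 k; have := d1 k; have := tau1 k; have := pow1 k; have := pow0 k; rewrite -/(p k) => ? ? ? ? ?.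
  by apply: yb; split => /=; rewrite in_itv/=; apply/andP; split; lra.
have gdis j k y : g j y != 0 -> g k y != 0 -> j = k.
  move=> /supp[_ gj] /supp[_ gk]; apply/eqP/negPn/negP => jk.
  by apply: (dyadic_gap jk gj); apply: (le_trans gk); have := tau0 k; rewrite /tau; lra.
have mG : measurable_fun (setT : set (measurableTypeR R * measurableTypeR R)) G.
  exact: measurable_superposition mg gdis.
have G1 : forall y, `|G y| <= 1 by exact: superposition_le1.
have Gbox : forall y, ~ (`[- 2, 2] `*` `[- 2, 2])%classic y -> G y = 0 by exact: superposition_box.
have Gnorm : (hdot_log_norm (7 / 4) beta G <= eta%:E)%E.
  apply: (superposition_norm_le mg g1 gbox gdis) => //.
  - exact: measurable_hdot_log_weight.
  - exact: hdot_log_weight_ge0.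
  - exact: ltW.
  - by move=> k; have [_ /(_ (p k))] := HN k.
(* One approximant [un n], with [eps n] below the threshold [e1] of a packet with [tau k < T], gives
   the contradiction for both nonexistence claims. *)
have no_proper T u ut : 0 < T -> ~ proper_solution T (fun=> 0) G u ut.
  move=> T0 [_ [phi [eps [un [[tphi phi1] [eps0 epsl] sol _]]]]].
  have [k kT] : exists k, tau k < T.
    have : (2^-1 : R) ^+ n @[n --> \oo] --> (0 : R) by apply: cvg_expr; rewrite ger0_norm ?invr_ge0// invf_lt1// ltr1n.
    move=> /cvgrPdist_lt/(_ _ T0) /filter_ex[k]; rewrite sub0r normrN ger0_norm ?exprn_ge0 ?invr_ge0//.
    rewrite exprVn => h; exists k; rewrite /tau; apply: le_lt_trans h.
    by have := pow0 k; lra.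
  have shape z : `|z.2 - p k| <= 3 * tau k -> (`|z.1| <= q k ^+ 2 -> `|z.2 - p k| <= 20 * q k) ->
      G z = 2 * q k ^+ 2 / tau k * pf0 Pa (z.1 / q k ^+ 2).
    move=> z3 z20.
    have GE : G z = g k z.
      have [gk|gk] := eqVneq (g k z) 0; last exact: superposition_eq.
      rewrite gk; apply: superposition_eq0 => j; apply/eqP/negPn/negP => gj.
      have [jk|jk] := eqVneq j k; first by rewrite jk gk eqxx in gj.
      by have [_ gj2] := supp _ _ gj; exact: (dyadic_gap jk gj2 z3).
    rewrite GE /g /packet; congr (_ * _).
    rewrite {1}/scaled subr0.
    have [z1|z1] := leP `|z.1| (q k ^+ 2).
      rewrite /scaled Pb1 ?mulr1// normrM normfV (gtr0_norm (q0 k)) ler_pdivrMr//.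
      exact: z20.
    have [|-> _ _] := @pf_out R Pa (z.1 / q k ^+ 2); last by rewrite mul0r.
    by rewrite PaL normrM normfV (gtr0_norm (d0 k)) ler_pdivlMr// mul1r ltW.
  have [e1 e10 he] := no_smooth_solution PaL Pa0 Pa_01 (tau0 k) (tau1 k) (q0 k) (q22 k) kT mG G1 Gbox
    shape tphi phi1.
  move/cvgrPdist_lt : epsl => /(_ _ e10)/filter_ex[n].
  rewrite sub0r normrN gtr0_norm// => en.
  exact: (he _ _ _ (eps0 n) en (@convolution0 _ _) (sol n)).
have [H0 norm0] := zero_weighted (11 / 4) beta.
exists (fun=> 0), G; split.
- split; first exact: H0.
  split; last exact: (le_lt_trans Gnorm (ltry eta)).
  exists (fourier_integral G); apply: (is_fourier_integrable mG).
  exact: integrable_bounded_support mG G1 Gbox.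
- split.
    by exists set0; split => //; exact: compact0.
  exists (`[- 2, 2] `*` `[- 2, 2])%classic; split => //.
  by apply: compact_setX; exact: segment_compact.
- by rewrite norm0 add0e.
- by move=> T T0 [u [ut [/no_proper h _ _]]]; exact: h T0.
- by exists 1 => // lambda _ T T0 [u [ut [/no_proper h _ _]]]; exact: h T0.
Unshelve. all: end_near. Qed.
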